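(* Taking closures in $\mathrm{Bir}_2$, one has $$\overline{\Sigma^0}=\Sigma^0,\qquad \overline{\Sigma^1}=\Sigma^0\cup\Sigma^1,\qquad \overline{\Sigma^2}=\Sigma^0\cup\Sigma^1\cup\Sigma^2,$$ $$\mathring{\mathrm{B}}\mathrm{ir}_2=\Sigma^1\cup\Sigma^2\cup\Sigma^3,\qquad \mathrm{Bir}_2=\overline{\Sigma^3}=\Sigma^0\cup\Sigma^1\cup\Sigma^2\cup\Sigma^3,$$ with $$\dim\Sigma^0=10,\quad \dim\Sigma^1=12,\quad \dim\Sigma^2=13,\quad \dim\Sigma^3=14.$$
   Context: $\mathrm{Rat}_2\simeq\mathbb{P}^{17}(\mathbb{C})$ is the projectivization of the vector space of triples $(f_0,f_1,f_2)$ of homogeneous polynomials of degree $2$ in $\mathbb{C}[x_0,x_1,x_2]$. $\mathrm{Bir}_2\subset\mathrm{Rat}_2$ is the set of those $f=(f_0:f_1:f_2)$ such that the rational map $f^\bullet$ of $\mathbb{P}^2(\mathbb{C})$ obtained by dividing the $f_i$ by their gcd is birational, and $\mathring{\mathrm{B}}\mathrm{ir}_2\subset\mathrm{Bir}_2$ is the subset of those $f$ for which $f_0,f_1,f_2$ have no common factor. The group $\mathrm{PGL}_3(\mathbb{C})\times\mathrm{PGL}_3(\mathbb{C})$ acts on $\mathrm{Rat}_2$ by $(A,B)\cdot f=AfB^{-1}$ (left-right action). $\Sigma^3,\Sigma^2,\Sigma^1$ are the orbits under this action of $\sigma=(x_1x_2:x_0x_2:x_0x_1)$, $\rho=(x_0x_1:x_2^2:x_1x_2)$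 and $\tau=(x_0^2:x_0x_1:x_1^2-x_0x_2)$ respectively, and $\Sigma^0=\{\ell(\ell_0:\ell_1:\ell_2)\}$, where $\ell\neq0,\ell_0,\ell_1,\ell_2$ are linear forms with $\ell_0,\ell_1,\ell_2$ linearly independent. *)

(* Defs.v *)
From mathcomp Require Import all_boot all_order all_algebra.
From mathcomp Require Import boolp classical_sets reals.
From mathcomp Require Import complex.
From mathcomp Require Import mpoly.

Set Implicit Arguments.
Unset Strict Implicit.
Unset Printing Implicit Defensive.

Import GRing.Theory.
Local Open Scope ring_scope.
Local Open Scope classical_set_scope.

Section ProjectiveSpace.
Context {K : fieldType} {V : vectType K}.

(* A point of P(V) is a line of V. *)
Definition proj : Type := {L : {vspace V} | \dim L == 1%N}.

(* [v] represents [L] in homogeneous coordinates (so [v != 0]). *)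
Definition represents (v : V) (L : proj) : Prop := sval L = <[v]>%VS.

(* The Zariski topology is independent of the basis chosen here to view
   elements of {mpoly K[\dim V]} as polynomial functions on V. *)
Definition polyfun (p : {mpoly K[\dim {:V}]}) (v : V) : K :=
  p.@[fun i => coord (vbasis {:V}) i v].

Definition zero_locus (S : set {mpoly K[\dim {:V}]}) : set proj :=
  [set L | forall p v, S p -> represents v L -> polyfun p v = 0].

Definition zclosed (Z : set proj) : Prop :=
  exists S : set {mpoly K[\dim {:V}]},
    (forall p, S p -> exists d, p \is d.-homog) /\ Z = zero_locus S.

(* Closure of [X] in the subspace [Y] (with X contained in Y). *)
Definition zclosure_in (Y X : set proj) : set proj :=
  [set L | Y L /\ forall Z, zclosed Z -> X `<=` Z -> Z L].

Definition zclosed_in (X F : set proj) : Prop :=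
  exists2 Z, zclosed Z & F = X `&` Z.

Definition zirreducible_in (X F : set proj) : Prop :=
  [/\ zclosed_in X F, F !=set0 &
      forall F1 F2, zclosed_in X F1 -> zclosed_in X F2 ->
        F = F1 `|` F2 -> F = F1 \/ F = F2].

(* c 0 < c 1 < ... < c n, all irreducible and closed in X *)
Definition irreducible_chain (X : set proj) (n : nat) (c : nat -> set proj) :=
  (forall i, (i <= n)%N -> zirreducible_in X (c i)) /\
  (forall i, (i < n)%N -> c i `<` c i.+1).

(* The Krull dimension of the subspace X is d. *)
Definition has_dim (X : set proj) (d : nat) : Prop :=
  (exists c, irreducible_chain X d c) /\
  (forall n c, irreducible_chain X n c -> (n <= d)%N).

End ProjectiveSpace.
Arguments proj {K} V.

Section RationalMaps.
Context {K : fieldType}.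

Definition triple := 'I_3 -> {mpoly K[3]}.

Definition homog_triple (F : triple) : Prop :=
  exists d, forall i, F i \is d.-homog.

Definition nonzero_triple (F : triple) : Prop := exists i, F i != 0.

(* F_0, F_1, F_2 have no common factor besides the nonzero constants; for
   F = 0 this fails, as 0 is then a common factor. *)
Definition no_common_factor (F : triple) : Prop :=
  forall h : {mpoly K[3]},
    (forall i, exists q, F i = h * q) -> h \is a GRing.unit.

(* Two nonzero homogeneous triples define the same rational map of P^2. *)
Definition same_map (F G : triple) : Prop :=
  forall i j, F i * G j = F j * G i.

Definition comp_triple (G F : triple) : triple :=
  fun i => G i \mPo [tuple F j | j < 3].

Definition id_triple : triple := fun i => 'X_i.

(* The composite G o F is defined as a rational map and is the identity. *)
Definition left_inverse_map (G F : triple) : Prop :=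
  nonzero_triple (comp_triple G F) /\ same_map (comp_triple G F) id_triple.

Definition birational (F : triple) : Prop :=
  [/\ homog_triple F, nonzero_triple F &
      exists G : triple, [/\ homog_triple G, nonzero_triple G,
        left_inverse_map G F & left_inverse_map F G]].

(* F is f divided by the gcd of f_0, f_1, f_2. *)
Definition reduction (f F : triple) : Prop :=
  no_common_factor F /\ exists h : {mpoly K[3]}, forall i, f i = h * F i.

End RationalMaps.
Arguments triple K : clear implicits.

Section QuadraticMaps.
Context {K : fieldType}.

Lemma dhomog1_mul (p q : dhomog 3 K 1) :
  (p : {mpoly K[3]}) * q \is 2.-homog.
Proof. exact: (dhomogM (dhomog_is_dhomog p) (dhomog_is_dhomog q)). Qed.

(* product of two linear forms *)
Definition lmul (p q : dhomog 3 K 1) : dhomog 3 K 2 :=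
  DHomog (dhomog1_mul p q).

Lemma linear_sub_homog (B : 'M[K]_3) k :
  \sum_l B k l *: ('X_l : {mpoly K[3]}) \is 1.-homog.
Proof.
apply: rpred_sum => l _; apply: rpredZ.
by rewrite dhomogX /= mdeg1.
Qed.

(* x |-> B x on column vectors *)
Definition linear_sub (B : 'M[K]_3) : 3.-tuple {mpoly K[3]} :=
  [tuple \sum_l B k l *: 'X_l | k < 3].

Lemma comp_linear_homog (B : 'M[K]_3) d (p : dhomog 3 K d) :
  (p : {mpoly K[3]}) \mPo linear_sub B \is d.-homog.
Proof.
rewrite comp_mpolyE big_seq; apply: rpred_sum => m mp; apply: rpredZ.
have <- : mdeg m = d by exact: (dhomogP _ _ _ (dhomog_is_dhomog p)).
rewrite mdegE; elim/big_ind2: _ => [|? ? ? ? |i _].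
- exact: dhomog1.
- exact: dhomogM.
have := dhomogMn (m i) (linear_sub_homog B i).
by rewrite mul1n tnth_mktuple.
Qed.

Definition comp_linear (B : 'M[K]_3) d (p : dhomog 3 K d) : dhomog 3 K d :=
  DHomog (comp_linear_homog B p).

(* Triples of ternary quadratic forms; Rat_2 is the projectivization. *)
Definition quadtriple : vectType K := {ffun 'I_3 -> dhomog 3 K 2}.

Definition triple_of (f : quadtriple) : triple K :=
  fun i => mpoly_of_dhomog (f i).

Definition Rat2 : Type := proj quadtriple.

Definition Bir2 : set Rat2 :=
  [set L | exists2 f : quadtriple, represents f L &
    exists2 F, reduction (triple_of f) F & birational F].

(* the subset of Bir_2 of maps without common factor *)
Definition oBir2 : set Rat2 :=
  [set L | Bir2 L /\
    exists2 f : quadtriple, represents f L & no_common_factor (triple_of f)].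

(* A f B^-1 *)
Definition lract (A B : 'M[K]_3) (f : quadtriple) : quadtriple :=
  [ffun i => \sum_j A i j *: comp_linear (invmx B) (f j)].

(* Scalar matrices act trivially on Rat_2, so that the orbits of
   PGL_3 x PGL_3 are those of GL_3 x GL_3. *)
Definition lrorbit (f : quadtriple) : set Rat2 :=
  [set L | exists A B : 'M[K]_3,
    [/\ A \in unitmx, B \in unitmx & represents (lract A B f) L]].

Lemma var_homog (i : 'I_3) : ('X_i : {mpoly K[3]}) \is 1.-homog.
Proof. by rewrite dhomogX /= mdeg1. Qed.

Definition var (i : 'I_3) : dhomog 3 K 1 := DHomog (var_homog i).
Definition x0 := var (@Ordinal 3 0 isT).
Definition x1 := var (@Ordinal 3 1 isT).
Definition x2 := var (@Ordinal 3 2 isT).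

Definition mkquad (a b c : dhomog 3 K 2) : quadtriple :=
  [ffun i : 'I_3 => tnth [tuple a; b; c] i].

Definition sigma := mkquad (lmul x1 x2) (lmul x0 x2) (lmul x0 x1).
Definition rho := mkquad (lmul x0 x1) (lmul x2 x2) (lmul x1 x2).
Definition tau := mkquad (lmul x0 x0) (lmul x0 x1) (lmul x1 x1 - lmul x0 x2).

Definition Sigma3 : set Rat2 := lrorbit sigma.
Definition Sigma2 : set Rat2 := lrorbit rho.
Definition Sigma1 : set Rat2 := lrorbit tau.
Definition Sigma0 : set Rat2 :=
  [set L | exists (l l0 l1 l2 : dhomog 3 K 1),
    [/\ l != 0, free [:: l0; l1; l2] &
        represents (mkquad (lmul l l0) (lmul l l1) (lmul l l2)) L]].

End QuadraticMaps.
Arguments quadtriple K : clear implicits.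
Arguments Rat2 K : clear implicits.
Arguments Bir2 K : clear implicits.
Arguments oBir2 K : clear implicits.
Arguments Sigma0 K : clear implicits.
Arguments Sigma1 K : clear implicits.
Arguments Sigma2 K : clear implicits.
Arguments Sigma3 K : clear implicits.

(* Main.v *)
Require Import Defs.
From mathcomp Require Import all_boot all_order all_algebra.
From mathcomp Require Import boolp classical_sets reals.
From mathcomp Require Import complex.
From mathcomp Require Import mpoly.
From mathcomp Require Import ring zify.

(** The closure relations come from invariants and degenerations.  An element of
    Sigma^0 is a collineation up to a factor, so det (f x, f y, f (x + y)) vanishes
    identically on Sigma^0, but for no f in the other orbits.  The Jacobian cubic of
    f is a triple line on Sigma^1, contains a double line on Sigma^2 and consists of
    three lines without a common point on Sigma^3; being a cube, and having vanishing
    discriminant on all lines, are closed conditions.  Conversely each orbit is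
    reached from the next larger one along a line in Rat_2.

    Let f be birational without common factor.  Its rational inverse gives f a
    rational section over every general line.  The net of conics has a singular
    member, and a map of degree 2 between lines has no rational section, so f has a
    base point.  When it is (0 : 0 : 1), f = z (x P + y Q) + q(x, y) with vectors P
    and Q; if these are dependent then f is in Sigma^1 or Sigma^2, and otherwise in
    Sigma^2 or Sigma^3, because in all other cases there are again no sections.

    Along a chain of irreducible closed subsets of length n one finds n + 1
    algebraically independent homogeneous functions; counting monomials shows that
    there are at most d + 1 of them on a cone covered by finitely many polynomial
    charts in d + 1 parameters.  A chain of length d is given by the closures of the
    images of a flag of coordinate subspaces, under a polynomial parametrization in d
    parameters with injective tangent map at the origin. *)

Set Implicit Arguments.
Unset Strict Implicit.
Unset Printing Implicit Defensive.

Import GRing.Theory Num.Theory.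
Local Open Scope ring_scope.
Local Notation widen := (widen_ord (leqnSn _)).

(** The field is infinite, so triples of forms are handled through their values on column vectors:
    equalities are checked pointwise and become ring identities, and a change of coordinates is a
    composition with matrices. Sections replace intersection numbers and infinitely near points: a
    section over a line is a triple of polynomials in one variable, and most excluded cases end in
    an identity [U = z W] between binary forms, refuted by degrees. The obstacle is that the inverse
    gives sections only over general lines, whereas the singular conic lies over a special one; the
    passage to the limit works under the very assumption to be refuted, that there is no base point.
    The closed conditions also hold outside the orbits, so closures are read off only once [Bir2] is
    known to be the union of the orbits. The dimensions are [8 + 6], [8 + 5], [8 + 4], [8 + 2]:
    matrices [A] up to scalars, plus matrices [M] modulo those whose effect on the normal form is
    undone by some [A]. Lower bounds use a linear complement of the tangent space to the latter,
    upper bounds a list of normal forms for [M]. *)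

Lemma poly_eval_eq0 (K : numDomainType) (p : {poly K}) :
  (forall z, p.[z] = 0) -> p = 0.
Proof.
move=> p0; apply/eqP; apply: contraT => pn0.
pose s : seq K := [seq i%:R | i <- iota 0 (size p)].
have us : uniq s by rewrite map_inj_uniq ?iota_uniq //; exact: mulrIn (oner_neq0 _).
have rs : all (root p) s by apply/allP => z _; apply/rootP.
by have := max_poly_roots pn0 rs us; rewrite size_map size_iota ltnn.
Qed.

Lemma poly_eval_inj (K : numDomainType) (p q : {poly K}) :
  (forall z, p.[z] = q.[z]) -> p = q.
Proof.
by move=> pq; apply/subr0_eq/poly_eval_eq0 => z; rewrite !hornerE pq subrr.
Qed.

Lemma muni_meval (R : comNzRingType) n (p : {mpoly R[n.+1]}) (v : 'I_n.+1 -> R) :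
  p.@[v] = (map_poly (meval (v \o widen)) (muni p)).[v ord_max].
Proof.
rewrite muniE mevalE raddf_sum horner_sum; apply: eq_bigr => m _ /=.
rewrite map_polyZ /= map_polyXn hornerZ hornerXn mevalZ mevalX -mulrA.
congr (_ * _); rewrite big_ord_recr /=; congr (_ * _).
by apply: eq_bigr => i _; rewrite mnmE.
Qed.

Lemma muni_eq0 (R : comNzRingType) n (p : {mpoly R[n.+1]}) : muni p = 0 -> p = 0.
Proof.
move=> p0.
have -> : p = (map_poly (@mwiden n R) (muni p)).['X_ord_max].
  rewrite muniE {1}(mpolyE p) raddf_sum horner_sum; apply: eq_bigr => m _ /=.
  rewrite map_polyZ /= map_polyXn hornerZ hornerXn mwidenZ -scalerAl.
  congr (_ *: _); rewrite mwidenX mpolyXn -mpolyXD; congr 'X_[_].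
  apply/mnmP => i; rewrite mnmDE mulmnE mnm1E.
  case: (unliftP ord_max i) => [j ->|->].
    have -> : lift ord_max j = widen j.
      by apply/val_inj; rewrite /= /bump leqNgt ltn_ord.
    rewrite mnmwiden_widen mnmE -val_eqE /= gtn_eqF ?ltn_ord // mul0n addn0.
    by [].
  by rewrite mnmwiden_ordmax eqxx mul1n.
by rewrite p0 rmorph0 horner0.
Qed.

Lemma mpoly_eval_eq0 (K : numDomainType) n (p : {mpoly K[n]}) :
  (forall v, p.@[v] = 0) -> p = 0.
Proof.
elim: n p => [|n IH] p p0.
  rewrite (nvar0_mpolyC p) in p0 *.
  by move: (p0 (fun=> 0)); rewrite mevalC => ->; rewrite mpolyC0.
apply/muni_eq0/polyP => k; rewrite coef0; apply: IH => v.
pose v' z (i : 'I_n.+1) := if unlift ord_max i is Some j then v j else z.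
have v'w z : v' z \o widen =1 v.
  move=> i /=; rewrite /v'; have -> : widen i = lift ord_max i.
    by apply/val_inj; rewrite /= /bump leqNgt ltn_ord.
  by rewrite liftK.
have q0 : map_poly (meval v) (muni p) = 0.
  apply: poly_eval_eq0 => z; rewrite -[RHS](p0 (v' z)) muni_meval.
  rewrite {2}/v' unlift_none; congr (_.[_]).
  by apply: eq_map_poly => q; apply: meval_eq => i; rewrite v'w.
by move/polyP/(_ k): q0; rewrite coef_map coef0.
Qed.

Lemma mpoly_eval_inj (K : numDomainType) n (p q : {mpoly K[n]}) :
  (forall v, p.@[v] = q.@[v]) -> p = q.
Proof.
by move=> pq; apply/subr0_eq/mpoly_eval_eq0 => v; rewrite mevalB pq subrr.
Qed.

Lemma dhomog_mevalZ (R : comNzRingType) n d (p : {mpoly R[n]}) (c : R) v :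
  p \is d.-homog -> p.@[fun i => c * v i] = c ^+ d * p.@[v].
Proof.
move=> /dhomogP pd; rewrite !mevalE mulr_sumr !big_seq.
apply: eq_bigr => m /pd md; rewrite mulrCA; congr (_ * _).
rewrite -md [X in c ^+ X](mdegE m) -prodrXr -big_split /=.
by apply: eq_bigr => i _; rewrite exprMn.
Qed.

(* Along the line through v, the homogeneous components are the coefficients. *)
Lemma pihomog_meval_eq0 (K : numFieldType) n (p : {mpoly K[n]}) v :
  (forall c, c != 0 -> p.@[fun i => c * v i] = 0) ->
  forall d, (pihomog mdeg d p).@[v] = 0.
Proof.
move=> p0 d.
pose q : {poly K} := \sum_(d < msize p) (pihomog mdeg d p).@[v] *: 'X^d.
have qE c : q.[c] = p.@[fun i => c * v i].
  rewrite [in RHS](pihomog_partitionE (mf := mdeg) (leqnn (msize p))).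
  rewrite rmorph_sum horner_sum; apply: eq_bigr => i _ /=.
  by rewrite (dhomog_mevalZ c v (pihomogP mdeg i p)) !hornerE mulrC.
(* The factor ['X] removes the value at [0], about which the hypothesis says nothing; the device
   recurs wherever an identity is only known off [0]. *)
have q0 : 'X * q = 0.
  apply: poly_eval_eq0 => z; rewrite !hornerE.
  by have [->|z0] := eqVneq z 0; rewrite ?mul0r // qE p0 ?mulr0.
move/eqP: q0; rewrite mulf_eq0 polyX_eq0 /= => /eqP/polyP/(_ d).
rewrite coef0 coef_sum; have [ltd <-|led _] := ltnP d (msize p).
  rewrite (bigD1 (Ordinal ltd)) //= coefZ coefXn eqxx mulr1.
  rewrite big1 ?addr0 // => i /eqP ne; rewrite coefZ coefXn.
  by case: eqP => [e|_]; rewrite ?mulr0 //; case: ne; apply/val_inj.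
rewrite pihomogE big_seq_cond big_pred0 ?meval0 // => m.
apply/negbTE/negP => /andP[/msize_mdeg_lt lt /eqP e].
by move: led; rewrite -e leqNgt lt.
Qed.

Lemma mpoly_along_polys (R : comNzRingType) n (q : {mpoly R[n]})
    (s : 'I_n -> {poly R}) :
  {r : {poly R} | forall z, r.[z] = q.@[fun a => (s a).[z]]}.
Proof.
exists (mmap (@polyC R) s q) => z.
rewrite mevalE horner_sum; apply: eq_bigr => m _.
rewrite !hornerE; congr (_ * _); rewrite /mmap1 horner_prod.
by apply: eq_bigr => i _; rewrite horner_exp.
Qed.

(** * Polynomial functions and algebraic dependence *)

Section PolynomialFunctions.
Context {K : numFieldType}.
Implicit Types I J : finType.

(** Any finite type may index the variables, so that parameter spaces built as sums and products of
    ordinals need no renumbering. *)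
Definition polynomial_fun I (phi : (I -> K) -> K) : Prop :=
  exists p : {mpoly K[#|I|]}, forall t, phi t = p.@[t \o enum_val].

Lemma polynomial_fun_mpoly I m (P : {mpoly K[m]}) (phi : 'I_m -> (I -> K) -> K) :
  (forall a, polynomial_fun (phi a)) ->
  polynomial_fun (fun t => P.@[fun a => phi a t]).
Proof.
move=> /choice[q qE]; exists (P \mPo [tuple q a | a < m]) => t.
by rewrite comp_mpoly_meval; apply: meval_eq => a; rewrite tnth_mktuple -qE.
Qed.

Lemma polynomial_fun_comp I J (phi : (I -> K) -> K) (f : (J -> K) -> I -> K) :
  polynomial_fun phi -> (forall i, polynomial_fun (f^~ i)) ->
  polynomial_fun (phi \o f).
Proof.
move=> [p pE] fP.
have [q qE] := polynomial_fun_mpoly p (fun a => fP (enum_val a)).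
by exists q => t; rewrite -qE /= pE.
Qed.

Lemma polynomial_fun_cst I (c : K) : polynomial_fun (fun _ : I -> K => c).
Proof. by exists c%:MP => t; rewrite mevalC. Qed.

Lemma polynomial_fun_var I (i : I) : polynomial_fun (fun t : I -> K => t i).
Proof. by exists 'X_(enum_rank i) => t; rewrite mevalXU /= enum_rankK. Qed.

Lemma polynomial_funD I (f g : (I -> K) -> K) :
  polynomial_fun f -> polynomial_fun g -> polynomial_fun (fun t => f t + g t).
Proof. by move=> [p pE] [q qE]; exists (p + q) => t; rewrite mevalD pE qE. Qed.

Lemma polynomial_funM I (f g : (I -> K) -> K) :
  polynomial_fun f -> polynomial_fun g -> polynomial_fun (fun t => f t * g t).
Proof. by move=> [p pE] [q qE]; exists (p * q) => t; rewrite mevalM pE qE. Qed.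

Lemma polynomial_funN I (f : (I -> K) -> K) :
  polynomial_fun f -> polynomial_fun (fun t => - f t).
Proof. by move=> [p pE]; exists (- p) => t; rewrite mevalN pE. Qed.

Lemma polynomial_fun_sum I (J : Type) (s : seq J) (P : pred J)
    (f : J -> (I -> K) -> K) :
  (forall j, polynomial_fun (f j)) ->
  polynomial_fun (fun t => \sum_(j <- s | P j) f j t).
Proof.
move=> fP; elim: s => [|j s [q qE]].
  by exists 0 => t; rewrite big_nil meval0.
have [p pE] := fP j.
exists ((if P j then p else 0) + q) => t.
by rewrite big_cons mevalD -qE; case: (P j); rewrite ?pE // meval0 add0r.
Qed.

Lemma polynomial_fun_prod I (J : Type) (s : seq J) (P : pred J)
    (f : J -> (I -> K) -> K) :
  (forall j, polynomial_fun (f j)) ->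
  polynomial_fun (fun t => \prod_(j <- s | P j) f j t).
Proof.
move=> fP; elim: s => [|j s [q qE]].
  by exists 1 => t; rewrite big_nil meval1.
have [p pE] := fP j.
exists ((if P j then p else 1) * q) => t.
by rewrite big_cons mevalM -qE; case: (P j); rewrite ?pE // meval1 mul1r.
Qed.

(** This is the irreducibility of affine space: polynomials form an integral domain, and one that
    vanishes at all points is zero. *)
Lemma polynomial_fun_mul_eq0 I (f g : (I -> K) -> K) :
  polynomial_fun f -> polynomial_fun g -> (forall t, f t * g t = 0) ->
  (forall t, f t = 0) \/ (forall t, g t = 0).
Proof.
move=> [p pE] [q qE] fg0.
have /eqP : p * q = 0.
  apply: mpoly_eval_eq0 => v; rewrite -[RHS](fg0 (v \o enum_rank)) pE qE mevalM.
  by congr (_ * _); apply: meval_eq => i; rewrite /= enum_valK.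
rewrite mulf_eq0 => /orP[] /eqP e; [left|right] => t.
  by rewrite pE e meval0.
by rewrite qE e meval0.
Qed.

End PolynomialFunctions.

Section AlgebraicDependence.
Context {K : numFieldType}.

(** Independence is tested on the points of [S], in place of a transcendence degree of a function
    field. *)
Definition alg_indep_on (T : Type) (S : T -> Prop) m (y : 'I_m -> T -> K) : Prop :=
  forall P : {mpoly K[m]},
    (forall v, S v -> P.@[fun a => y a v] = 0) -> P = 0.

Lemma msize_prodX_le n m (q : 'I_m -> {mpoly K[n]}) (e : 'I_m -> nat) D N :
  (forall a, msize (q a) <= D.+1)%N -> (forall a, e a <= N)%N ->
  (msize (\prod_a q a ^+ e a) <= (m * (N * D)).+1)%N.
Proof.
move=> qD eN.
have mulD (p1 p2 : {mpoly K[n]}) a b : (msize p1 <= a.+1)%N ->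
    (msize p2 <= b.+1)%N -> (msize (p1 * p2)%R <= (a + b).+1)%N.
  have [->|n1] := eqVneq p1 0; first by rewrite mul0r msize0.
  have [->|n2] := eqVneq p2 0; first by rewrite mulr0 msize0.
  move=> h1 h2; rewrite msizeM //.
  by have := leq_add h1 h2; rewrite addSn addnS; case: (_ + _)%N => // k; rewrite ltnS.
have expD (p : {mpoly K[n]}) k : (msize p <= D.+1)%N -> (msize (p ^+ k) <= (k * D).+1)%N.
  move=> h; elim: k => [|k IH]; first by rewrite expr0 msize1.
  by rewrite exprS mulSn; apply: mulD.
suff H (s : seq 'I_m) : (msize (\prod_(a <- s) q a ^+ e a) <= (size s * (N * D)).+1)%N.
  by have := H (index_enum _); rewrite -[index_enum _]enumT size_enum_ord.
elim: s => [|a s IH]; first by rewrite big_nil msize1.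
rewrite big_cons /= mulSn; apply: mulD => //.
by apply: (leq_trans (expD _ _ (qD a))); rewrite ltnS leq_mul2r eN orbT.
Qed.

(* Counting: the monomials with exponents below N in n + 1 polynomials in n
   variables span a space of dimension at most (C N) ^ n, fewer than N ^ n.+1. *)
Lemma mpoly_dependent n (q : 'I_n.+1 -> {mpoly K[n]}) :
  exists2 P : {mpoly K[n.+1]}, P != 0 &
    forall v, P.@[fun a => (q a).@[v]] = 0.
Proof.
pose D := (\max_a msize (q a))%N.
have qD a : (msize (q a) <= D.+1)%N by apply: leqW; apply: leq_bigmax.
(* The products [Y e] have degree below [B], so they lie in a space of dimension
   [B ^ n = C ^ n * N ^ n]; this is less than the number [N ^ n.+1] of products because
   [C ^ n < N]. *)
pose C := (n.+1 * D).+1; pose N := (C ^ n).+1; pose B := (C * N)%N.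
pose E : finType := {ffun 'I_n.+1 -> 'I_N}; pose F : finType := {ffun 'I_n -> 'I_B}.
pose Y (e : E) := \prod_a q a ^+ e a.
pose mF (f : F) : 'X_{1..n} := [multinom (f i : nat) | i < n].
pose mE (e : E) : 'X_{1..n.+1} := [multinom (e i : nat) | i < n.+1].
have YB e (m : 'X_{1..n}) i : (B <= m i)%N -> (Y e)@_m = 0.
  move=> Bm; apply: memN_msupp_eq0; apply: msize_mdeg_ge.
  have mi : (m i <= mdeg m)%N by rewrite mdegE (bigD1 i) //= leq_addr.
  apply: leq_trans mi; apply: leq_trans Bm.
  apply: leq_trans (msize_prodX_le qD (N := N) _) _ => [a|].
    exact: ltnW (ltn_ord _).
  have -> : (n.+1 * (N * D) = n.+1 * D * N)%N by rewrite mulnCA mulnC.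
  by rewrite /B /C mulSn; exact: (leq_add (isT : 1 <= N)%N (leqnn _)).
pose A : 'M[K]_(#|E|, #|F|) := \matrix_(i, j) (Y (enum_val i))@_(mF (enum_val j)).
have ltFE : (#|F| < #|E|)%N.
  rewrite !card_ffun !card_ord /B expnMn expnS ltn_pmul2r ?expn_gt0 //.
have /rowV0Pn[a /sub_kermxP aA an0] : kermx A != 0.
  rewrite kermx_eq0 -row_leq_rank -ltnNge.
  by apply: leq_ltn_trans ltFE; exact: rank_leq_col.
have Y0 : \sum_i a 0 i *: Y (enum_val i) = 0.
  apply/mpolyP => m; rewrite mcoeff0 raddf_sum /=.
  have [mB|] := pselect (forall i, (m i < B)%N); last first.
    move=> nB; have /existsNP[i /negP] := nB; rewrite -leqNgt => Bm.
    by rewrite big1 // => j _; rewrite mcoeffZ (YB _ _ _ Bm) mulr0.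
  pose f : F := [ffun i => Ordinal (mB i)].
  have -> : m = mF f by apply/mnmP => i; rewrite mnmE ffunE.
  have := congr1 (fun M : 'rV_ _ => M 0 (enum_rank f)) aA; rewrite !mxE => e.
  rewrite -[RHS]e; apply: eq_bigr => i _.
  by rewrite mcoeffZ mxE enum_rankK.
exists (\sum_i a 0 i *: 'X_[mE (enum_val i)]).
  apply: contraNneq an0 => P0; apply/eqP/rowP => i; rewrite mxE.
  move/(congr1 (mcoeff (mE (enum_val i)))): P0.
  rewrite mcoeff0 raddf_sum /= (bigD1 i) //= mcoeffZ mcoeffX eqxx mulr1.
  rewrite big1 ?addr0 // => j ne; rewrite mcoeffZ mcoeffX.
  case: eqP => [/mnmP e|_]; last by rewrite mulr0.
  case/eqP: ne; apply: enum_val_inj; apply/ffunP => k; apply/val_inj.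
  by have := e k; rewrite !mnmE.
move=> v; rewrite -[RHS](meval0 v) -Y0 !rmorph_sum; apply: eq_bigr => i _ /=.
rewrite !mevalZ; congr (_ * _); rewrite mevalX /Y rmorph_prod /=.
by apply: eq_bigr => k _; rewrite mnmE rmorphXn.
Qed.

Lemma polynomial_fun_dependent (I : finType) m (y : 'I_m.+1 -> (I -> K) -> K) :
  #|I| = m -> (forall a, polynomial_fun (y a)) ->
  exists2 P : {mpoly K[m.+1]}, P != 0 & forall t, P.@[fun a => y a t] = 0.
Proof.
move=> cI; subst m => /choice[q qE]; have [P Pn0 P0] := mpoly_dependent q.
by exists P => // t; rewrite -[RHS](P0 (t \o enum_val)); apply: meval_eq => a.
Qed.

(* The component of least degree of a relation P between the y a vanishes at
   every tangent direction u. *)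
Lemma tangent_indep m (T : Type) (S : T -> Prop) (y : 'I_m -> T -> K)
    (c : 'I_m -> K) :
  (forall u : 'I_m -> K, exists r : 'I_m -> {poly K}, forall e, exists2 v, S v &
     forall a, y a v = c a + e * u a + e ^+ 2 * (r a).[e]) ->
  alg_indep_on S y.
Proof.
move=> tan P P0; pose Q := P \mPo [tuple 'X_a + (c a)%:MP | a < m].
have QE w : Q.@[w] = P.@[fun a => c a + w a].
  rewrite comp_mpoly_meval; apply: meval_eq => a.
  by rewrite tnth_mktuple mevalD mevalXU mevalC addrC.
suff Q0 : Q = 0.
  apply: mpoly_eval_eq0 => v; have := QE (fun a => v a - c a).
  rewrite Q0 meval0 => ->; apply: meval_eq => a.
  by rewrite addrC subrK.
suff Qk k : pihomog mdeg k Q = 0.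
  by rewrite (pihomog_partitionE (mf := mdeg) (leqnn (msize Q))) big1.
elim/ltn_ind: k => k IH; apply: mpoly_eval_eq0 => u.
have [r rE] := tan u.
pose R j := sval (mpoly_along_polys (pihomog mdeg j Q) (fun a => (u a)%:P + 'X * r a)).
have RE j z : (R j).[z] = (pihomog mdeg j Q).@[fun a => u a + z * (r a).[z]].
  rewrite /R; case: mpoly_along_polys => s /= ->; apply: meval_eq => a.
  by rewrite !hornerE.
(* The relation along the curve [c + e u + e ^+ 2 r]: the component of degree [j] contributes
   [e ^+ j] times its value at [u + e r]. *)
have R0 : \sum_(j < msize Q) 'X^j * R j = 0.
  apply: poly_eval_eq0 => z; rewrite horner_sum.
  have [v Sv vE] := rE z; rewrite -[RHS](P0 v Sv).
  pose w a := u a + z * (r a).[z].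
  transitivity (Q.@[fun a => z * w a]); last first.
    rewrite QE; apply: meval_eq => a; rewrite vE /w mulrDr addrA.
    by rewrite mulrA.
  rewrite [in RHS](pihomog_partitionE (mf := mdeg) (leqnn (msize Q))).
  rewrite rmorph_sum; apply: eq_bigr => i _ /=.
  by rewrite hornerM hornerXn RE (dhomog_mevalZ z w (pihomogP mdeg i Q)).
have [ltk|lek] := ltnP k (msize Q).
  have -> : (pihomog mdeg k Q).@[u] = (R k).[0].
    by rewrite RE; apply: meval_eq => a; rewrite mul0r addr0.
  (* In the coefficient of ['X^k] the lower components vanish by induction and the higher ones start
     at a larger power, which leaves [(R k).[0]]. *)
  move/polyP/(_ k): R0; rewrite coef0 coef_sum (bigD1 (Ordinal ltk)) //=.
  rewrite coefXnM ltnn subnn horner_coef0 big1 ?addr0 // => i ne.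
  rewrite coefXnM; case: ltnP => // ik.
  have ltik : (i < k)%N.
    by rewrite ltn_neqAle ik andbT; apply: contra ne => /eqP e; apply/eqP/val_inj.
  have -> : R i = 0 by apply: poly_eval_eq0 => z; rewrite RE IH // meval0.
  by rewrite coef0.
rewrite pihomogE big_seq_cond big_pred0 ?meval0 // => a.
apply/negbTE/negP => /andP[/msize_mdeg_lt lt /eqP e].
by move: lek; rewrite -e leqNgt lt.
Qed.

End AlgebraicDependence.

(** * Chains of irreducible closed subsets of projective space *)

Section ProjectiveDimension.
Context {K : numFieldType} {V : vectType K}.
Implicit Types (X Z : set (proj V)) (L : proj V) (v : V).
Local Open Scope classical_set_scope.
Local Notation mpolyV := {mpoly K[\dim {:V}]}.

Lemma represents_neq0 v L : represents v L -> v != 0.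
Proof.
rewrite /represents => vL; have := svalP L; rewrite vL dim_vline.
by case: (v != 0).
Qed.

Lemma represents_exists v : v != 0 -> exists L, represents v L.
Proof.
move=> v0; have dv : \dim <[v]> == 1%N by rewrite dim_vline v0.
by exists (exist (fun L : {vspace V} => is_true (\dim L == 1%N)) _ dv).
Qed.

Lemma representative_exists L : exists v, represents v L.
Proof.
exists (vpick (sval L)); apply/esym/eqP; rewrite eqEdim -memvE memv_pick.
rewrite dim_vline (eqP (svalP L)) vpick0 -dimv_eq0.
by have := svalP L; case: (\dim _) => // -[].
Qed.

Lemma representsZ (c : K) v L : c != 0 -> represents v L -> represents (c *: v) L.
Proof.
move=> c0 vL; rewrite /represents vL; apply/eqP; rewrite eq_sym eqEdim -memvE.
rewrite memvZ ?memv_line // !dim_vline scaler_eq0 negb_or c0.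
by rewrite (represents_neq0 vL).
Qed.

Lemma represents_inj v L L' : represents v L -> represents v L' -> L = L'.
Proof. by move=> vL vL'; apply/val_inj; rewrite /= vL vL'. Qed.

Lemma represents_colinear v v' L : represents v L -> represents v' L ->
  exists2 c : K, c != 0 & v' = c *: v.
Proof.
move=> vL v'L; have : v' \in <[v]>%VS by rewrite -vL v'L memv_line.
move=> /vlineP[c v'E]; exists c => //; apply/eqP => c0.
by have := represents_neq0 v'L; rewrite v'E c0 scale0r eqxx.
Qed.

Lemma polyfunZ d (p : mpolyV) (c : K) v : p \is d.-homog ->
  polyfun p (c *: v) = c ^+ d * polyfun p v.
Proof.
move=> pd; rewrite -(dhomog_mevalZ c _ pd).
by apply: meval_eq => i; rewrite linearZ.
Qed.

Definition cone X v : Prop := exists2 L, X L & represents v L.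

Lemma coneZ X c v : c != 0 -> cone X v -> cone X (c *: v).
Proof. by move=> c0 [L XL vL]; exists L => //; apply: representsZ. Qed.

Lemma zclosed_in_zero X Z (g : mpolyV) d : g \is d.-homog -> zclosed_in X Z ->
  zclosed_in X (Z `&` zero_locus [set g]).
Proof.
move=> gd [_ [S [Sh ->]] ->]; exists (zero_locus (S `|` [set g])).
  by exists (S `|` [set g]); split=> // p [/Sh//|->]; exists d.
rewrite -setIA; congr (_ `&` _); apply/seteqP; split => L.
  by move=> [LS Lg] p v [/LS|/Lg]; apply.
by move=> LS; split => p v pS; apply: LS; [left|right].
Qed.

(** The ideal of an irreducible closed set is prime. Since only homogeneous polynomials cut out
    closed sets, [q] is split into components: scaling shows that [g] times each of them vanishes on
    the cone, so [Z] is covered by the zero loci of [g] and of that component. *)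
Lemma zirreducible_prime X Z (g q : mpolyV) d : zirreducible_in X Z ->
  g \is d.-homog -> (exists2 v, cone Z v & polyfun g v != 0) ->
  (forall v, cone Z v -> polyfun g v * polyfun q v = 0) ->
  forall v, cone Z v -> polyfun q v = 0.
Proof.
move=> [Zc _ Zirr] gd [v0 Zv0 gv0] gq v Zv.
have gqk k u : cone Z u -> polyfun g u * polyfun (pihomog mdeg k q) u = 0.
  move=> Zu; have [->|gu] := eqVneq (polyfun g u) 0; first by rewrite mul0r.
  rewrite [X in _ * X](_ : _ = 0) ?mulr0 //; apply: pihomog_meval_eq0 => c c0.
  have /eqP := gq _ (coneZ c0 Zu); rewrite (polyfunZ _ _ gd) mulf_eq0 => /orP[].
    by rewrite mulf_eq0 expf_eq0 (negbTE c0) andbF (negbTE gu).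
  by move=> /eqP e; rewrite -[RHS]e; apply: meval_eq => i; rewrite linearZ.
rewrite /polyfun [q](pihomog_partitionE (mf := mdeg) (leqnn (msize q))).
rewrite rmorph_sum big1 // => -[k _] _ /=; set qk := pihomog mdeg k q.
have qkd : qk \is k.-homog by exact: pihomogP.
have ZE : Z = Z `&` zero_locus [set g] `|` Z `&` zero_locus [set qk].
  apply/seteqP; split => [L ZL|L [[]|[]] //].
  have [u uL] := representative_exists L; have Zu : cone Z u by exists L.
  have /eqP := gqk k u Zu; rewrite mulf_eq0 => /orP[] /eqP e; [left|right];
    split => // p u' /= -> u'L; have [c _ ->] := represents_colinear uL u'L.
    by rewrite (polyfunZ _ _ gd) e mulr0.
  by rewrite (polyfunZ _ _ qkd) e mulr0.
case: (Zirr _ _ (zclosed_in_zero gd Zc) (zclosed_in_zero qkd Zc) ZE) => E.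
  case/eqP: gv0; have [L + v0L] := Zv0.
  by rewrite E => -[_]; apply.
by have [L + vL] := Zv; rewrite E => -[_]; apply.
Qed.

(** The new function is a form [g] that vanishes on [Z] but not on [Z']. In a relation on [Z'],
    written as a polynomial in [g], the constant coefficient is a relation between the [y a] on [Z],
    hence zero; then [g] cancels by primality, and the degree drops. *)
Lemma alg_indep_step X Z Z' m (y : 'I_m -> mpolyV) :
  zclosed_in X Z -> zirreducible_in X Z' -> Z `<` Z' ->
  alg_indep_on (cone Z) (fun a => polyfun (y a)) ->
  exists y' : 'I_m.+1 -> mpolyV, alg_indep_on (cone Z') (fun a => polyfun (y' a)).
Proof.
move=> [_ [S [Sh ->]] ->] Zirr [ZZ' Z'Z] yind.
have [L Z'L /not_implyP[XL]] : exists2 L, Z' L & ~ (X L -> zero_locus S L).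
  apply: contrapT => nL; apply: Z'Z => L Z'L; split.
    by case: Zirr => -[Z0 _ Z'E] _ _; move: Z'L; rewrite Z'E => -[].
  apply: contrapT => LS; apply: nL; exists L => // /(_ _)/LS; apply.
  by case: Zirr => -[Z0 _ Z'E] _ _; move: Z'L; rewrite Z'E => -[].
move=> /existsNP[g] /existsNP[v0] /not_implyP[Sg] /not_implyP[v0L /eqP gv0].
have [d gd] := Sh _ Sg.
exists (fun a => if unlift ord_max a is Some j then y j else g) => P P0.
apply: muni_eq0.
pose val (Q : {poly {mpoly K[m]}}) v :=
  (map_poly (meval (fun a => polyfun (y a) v)) Q).[polyfun g v].
have : forall v, cone Z' v -> val (muni P) v = 0.
  move=> v Z'v; rewrite -[RHS](P0 v Z'v) muni_meval unlift_none.
  congr (_.[_]); apply: eq_map_poly => q; apply: meval_eq => a /=.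
  have -> : widen a = lift ord_max a.
    by apply/val_inj; rewrite /= /bump leqNgt ltn_ord.
  by rewrite liftK.
elim/poly_ind: (muni P) => // Q c IH Q0.
have valE v : val (Q * 'X + c%:P) v =
    polyfun g v * val Q v + c.@[fun a => polyfun (y a) v].
  by rewrite /val rmorphD rmorphM /= map_polyX map_polyC !hornerE mulrC.
have c0 : c = 0.
  apply: yind => v [L' [XL' SL'] vL']; have := Q0 v; rewrite valE.
  by rewrite (SL' g v Sg vL') mul0r add0r; apply; exists L' => //; apply: ZZ'.
rewrite c0 addr0 IH ?mul0r // => v Z'v.
pose q : mpolyV := (map_poly (comp_mpoly [tuple y a | a < m]) Q).[g].
have qE u : polyfun q u = val Q u.
  rewrite /polyfun /q -horner_map /= -map_poly_comp; congr (_.[_]).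
  apply: eq_map_poly => r /=; rewrite comp_mpoly_meval.
  by apply: meval_eq => a; rewrite tnth_mktuple.
rewrite -qE; apply: (zirreducible_prime Zirr gd _ _ Z'v).
  by exists v0 => //; exists L.
move=> u Z'u; have := Q0 u Z'u; rewrite valE c0 meval0 addr0 => <-.
by rewrite qE.
Qed.

(** The count starts with one function on [c 0], because the cone over a point is a line without its
    origin: a coordinate that is nonzero there takes all nonzero values. *)
Lemma irreducible_chain_indep X n (c : nat -> set (proj V)) i :
  irreducible_chain X n c -> (i <= n)%N ->
  exists y : 'I_i.+1 -> mpolyV, alg_indep_on (cone (c i)) (fun a => polyfun (y a)).
Proof.
move=> [cirr cinc]; elim: i => [_|i IH lein].
  have [_ [L cL] _] := cirr 0 (leq0n _); have [v vL] := representative_exists L.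
  have [i vi] : exists i, coord (vbasis {:V}) i v != 0.
    apply: contrapT => nv; have := represents_neq0 vL.
    rewrite [v](coord_vbasis (memvf v)) big1 ?eqxx // => i _.
    by have [->|vi] := eqVneq (coord (vbasis {:V}) i v) 0; rewrite ?scale0r //; case: nv; exists i.
  exists (fun=> 'X_i) => P P0; apply/eqP.
  have /eqP : P * 'X_ord0 = 0.
    apply: mpoly_eval_eq0 => w; rewrite mevalM mevalXU.
    have [->|w0] := eqVneq (w ord0) 0; first by rewrite mulr0.
    have c0 : w ord0 / coord (vbasis {:V}) i v != 0 by rewrite mulf_neq0 ?invr_eq0.
    rewrite [X in X * _](_ : _ = 0) ?mul0r // -[RHS](P0 _ (coneZ c0 (ex_intro2 _ _ _ cL vL))).
    by apply: meval_eq => a; rewrite /polyfun mevalXU linearZ /= divfK // ord1.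
  rewrite mulf_eq0 => /orP[//|/eqP X0].
  by have := mevalXU (fun=> 1) (ord0 : 'I_1) : _ = 1 :> K; rewrite X0 meval0 => /esym/eqP; rewrite oner_eq0.
have [y yind] := IH (ltnW lein).
have [cc _ _] := cirr _ (ltnW lein).
exact: (alg_indep_step cc (cirr _ lein) (cinc _ lein) yind).
Qed.

Lemma irreducible_chain_le X d n (c : nat -> set (proj V)) :
  (forall y : 'I_d.+2 -> mpolyV, exists2 P, P != 0 &
     forall v, cone X v -> P.@[fun a => polyfun (y a) v] = 0) ->
  irreducible_chain X n c -> (n <= d)%N.
Proof.
move=> dep chain; rewrite leqNgt; apply/negP => ltdn.
have [y yind] := irreducible_chain_indep chain ltdn.
have [P /eqP Pn0 P0] := dep y; apply: Pn0; apply: yind => v [L cL vL]; apply: P0.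
have [cirr _] := chain; have [[Z _ cE] _ _] := cirr _ ltdn.
by exists L => //; move: cL; rewrite cE => -[].
Qed.

End ProjectiveDimension.

(** * Dimension bounds from polynomial parametrizations *)

Section ParametrizedDimension.
Context {K : numFieldType} {V : vectType K}.
Local Open Scope classical_set_scope.
Local Notation mpolyV := {mpoly K[\dim {:V}]}.

Definition polynomial_map (I : finType) (w : (I -> K) -> V) : Prop :=
  forall i, polynomial_fun (fun t => coord (vbasis {:V}) i (w t)).

Lemma polynomial_map_polyfun (I : finType) (w : (I -> K) -> V) (p : mpolyV) :
  polynomial_map w -> polynomial_fun (fun t => polyfun p (w t)).
Proof. exact: polynomial_fun_mpoly. Qed.

Lemma polynomial_map_comp (I J : finType) (w : (I -> K) -> V)
    (f : (J -> K) -> I -> K) :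
  polynomial_map w -> (forall i, polynomial_fun (f^~ i)) -> polynomial_map (w \o f).
Proof. by move=> wP fP i; exact: (polynomial_fun_comp (wP i) fP). Qed.

Lemma polynomial_mapZ (I : finType) (s : (I -> K) -> K) (w : (I -> K) -> V) :
  polynomial_fun s -> polynomial_map w -> polynomial_map (fun t => s t *: w t).
Proof.
move=> sP wP i; have [p pE] := polynomial_funM sP (wP i).
by exists p => t; rewrite linearZ /= pE.
Qed.

Lemma linear_polyfun (z : {scalar V}) : exists p : mpolyV, polyfun p =1 z.
Proof.
exists (\sum_(i < \dim {:V}) z (vbasis {:V})`_i *: 'X_i) => v.
rewrite /polyfun raddf_sum /= [in RHS](coord_vbasis (memvf v)).
rewrite linear_sum; apply: eq_bigr => i _.
by rewrite mevalZ mevalXU linearZ /= mulrC.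
Qed.

(** On each chart [d + 2] polynomials in [d + 1] parameters satisfy a relation; the product of these
    relations over the finitely many charts holds on the whole cone. *)
Lemma charts_chain_le (X : set (proj V)) (C I : finType) d
    (w : C -> (I -> K) -> V) n (c : nat -> set (proj V)) :
  #|I| = d.+1 -> (forall k, polynomial_map (w k)) ->
  (forall v, cone X v -> exists k t, v = w k t) ->
  irreducible_chain X n c -> (n <= d)%N.
Proof.
move=> cI wP wX; apply: irreducible_chain_le => y.
have /choice[P PP] : forall k, exists P : {mpoly K[d.+2]}, P != 0 /\
    forall t, P.@[fun a => polyfun (y a) (w k t)] = 0.
  move=> k; have [P Pn0 P0] := polynomial_fun_dependent cI
    (fun a => polynomial_map_polyfun (y a) (wP k)).
  by exists P.
exists (\prod_k P k).
  by apply/prodf_neq0 => k _; case: (PP k).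
move=> v /wX[k [t ->]]; rewrite rmorph_prod (bigD1 k) //=.
by case: (PP k) => _ ->; rewrite mul0r.
Qed.

(* The tangent vectors of (s, t) |-> s *: w t at (1, 0) are w 0 and the T j. *)
Definition has_tangents d (w : ('I_d -> K) -> V) (T : 'I_d -> V) : Prop :=
  forall u : 'I_d -> K, exists r : seq V, forall e,
    w (fun j => e * u j) = w (fun=> 0) + e *: (\sum_j u j *: T j)
      + e ^+ 2 *: (\sum_(k < size r) e ^+ k *: r`_k).

Variables (X : set (proj V)) (d : nat) (w : ('I_d -> K) -> V).
Variables (delta : ('I_d -> K) -> K) (T : 'I_d -> V).
Hypothesis wP : polynomial_map w.
Hypothesis deltaP : polynomial_fun delta.
Hypothesis delta0 : delta (fun=> 0) != 0.
Hypothesis wX : forall t, delta t != 0 -> cone X (w t).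
Hypothesis wT : has_tangents w T.
Hypothesis Tfree : free (w (fun=> 0) :: [seq T j | j <- enum 'I_d]).

Let trunc (i : nat) (t : 'I_d -> K) (j : 'I_d) := if (j < i)%N then t j else 0.

Let truncP i (j : 'I_d) : polynomial_fun ((trunc i)^~ j).
Proof.
rewrite /trunc; case: (j < i)%N; first exact: polynomial_fun_var.
exact: polynomial_fun_cst.
Qed.

Let trunc_id i k t : (i <= k)%N -> trunc k (trunc i t) = trunc i t.
Proof.
move=> leik; apply/funext => j; rewrite /trunc.
case: (ltnP j i) => [lt|]; last by rewrite if_same.
by rewrite (leq_trans lt).
Qed.

Let trunc0 i : trunc i (fun=> 0) = fun=> 0.
Proof. by apply/funext => j; rewrite /trunc if_same. Qed.

Let vanishing i : set mpolyV := [set p | (exists k, p \is k.-homog) /\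
  forall t, delta (trunc i t) != 0 -> polyfun p (w (trunc i t)) = 0].

(** The closure in [X] of the image of the [i]th coordinate subspace; [delta != 0] selects
    parameters whose image is known to lie in [X]. *)
Let flag i : set (proj V) := X `&` zero_locus (vanishing i).

Let flag_mem i t L : delta (trunc i t) != 0 ->
  represents (w (trunc i t)) L -> flag i L.
Proof.
move=> dt wL; split.
  by have [L' XL' wL'] := wX dt; rewrite (represents_inj wL wL').
move=> p v [[k pk] p0] vL; have [c _ ->] := represents_colinear wL vL.
by rewrite (polyfunZ _ _ pk) p0 ?mulr0.
Qed.

Let flag_closed i : zclosed_in X (flag i).
Proof.
by exists (zero_locus (vanishing i)) => //; exists (vanishing i); split => // p [].
Qed.

(** If both parts were proper, each would have an equation that fails somewhere on the image. The
    product of [delta] and these two equations would vanish as a polynomial function on the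
    coordinate subspace, although no factor does. *)
Let flag_irreducible i : zirreducible_in X (flag i).
Proof.
split; first exact: flag_closed.
  have [L XL wL] := wX delta0; exists L; apply: (@flag_mem i (fun=> 0)).
    by rewrite trunc0.
  by rewrite trunc0.
move=> F1 F2 [_ [S1 [S1h ->]] F1E] [_ [S2 [S2h ->]] F2E] FE.
have sep (F : set (proj V)) S : F = X `&` zero_locus S ->
    (forall p, S p -> exists k, p \is k.-homog) -> F `<=` flag i -> F <> flag i ->
    exists p t, [/\ S p, delta (trunc i t) != 0 & polyfun p (w (trunc i t)) != 0].
  move=> E Sh Ff Fn; apply: contrapT => np; apply: Fn; apply/seteqP; split => //.
  move=> L [XL VL]; rewrite E; split => // p v Sp vL; apply: VL vL.
  split; first exact: Sh.
  move=> t dt; apply/eqP; apply: contrapT => /negP pt; apply: np.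
  by exists p, t.
apply: contrapT => /not_orP[n1 n2].
have F1f : F1 `<=` flag i by rewrite FE; left.
have F2f : F2 `<=` flag i by rewrite FE; right.
have [p1 [t1 [Sp1 d1 pt1]]] := sep _ _ F1E S1h F1f (nesym n1).
have [p2 [t2 [Sp2 d2 pt2]]] := sep _ _ F2E S2h F2f (nesym n2).
have dP := polynomial_fun_comp deltaP (truncP i).
have wiP := polynomial_map_comp wP (truncP i).
have := polynomial_fun_mul_eq0 dP (polynomial_funM
  (polynomial_map_polyfun p1 wiP) (polynomial_map_polyfun p2 wiP)).
case=> [t /=|/(_ t1) /eqP|].
- have [->|dt] := eqVneq (delta (trunc i t)) 0; first by rewrite mul0r.
  have [L XL wL] := wX dt; have := flag_mem dt wL; rewrite FE F1E F2E.
  case=> -[_ H]; first by rewrite (H _ _ Sp1 wL) mul0r mulr0.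
  by rewrite (H _ _ Sp2 wL) !mulr0.
- by rewrite /= (negbTE d1).
move/(polynomial_fun_mul_eq0 (polynomial_map_polyfun p1 wiP)
  (polynomial_map_polyfun p2 wiP)) => -[/(_ t1)|/(_ t2)] /eqP /=.
  by rewrite (negbTE pt1).
by rewrite (negbTE pt2).
Qed.

Let flag_sub i : flag i `<=` flag i.+1.
Proof.
move=> L [XL VL]; split => // p v [pk p0]; apply: VL; split => // t.
by rewrite -(trunc_id t (leqnSn i)); apply: p0.
Qed.

Let dual : d.+1.-tuple V := [tuple of w (fun=> 0) :: [seq T j | j <- ord_tuple d]].

Let dualE (a : 'I_d.+1) (s : K) (u : 'I_d -> K) :
  coord dual a (s *: w (fun=> 0) + \sum_j u j *: T j) =
    if unlift ord0 a is Some j then u j else s.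
Proof.
have fd : free dual by exact: Tfree.
rewrite linearD linearZ linear_sum /=.
rewrite -[w _]/(dual`_(ord0 : 'I_d.+1)) (coord_free _ _ fd).
have -> : \sum_i coord dual a (u i *: T i) = \sum_i u i * (lift ord0 i == a)%:R.
  apply: eq_bigr => i _; rewrite linearZ /=; congr (_ * _).
  have -> : T i = dual`_(lift ord0 i).
    rewrite /= (nth_map i) ?add0n ?size_enum_ord //.
    by rewrite nth_ord_enum.
  by rewrite coord_free.
case: unliftP => [j ->|->].
  rewrite (negbTE (neq_lift _ _)) mulr0 add0r.
  rewrite (bigD1 j) //= eqxx mulr1 big1 ?addr0 // => k ne.
  by rewrite (inj_eq lift_inj) (negbTE ne) mulr0.
rewrite eqxx mulr1 big1 ?addr0 // => k _.
by rewrite eq_sym (negbTE (neq_lift _ _)) mulr0.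
Qed.

(** Along the cone over the [i]th image, [i + 2] of the dual coordinates depend on [i + 1]
    parameters only, so they satisfy a relation there, whose components vanish on [flag i]. On the
    cone over the next image the same coordinates are independent, by their tangent directions. *)
Let flag_strict i : (i < d)%N -> ~ flag i.+1 `<=` flag i.
Proof.
move=> ltid sub; have lei : (i.+2 <= d.+1)%N by [].
pose z (a : 'I_i.+2) v := coord dual (widen_ord lei a) v.
have /choice[l lE] : forall a, exists p : mpolyV, polyfun p =1 z a.
  by move=> a; exact: (linear_polyfun (coord dual (widen_ord lei a))).
(* Parameter [0] of ['I_i.+1] is the scaling factor of the cone, parameter [j.+1] the coordinate
   [j]. *)
pose ext (t : 'I_i.+1 -> K) (j : 'I_d) := if (j < i)%N then t (inord j.+1) else 0.
have extP j : polynomial_fun (ext^~ j).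
  rewrite /ext; case: (j < i)%N; first exact: polynomial_fun_var.
  exact: polynomial_fun_cst.
have wiP := polynomial_mapZ (polynomial_fun_var (ord0 : 'I_i.+1))
  (polynomial_map_comp wP extP).
have [P Pn0 P0] := polynomial_fun_dependent (card_ord i.+1)
  (fun a => polynomial_map_polyfun (l a) wiP).
pose q : mpolyV := P \mPo [tuple l a | a < i.+2].
have qE v : polyfun q v = P.@[fun a => z a v].
  rewrite /polyfun comp_mpoly_meval; apply: meval_eq => a.
  by rewrite tnth_mktuple -lE.
have qV k : vanishing i (pihomog mdeg k q).
  split; first by exists k; exact: pihomogP.
  move=> t _; apply: pihomog_meval_eq0 => c c0.
  pose t' (j : 'I_i.+1) := if unlift ord0 j is Some j' then t (widen_ord (ltnW ltid) j') else c.
  have := P0 t'; rewrite /= {1}/t' unlift_none => E; rewrite -[RHS]E.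
  have -> : ext t' = trunc i t.
    apply/funext => j; rewrite /ext /trunc; case: ltnP => // ji.
    rewrite /t'; have -> : inord j.+1 = lift ord0 (Ordinal ji).
      by apply/val_inj; rewrite /= inordK.
    by rewrite liftK; congr t; apply/val_inj.
  transitivity (polyfun q (c *: w (trunc i t))).
    by apply: meval_eq => j; rewrite linearZ.
  by rewrite qE; apply: meval_eq => a; rewrite -lE.
have qV' k t : delta (trunc i.+1 t) != 0 ->
    polyfun (pihomog mdeg k q) (w (trunc i.+1 t)) = 0.
  move=> dt; have [L _ wL] := wX dt.
  by have [_] := sub _ (flag_mem dt wL); apply.
have q0 s t : delta (trunc i.+1 t) != 0 -> polyfun q (s *: w (trunc i.+1 t)) = 0.
  move=> dt; rewrite /polyfun [q](pihomog_partitionE (mf := mdeg) (leqnn (msize q))).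
  rewrite rmorph_sum big1 // => k _ /=.
  by have := polyfunZ s (w (trunc i.+1 t)) (pihomogP mdeg k q); rewrite qV' // mulr0.
have {}q0 s t : polyfun q (s *: w (trunc i.+1 t)) = 0.
  have dP := polynomial_fun_comp deltaP (truncP i.+1).
  have swP := polynomial_mapZ (polynomial_fun_cst 'I_d s)
    (polynomial_map_comp wP (truncP i.+1)).
  case: (polynomial_fun_mul_eq0 dP (polynomial_map_polyfun q swP)) => [t' /=|/(_ (fun=> 0))|->//].
    have [->|dt] := eqVneq (delta (trunc i.+1 t')) 0; first by rewrite mul0r.
    by rewrite q0 // mulr0.
  by rewrite /= trunc0 => /eqP; rewrite (negbTE delta0).
case/eqP: Pn0.
(* These functions are expanded at [s = 1], [t = 0], where their values are [1, 0, ..., 0]. *)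
pose y (a : 'I_i.+2) (st : K * ('I_d -> K)) := z a (st.1 *: w (trunc i.+1 st.2)).
apply: (tangent_indep (S := fun=> True) (y := y)
    (c := fun a => (a == ord0)%:R)) => [u|[s t] _]; last first.
  by rewrite -[RHS](q0 s t) qE.
pose u' (j : 'I_d) := if (j < i.+1)%N then u (inord j.+1) else 0.
have [r rE] := wT u'.
pose W0 := u ord0 *: \sum_j u' j *: T j.
pose zr a : {poly K} := \sum_(k < size r) z a r`_k *: 'X^k.
(* The terms of order at least two of [(1 + e u_0) w (e u')], divided by [e ^+ 2]. *)
exists (fun a => (z a W0)%:P + (1 + u ord0 *: 'X) * zr a) => e.
exists (1 + e * u ord0, fun j => e * u' j) => // a; rewrite /y /=.
have -> : trunc i.+1 (fun j => e * u' j) = fun j => e * u' j.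
  apply/funext => j. rewrite /trunc /u'.
  by case: (j < i.+1)%N; rewrite ?mulr0.
rewrite rE.
have zrE : (zr a).[e] = z a (\sum_(k < size r) e ^+ k *: r`_k).
  rewrite horner_sum /z linear_sum; apply: eq_bigr => k _.
  by rewrite !hornerE linearZ /= mulrC.
have za s v v' : z a (s *: v + v') = s * z a v + z a v' by rewrite /z linearP.
have zc : z a (w (fun=> 0)) = (a == ord0)%:R.
  have := dualE (widen_ord lei a) 1 (fun=> 0).
  rewrite scale1r big1 ?addr0 => [|j _]; last by rewrite scale0r.
  rewrite -/(z a _) => ->; case: unliftP => [j E|E].
    by case: eqP => // a0; move/(congr1 val): E; rewrite a0.
  have -> : a = ord0 by apply/val_inj; have := congr1 val E.
  by [].
have zu : u ord0 * z a (w (fun=> 0)) + z a (\sum_j u' j *: T j) = u a.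
  rewrite -za /z dualE; case: unliftP => [j E|E].
    have ja : a = j.+1 :> nat by have := congr1 val E.
    rewrite /u'; have -> : (j < i.+1)%N by rewrite -ltnS -ja.
    by congr u; apply/val_inj; rewrite /= -ja inordK.
  have -> : a = ord0 by apply/val_inj; have := congr1 val E.
  by [].
rewrite !hornerE zrE -zu -zc /W0.
have zZ s v : z a (s *: v) = s * z a v by rewrite /z linearZ.
have zD v v' : z a (v + v') = z a v + z a v' by rewrite /z linearD.
by rewrite !(zZ, zD); ring.
Qed.

Lemma irreducible_chain_exists : exists c, irreducible_chain X d c.
Proof.
exists flag; split => [i _|i ltid]; first exact: flag_irreducible.
by split; [exact: flag_sub|exact: flag_strict].
Qed.

End ParametrizedDimension.

(** * Quadratic maps of the plane *)

Definition i0 : 'I_3 := @Ordinal 3 0 isT.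
Definition i1 : 'I_3 := @Ordinal 3 1 isT.
Definition i2 : 'I_3 := @Ordinal 3 2 isT.

Lemma ord3_ind (P : 'I_3 -> Prop) : P i0 -> P i1 -> P i2 -> forall i, P i.
Proof.
move=> P0 P1 P2 [[|[|[|//]]] lt]; [move: P0|move: P1|move: P2];
  congr P; exact/val_inj.
Qed.

Lemma sum3 (V : nmodType) (F : 'I_3 -> V) : \sum_i F i = F i0 + F i1 + F i2.
Proof.
rewrite !big_ord_recl big_ord0 addr0 addrA.
by congr (F _ + F _ + F _); exact/val_inj.
Qed.

Section Vectors3.
Context {R : comPzRingType}.

Definition v3 (a b c : R) : 'cV[R]_3 := \col_i tnth [tuple a; b; c] i.

Definition m3 (a b c d e f g h i : R) : 'M[R]_3 :=
  \matrix_(j, k) tnth (tnth [tuple [tuple a; b; c]; [tuple d; e; f]; [tuple g; h; i]] j) k.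

Lemma v3E0 a b c : v3 a b c i0 0 = a. Proof. by rewrite mxE. Qed.
Lemma v3E1 a b c : v3 a b c i1 0 = b. Proof. by rewrite mxE. Qed.
Lemma v3E2 a b c : v3 a b c i2 0 = c. Proof. by rewrite mxE. Qed.
Definition v3E := (v3E0, v3E1, v3E2).

Lemma cv3P (x y : 'cV[R]_3) :
  x i0 0 = y i0 0 -> x i1 0 = y i1 0 -> x i2 0 = y i2 0 -> x = y.
Proof. by move=> e0 e1 e2; apply/colP; apply: ord3_ind. Qed.

Lemma v3_eta (x : 'cV[R]_3) : x = v3 (x i0 0) (x i1 0) (x i2 0).
Proof. by apply: cv3P; rewrite v3E. Qed.

Lemma mulmx_v3 (M : 'M[R]_3) a b c : M *m v3 a b c =
  v3 (M i0 i0 * a + M i0 i1 * b + M i0 i2 * c)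
     (M i1 i0 * a + M i1 i1 * b + M i1 i2 * c)
     (M i2 i0 * a + M i2 i1 * b + M i2 i2 * c).
Proof. by apply: cv3P; rewrite !mxE sum3 !v3E. Qed.

Lemma m3_v3 a b c d e f g h i x y z : m3 a b c d e f g h i *m v3 x y z =
  v3 (a * x + b * y + c * z) (d * x + e * y + f * z) (g * x + h * y + i * z).
Proof. by rewrite mulmx_v3; apply: cv3P; rewrite !v3E !mxE. Qed.

Lemma scale_v3 (k : R) a b c : k *: v3 a b c = v3 (k * a) (k * b) (k * c).
Proof. by apply: cv3P; rewrite mxE !v3E. Qed.

Lemma add_v3 (a b c a' b' c' : R) : v3 a b c + v3 a' b' c' = v3 (a + a') (b + b') (c + c').
Proof. by apply: cv3P; rewrite mxE !v3E. Qed.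

Lemma opp_v3 (a b c : R) : - v3 a b c = v3 (- a) (- b) (- c).
Proof. by apply: cv3P; rewrite mxE !v3E. Qed.

Lemma row_v3 (u : 'rV[R]_3) a b c :
  (u *m v3 a b c) 0 0 = u 0 i0 * a + u 0 i1 * b + u 0 i2 * c.
Proof. by rewrite mxE sum3 !v3E. Qed.

End Vectors3.

Lemma v3_eq0 (R : comPzRingType) (a b c : R) :
  v3 a b c = 0 -> [/\ a = 0, b = 0 & c = 0].
Proof.
move=> e; have E i : v3 a b c i 0 = 0 by rewrite e mxE.
by split; [rewrite -(E i0)|rewrite -(E i1)|rewrite -(E i2)]; rewrite v3E.
Qed.

Lemma v3_inj (R : comPzRingType) (a b c a' b' c' : R) :
  v3 a b c = v3 a' b' c' -> [/\ a = a', b = b' & c = c'].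
Proof.
move=> e; have E i : v3 a b c i 0 = v3 a' b' c' i 0 by rewrite e.
by have := (E i0, E i1, E i2); rewrite !v3E => -[[]].
Qed.

(** Each monomial of positive degree is assigned one variable [idx m] that divides it, and the
    monomials are grouped by it. Applied twice, this yields the coefficients of a quadratic form. *)
Lemma dhomog_divX (R : comNzRingType) n d (p : {mpoly R[n]}) :
  p \is d.+1.-homog -> exists q : 'I_n -> {mpoly R[n]},
    (forall i, q i \is d.-homog) /\ p = \sum_i 'X_i * q i.
Proof.
move=> /dhomogP pd.
case: n => [|n] in p pd *.
  exists (fun=> 0); split=> [i|]; first exact: dhomog0.
  rewrite big_ord0; apply/mpolyP => m; rewrite mcoeff0; apply: memN_msupp_eq0.
  apply/negP => /pd; have -> : m = 0%MM by apply/mnmP => -[].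
  by move=> e; have := mdeg0 (n := 0); rewrite [mdeg _]e.
have idxP (m : 'X_{1..n.+1}) : exists i : 'I_n.+1, (0 < mdeg m)%N -> (0 < m i)%N.
  have [->|] := eqVneq m 0%MM; first by exists ord0; rewrite mdeg0.
  move=> mn0; suff [i mi] : exists i, (0 < m i)%N by exists i.
  apply: contrapT => nm; case/eqP: mn0; apply/mnmP => i; rewrite mnm0E.
  by case E : (m i) => // [k]; case: nm; exists i; rewrite E.
have /choice[idx idxE] := idxP.
exists (fun i => \sum_(m <- msupp p | idx m == i) p@_m *: 'X_[(m - U_(i))%MM]).
split=> [i|].
  rewrite big_seq_cond; apply: rpred_sum => m /andP[/pd /= md /eqP im].
  apply: rpredZ; rewrite dhomogX /=.
  have mi : (0 < m i)%N by rewrite -im; apply: idxE; rewrite [mdeg m]md.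
  have := mdegD (m - U_(i))%MM U_(i).
  rewrite submK; last by apply/mnm_lepP => j; rewrite mnm1E; case: eqP => // <-.
  by rewrite [mdeg m]md mdeg1 addn1 => -[<-].
rewrite {1}(mpolyE p) (partition_big idx predT) //=; apply: eq_bigr => i _.
rewrite mulr_sumr [LHS]big_seq_cond [RHS]big_seq_cond.
apply: eq_bigr => m /andP[/pd /= md /eqP im].
rewrite -scalerAr -mpolyXD; congr (_ *: 'X_[_]).
rewrite addmC submK //; apply/mnm_lepP => j; rewrite mnm1E; case: eqP => // <-.
by rewrite -im; apply: idxE; rewrite [mdeg m]md.
Qed.

Lemma dhomog0_mpolyC (R : comNzRingType) n (p : {mpoly R[n]}) :
  p \is 0.-homog -> exists c, p = c%:MP.
Proof.
move=> /dhomogP pd; exists p@_0; apply: msize1_polyC.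
by rewrite msizeE; apply/bigmax_leqP_seq => m /pd /= e _; rewrite [mdeg m]e.
Qed.

Lemma dhomog1_linear (R : comNzRingType) n (p : {mpoly R[n]}) :
  p \is 1.-homog -> exists a : 'I_n -> R, p = \sum_i a i *: 'X_i.
Proof.
move=> /dhomog_divX[q [q0 ->]].
have /choice[a aE] := fun i => dhomog0_mpolyC (q0 i).
by exists a; apply: eq_bigr => i _; rewrite aE mulrC mul_mpolyC.
Qed.

Lemma DHomog_inj (R : comNzRingType) n d (p q : dhomog n R d) :
  (p : {mpoly R[n]}) = q -> p = q.
Proof. exact: val_inj. Qed.

(** * Evaluation of quadratic triples and left-right equivalence *)

Section Evaluation.
Context {K : numFieldType}.
Implicit Types (f g : quadtriple K) (x : 'cV[K]_3) (A B M N : 'M[K]_3).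

Definition lin (a : 'rV[K]_3) : dhomog 3 K 1 := \sum_k a 0 k *: var k.

(** The coefficients need not be symmetric in [k] and [l], so different [c] may give the same
    triple. *)
Definition quad (c : 'I_3 -> 'I_3 -> 'I_3 -> K) : quadtriple K :=
  [ffun i => \sum_k \sum_l c i k l *: lmul (var k) (var l)].

Definition ev f x : 'cV[K]_3 :=
  \col_i (f i : {mpoly K[3]}).@[fun j => x j 0].

Lemma ev_inj f g : (forall x, ev f x = ev g x) -> f = g.
Proof.
move=> fg; apply/ffunP => i; apply: DHomog_inj; apply: mpoly_eval_inj => v.
have /colP/(_ i) := fg (\col_j v j); rewrite !mxE => E.
transitivity ((f i : {mpoly K[3]}).@[fun j => (\col_j v j) j (0 : 'I_1)]).
  by apply: meval_eq => j; rewrite mxE.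
by rewrite E; apply: meval_eq => j; rewrite mxE.
Qed.

Lemma evZ c f x : ev (c *: f) x = c *: ev f x.
Proof. by apply/colP => i; rewrite !mxE ffunE /= mevalZ. Qed.

Lemma evD f g x : ev (f + g) x = ev f x + ev g x.
Proof. by apply/colP => i; rewrite !mxE ffunE /= mevalD. Qed.

Lemma ev0 x : ev 0 x = 0.
Proof. by apply/colP => i; rewrite !mxE ffunE /= meval0. Qed.

Lemma ev_sum (I : Type) (r : seq I) (P : pred I) (F : I -> quadtriple K) x :
  ev (\sum_(i <- r | P i) F i) x = \sum_(i <- r | P i) ev (F i) x.
Proof. by rewrite (big_morph (ev^~ x) (id1 := 0) (fun f g => evD f g x) (ev0 x)). Qed.

Lemma ev_mkquad (p q r : dhomog 3 K 2) a b c : let v := fun j => v3 a b c j 0 in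
  ev (mkquad p q r) (v3 a b c) =
  v3 (p : {mpoly K[3]}).@[v] (q : {mpoly K[3]}).@[v] (r : {mpoly K[3]}).@[v].
Proof. by move=> v; apply: cv3P; rewrite !v3E mxE ffunE. Qed.

Lemma ev_sigma a b c : ev sigma (v3 a b c) = v3 (b * c) (a * c) (a * b).
Proof.
by rewrite ev_mkquad /= !mevalM !mevalXU -/i0 -/i1 -/i2 !v3E.
Qed.

Lemma ev_rho a b c : ev rho (v3 a b c) = v3 (a * b) (c * c) (b * c).
Proof.
by rewrite ev_mkquad /= !mevalM !mevalXU -/i0 -/i1 -/i2 !v3E.
Qed.

Lemma ev_tau a b c : ev tau (v3 a b c) = v3 (a * a) (a * b) (b * b - a * c).
Proof.
by rewrite ev_mkquad /= mevalB !mevalM !mevalXU -/i0 -/i1 -/i2 !v3E.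
Qed.

Lemma ev_quad c x i :
  ev (quad c) x i 0 = \sum_k \sum_l c i k l * x k 0 * x l 0.
Proof.
rewrite mxE ffunE raddf_sum /= raddf_sum; apply: eq_bigr => k _.
rewrite /= !raddf_sum; apply: eq_bigr => l _.
by rewrite /= mevalZ mevalM !mevalXU mulrA.
Qed.

Lemma quad_surj f : exists c, f = quad c.
Proof.
have /choice[c cE] : forall i, exists c : 'I_3 -> 'I_3 -> K,
    (f i : {mpoly K[3]}) = \sum_k \sum_l c k l *: ('X_k * 'X_l).
  move=> i; have [q [qd ->]] := dhomog_divX (dhomog_is_dhomog (f i)).
  have /choice[c cE] := fun k => dhomog1_linear (qd k).
  exists c; apply: eq_bigr => k _; rewrite cE mulr_sumr.
  by apply: eq_bigr => l _; rewrite scalerAr.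
exists c; apply: ev_inj => x; apply/colP => i; rewrite ev_quad mxE cE.
rewrite raddf_sum; apply: eq_bigr => k _ /=.
rewrite raddf_sum; apply: eq_bigr => l _ /=.
by rewrite mevalZ mevalM !mevalXU mulrA.
Qed.

Lemma linear_sub_meval B x k :
  (tnth (linear_sub B) k).@[fun j => x j 0] = (B *m x) k 0.
Proof.
rewrite tnth_mktuple raddf_sum mxE; apply: eq_bigr => l _ /=.
by rewrite mevalZ mevalXU.
Qed.

Lemma ev_lract A B f x : ev (lract A B f) x = A *m ev f (invmx B *m x).
Proof.
apply/colP => i; rewrite !mxE ffunE !raddf_sum; apply: eq_bigr => j _ /=.
rewrite mevalZ mxE comp_mpoly_meval; congr (_ * _).
by apply: meval_eq => k; rewrite linear_sub_meval.
Qed.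

Lemma evXZ f (c : K) x : ev f (c *: x) = c ^+ 2 *: ev f x.
Proof.
apply/colP => i; rewrite !mxE -(dhomog_mevalZ c _ (dhomog_is_dhomog (f i))).
by apply: meval_eq => j; rewrite !mxE.
Qed.

(** [M] plays the part of [B^-1]. Working with functions lets the classification change coordinates
    by plain composition. *)
Definition lr_equiv (F G : 'cV[K]_3 -> 'cV[K]_3) : Prop :=
  exists A M, [/\ A \in unitmx, M \in unitmx & forall x, G x = A *m F (M *m x)].

Lemma lr_equiv_trans F G H : lr_equiv F G -> lr_equiv G H -> lr_equiv F H.
Proof.
move=> [A [M [uA uM FG]]] [A' [M' [uA' uM' GH]]].
exists (A' *m A), (M *m M'); rewrite !unitmx_mul uA uM uA' uM'; split => // x.
by rewrite GH FG !mulmxA.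
Qed.

Lemma lr_equiv_sym F G : lr_equiv F G -> lr_equiv G F.
Proof.
move=> [A [M [uA uM FG]]]; exists (invmx A), (invmx M); rewrite !unitmx_inv.
by split => // x; rewrite FG !mulmxA mulmxV // mulVmx // !mul1mx.
Qed.

Lemma scalemx_unit (c : K) A : c != 0 -> A \in unitmx -> c *: A \in unitmx.
Proof. by move=> c0; rewrite !unitmxE detZ unitrM unitrX ?unitfE. Qed.

Lemma lr_equivZ (c : K) F G : c != 0 -> lr_equiv F G ->
  lr_equiv F (fun x => c *: G x).
Proof.
move=> c0 [A [M [uA uM FG]]]; exists (c *: A), M; rewrite scalemx_unit //.
by split => // x; rewrite FG scalemxAl.
Qed.

Lemma lr_equiv_lract A B f : A \in unitmx -> B \in unitmx ->
  lr_equiv (ev f) (ev (lract A B f)).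
Proof.
move=> uA uB; exists A, (invmx B); rewrite unitmx_inv uA uB; split => // x.
exact: ev_lract.
Qed.

Lemma lrorbitP f v (L : Rat2 K) : represents v L ->
  lrorbit f L <-> lr_equiv (ev f) (ev v).
Proof.
move=> vL; split.
  move=> [A [B [uA uB /represents_colinear/(_ vL)[c c0 ->]]]].
  have [A' [M [uA' uM E]]] := lr_equivZ c0 (lr_equiv_lract f uA uB).
  by exists A', M; split => // x; rewrite evZ E.
move=> [A [M [uA uM E]]]; exists A, (invmx M); rewrite unitmx_inv; split => //.
have -> : lract A (invmx M) f = v; last by [].
by apply: ev_inj => x; rewrite ev_lract invmxK -E.
Qed.

Lemma lin_surj (p : dhomog 3 K 1) : exists a, p = lin a.
Proof.
have [a aE] := dhomog1_linear (dhomog_is_dhomog p).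
exists (\row_k a k); apply: DHomog_inj; rewrite [LHS]aE raddf_sum.
by apply: eq_bigr => k _; rewrite /= mxE.
Qed.

Lemma lin_meval (a : 'rV[K]_3) x :
  (lin a : {mpoly K[3]}).@[fun j => x j 0] = (a *m x) 0 0.
Proof.
rewrite /= raddf_sum /= raddf_sum mxE; apply: eq_bigr => k _ /=.
by rewrite mevalZ mevalXU.
Qed.

Lemma lin_inj : injective lin.
Proof.
move=> a b e; apply/rowP => k; have := lin_meval a (delta_mx k 0).
by rewrite e lin_meval -!colE !mxE => ->.
Qed.

Lemma lin0 : lin 0 = 0.
Proof. by rewrite /lin big1 // => k _; rewrite mxE scale0r. Qed.

Lemma lin_sum3 (u : 'rV[K]_3) N :
  lin (u *m N) = u 0 i0 *: lin (row i0 N) + u 0 i1 *: lin (row i1 N) + u 0 i2 *: lin (row i2 N).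
Proof.
apply: DHomog_inj; apply: mpoly_eval_inj => v.
have E (a : 'rV[K]_3) : (lin a : {mpoly K[3]}).@[v] = \sum_k a 0 k * v k.
  rewrite -[LHS](_ : (lin a : {mpoly K[3]}).@[fun j => (\col_j v j) j (0 : 'I_1)] = _).
    by rewrite lin_meval mxE; apply: eq_bigr => k _; rewrite mxE.
  by apply: meval_eq => j; rewrite mxE.
rewrite E /= !raddfD /= !mevalZ !E !sum3 !mxE !sum3; ring.
Qed.

Lemma free_lin_rows N : free [:: lin (row i0 N); lin (row i1 N); lin (row i2 N)] = (N \in unitmx).
Proof.
pose X := [tuple lin (row i0 N); lin (row i1 N); lin (row i2 N)].
have XE (u : 'I_3 -> K) : \sum_i u i *: X`_i = lin ((\row_i u i) *m N).
  by rewrite sum3 lin_sum3 !mxE.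
rewrite -[X in free X]/(tval X); apply/idP/idP => [/freeP fX|uN].
  rewrite -row_free_unit -kermx_eq0; apply/eqP/row_matrixP => i; rewrite row0.
  set u := row i _; have uN : u *m N = 0.
    by apply/sub_kermxP; rewrite row_sub.
  apply/rowP => j; rewrite [RHS]mxE; apply: (fX (u 0)); rewrite XE -[RHS]lin0 -uN.
  by congr (lin (_ *m N)); apply/rowP => k; rewrite mxE.
apply/freeP => u; rewrite XE -lin0 => /lin_inj e i.
have : (\row_i u i) = 0 by rewrite -[LHS](mulmxK uN) e mul0mx.
by move/rowP/(_ i); rewrite !mxE.
Qed.

Definition factored (F : 'cV[K]_3 -> 'cV[K]_3) : Prop := exists (a : 'rV[K]_3) N,
  [/\ a != 0, N \in unitmx & forall x, F x = (a *m x) 0 0 *: (N *m x)].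

Lemma ev_mkquad_lin (a b c d : 'rV[K]_3) x :
  ev (mkquad (lmul (lin a) (lin b)) (lmul (lin a) (lin c)) (lmul (lin a) (lin d))) x =
  (a *m x) 0 0 *: v3 ((b *m x) 0 0) ((c *m x) 0 0) ((d *m x) 0 0).
Proof.
by apply: cv3P; rewrite scale_v3 v3E mxE ffunE /= mevalM !lin_meval.
Qed.

Lemma rows_v3 N x : v3 ((row i0 N *m x) 0 0) ((row i1 N *m x) 0 0)
  ((row i2 N *m x) 0 0) = N *m x.
Proof. by apply: cv3P; rewrite v3E -row_mul mxE. Qed.

Lemma Sigma0P v (L : Rat2 K) : represents v L ->
  Sigma0 K L <-> factored (ev v).
Proof.
move=> vL; split.
  move=> [l [l0 [l1 [l2 [ln0 lf /represents_colinear/(_ vL)[c c0 ->]]]]]].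
  have [a aE] := lin_surj l; have [b0 b0E] := lin_surj l0.
  have [b1 b1E] := lin_surj l1; have [b2 b2E] := lin_surj l2.
  pose N : 'M[K]_3 := \matrix_i tnth [tuple b0; b1; b2] i.
  have rN : [/\ row i0 N = b0, row i1 N = b1 & row i2 N = b2] by rewrite !rowK.
  case: rN => r0 r1 r2; exists a, (c *: N); split.
  - by apply: contra ln0 => /eqP a0; rewrite aE a0 lin0.
  - by rewrite scalemx_unit // -free_lin_rows r0 r1 r2 -b0E -b1E -b2E.
  move=> x; rewrite evZ aE b0E b1E b2E ev_mkquad_lin -r0 -r1 -r2 rows_v3.
  by rewrite -scalemxAl scalerA mulrC -scalerA.
move=> [a [N [an0 uN E]]]; exists (lin a), (lin (row i0 N)), (lin (row i1 N)), (lin (row i2 N)).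
split; first by apply: contra an0 => /eqP e; apply/eqP/lin_inj; rewrite e lin0.
  by rewrite free_lin_rows.
rewrite (_ : mkquad _ _ _ = v) //; apply: ev_inj => x.
by rewrite ev_mkquad_lin rows_v3 E.
Qed.

End Evaluation.

Section Determinant3.
Context {R : comUnitRingType}.

Definition det3 (a b c : 'cV[R]_3) : R :=
  \det (\matrix_(i, j) tnth [tuple a; b; c] j i 0).

Lemma det_mx3 (M : 'M[R]_3) : \det M =
  M i0 i0 * (M i1 i1 * M i2 i2 - M i1 i2 * M i2 i1)
  - M i0 i1 * (M i1 i0 * M i2 i2 - M i1 i2 * M i2 i0)
  + M i0 i2 * (M i1 i0 * M i2 i1 - M i1 i1 * M i2 i0).
Proof.
have d2 (N : 'M[R]_2) : \det N = N 0 0 * N 1 1 - N 0 1 * N 1 0.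
  rewrite (expand_det_row _ 0) !big_ord_recl big_ord0 /cofactor !det_mx11 !mxE /=.
  rewrite !addn0 expr0 expr1 mul1r addr0 mulN1r mulrN.
  by congr (_ * N _ _ - N _ _ * N _ _); apply/val_inj.
rewrite (expand_det_row _ i0) sum3 /cofactor !d2 !mxE /=.
rewrite expr0 expr1 sqrrN expr1n !mul1r mulN1r mulrN.
by congr (_ * (M _ _ * M _ _ - M _ _ * M _ _) - _ * (M _ _ * M _ _ - M _ _ * M _ _) +
  _ * (M _ _ * M _ _ - M _ _ * M _ _)); apply/val_inj.
Qed.

Lemma det3E a b c : det3 a b c =
  a i0 0 * (b i1 0 * c i2 0 - c i1 0 * b i2 0)
  - b i0 0 * (a i1 0 * c i2 0 - c i1 0 * a i2 0)
  + c i0 0 * (a i1 0 * b i2 0 - b i1 0 * a i2 0).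
Proof. by rewrite /det3 det_mx3 !mxE. Qed.

Lemma det3_v3 a b c d e f g h i : det3 (v3 a b c) (v3 d e f) (v3 g h i) =
  a * (e * i - h * f) - d * (b * i - h * c) + g * (b * f - e * c).
Proof. by rewrite det3E !v3E. Qed.

Lemma det3_mul (A : 'M[R]_3) a b c :
  det3 (A *m a) (A *m b) (A *m c) = \det A * det3 a b c.
Proof.
rewrite /det3 -det_mulmx; congr (\det _); apply/matrixP => i j; rewrite !mxE.
case: j => -[|[|[|//]]] lt; rewrite !(tnth_nth 0) /= mxE;
  by apply: eq_bigr => k _; rewrite !mxE (tnth_nth 0).
Qed.

Lemma det_m3 a b c d e f g h i : \det (m3 a b c d e f g h i : 'M[R]_3) =
  a * (e * i - f * h) - b * (d * i - f * g) + c * (d * h - e * g).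
Proof. by rewrite det_mx3 !mxE. Qed.

End Determinant3.

Lemma m3_unit (K : fieldType) (a b c d e f g h i : K) :
  a * (e * i - f * h) - b * (d * i - f * g) + c * (d * h - e * g) != 0 ->
  m3 a b c d e f g h i \in unitmx.
Proof. by rewrite unitmxE det_m3 unitfE. Qed.

Lemma row_complete (K : fieldType) (a : 'rV[K]_3) : a != 0 ->
  exists2 M : 'M[K]_3, M \in unitmx & row i0 M = a.
Proof.
move=> a0.
have rowE (b c d e f g h i j : K) : row i0 (m3 b c d e f g h i j) =
    \row_k tnth [tuple b; c; d] k by apply/rowP => k; rewrite !mxE.
have aE : a = \row_k tnth [tuple a 0 i0; a 0 i1; a 0 i2] k.
  by apply/rowP; apply: ord3_ind; rewrite mxE.
have [a00|a00] := eqVneq (a 0 i0) 0; last first.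
  exists (m3 (a 0 i0) (a 0 i1) (a 0 i2) 0 1 0 0 0 1); last by rewrite rowE -aE.
  by apply: m3_unit; rewrite [X in X != 0](_ : _ = a 0 i0) //; ring.
have [a01|a01] := eqVneq (a 0 i1) 0; last first.
  exists (m3 (a 0 i0) (a 0 i1) (a 0 i2) 1 0 0 0 0 1); last by rewrite rowE -aE.
  by apply: m3_unit; rewrite [X in X != 0](_ : _ = - a 0 i1) ?oppr_eq0 //; ring.
exists (m3 (a 0 i0) (a 0 i1) (a 0 i2) 1 0 0 0 1 0); last by rewrite rowE -aE.
apply: m3_unit; rewrite [X in X != 0](_ : _ = a 0 i2); last by ring.
by apply: contra a0 => /eqP a02; rewrite aE a00 a01 a02; apply/eqP/rowP; apply: ord3_ind; rewrite !mxE.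
Qed.

Lemma row0_mulmx (K : fieldType) (M : 'M[K]_3) (a : 'rV[K]_3) (x : 'cV[K]_3) : row i0 M = a ->
  (a *m x) 0 0 = (M *m x) i0 0.
Proof. by move=> <-; rewrite -row_mul mxE. Qed.

(** * Invariants and degenerations *)

Section ClosedConditions.
Context {K : numFieldType}.
Implicit Types (F G : 'cV[K]_3 -> 'cV[K]_3) (f : quadtriple K) (A M : 'M[K]_3) (x y : 'cV[K]_3).
Local Open Scope classical_set_scope.

(** A normal form that makes [Sigma0] an orbit as well, so that it is handled like the other
    three. *)
Definition zeta : quadtriple K := mkquad (lmul x0 x0) (lmul x0 x1) (lmul x0 x2).

Lemma ev_zeta (a b c : K) : ev zeta (v3 a b c) = v3 (a * a) (a * b) (a * c).
Proof.
by rewrite ev_mkquad /= !mevalM !mevalXU -/i0 -/i1 -/i2 !v3E.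
Qed.

Lemma ev_zetaE (x : 'cV[K]_3) : ev zeta x = x i0 0 *: x.
Proof. by rewrite [x]v3_eta ev_zeta scale_v3 !v3E. Qed.

Lemma factored_zeta F : factored F <-> lr_equiv (ev zeta) F.
Proof.
split=> [[a [N [a0 uN FE]]]|[A [M [uA uM FE]]]].
  have [M uM aM] := row_complete a0.
  exists (N *m invmx M), M; rewrite unitmx_mul uN unitmx_inv uM; split => // x.
  by rewrite FE ev_zetaE (row0_mulmx _ aM) -scalemxAr mulmxA mulmxKV.
exists (row i0 M), (A *m M); split; last 1 first.
- by move=> x; rewrite FE ev_zetaE (row0_mulmx _ (erefl (row i0 M))) -scalemxAr mulmxA.
- apply: contraTneq uM => r0; rewrite unitmxE (expand_det_row _ i0) big1 ?unitr0 // => j _.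
  by move/rowP/(_ j): r0; rewrite !mxE => ->; rewrite mul0r.
by rewrite unitmx_mul uA.
Qed.

Definition polar F x y := F (x + y) - F x - F y.

(** For quadratic [F] the polar form at [x] is the derivative of [F] at [x], so this is the Jacobian
    determinant. *)
Definition jac F x : K :=
  det3 (polar F x (v3 1 0 0)) (polar F x (v3 0 1 0)) (polar F x (v3 0 0 1)).

Definition lines_to_lines F x y : K := det3 (F x) (F y) (F (x + y)).

(* If C (x + t y) = a + 3 b t + 3 c t^2 + d t^3, then cubic_b, cubic_c,
   cubic_hessian and cubic_disc are 6 b, 6 c, 36 (b^2 - a c) and -1296/27 times the
   discriminant. *)
Definition cubic_b (C : 'cV[K]_3 -> K) x y := C (x + y) - C (x - y) - 2%:R * C y.
Definition cubic_c (C : 'cV[K]_3 -> K) x y := C (x + y) + C (x - y) - 2%:R * C x.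

Definition cubic_hessian C x y : K :=
  cubic_b C x y ^+ 2 - 6%:R * C x * cubic_c C x y.

Definition cubic_disc C x y : K :=
  let a := C x in let b := cubic_b C x y in let c := cubic_c C x y in let d := C y in
  1296%:R * a ^+ 2 * d ^+ 2 - 216%:R * a * b * c * d + 24%:R * a * c ^+ 3
  + 24%:R * b ^+ 3 * d - 3%:R * b ^+ 2 * c ^+ 2.

Lemma polar_lr F G A M : (forall x, G x = A *m F (M *m x)) ->
  forall x y, polar G x y = A *m polar F (M *m x) (M *m y).
Proof. by move=> GE x y; rewrite /polar !GE mulmxDr !mulmxBr. Qed.

Lemma jac_lr F G A M (J : 'cV[K]_3 -> 'M[K]_3) :
  (forall x y, polar F x y = J x *m y) ->
  (forall x, G x = A *m F (M *m x)) ->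
  forall x, jac G x = \det A * \det M * \det (J (M *m x)).
Proof.
move=> FJ GE x; rewrite /jac !(polar_lr GE) det3_mul !FJ det3_mul det3_mul.
by rewrite det3_v3; ring.
Qed.

Lemma polar_sigma (x y : 'cV[K]_3) : polar (ev sigma) x y =
  m3 0 (x i2 0) (x i1 0) (x i2 0) 0 (x i0 0) (x i1 0) (x i0 0) 0 *m y.
Proof.
rewrite /polar [x]v3_eta [y]v3_eta add_v3 !ev_sigma m3_v3 !opp_v3 !add_v3 !v3E.
by congr v3; ring.
Qed.

Lemma polar_rho (x y : 'cV[K]_3) : polar (ev rho) x y =
  m3 (x i1 0) (x i0 0) 0 0 0 (2%:R * x i2 0) 0 (x i2 0) (x i1 0) *m y.
Proof.
rewrite /polar [x]v3_eta [y]v3_eta add_v3 !ev_rho m3_v3 !opp_v3 !add_v3 !v3E.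
by congr v3; ring.
Qed.

Lemma polar_tau (x y : 'cV[K]_3) : polar (ev tau) x y =
  m3 (2%:R * x i0 0) 0 0 (x i1 0) (x i0 0) 0 (- x i2 0) (2%:R * x i1 0) (- x i0 0) *m y.
Proof.
rewrite /polar [x]v3_eta [y]v3_eta add_v3 !ev_tau m3_v3 !opp_v3 !add_v3 !v3E.
by congr v3; ring.
Qed.

Lemma polar_zeta (x y : 'cV[K]_3) : polar (ev zeta) x y =
  m3 (2%:R * x i0 0) 0 0 (x i1 0) (x i0 0) 0 (x i2 0) 0 (x i0 0) *m y.
Proof.
rewrite /polar [x]v3_eta [y]v3_eta add_v3 !ev_zeta m3_v3 !opp_v3 !add_v3 !v3E.
by congr v3; ring.
Qed.

Lemma jac_sigma G A M : (forall x, G x = A *m ev sigma (M *m x)) ->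
  forall x, let z := M *m x in
  jac G x = 2%:R * \det A * \det M * (z i0 0 * z i1 0 * z i2 0).
Proof. by move=> GE x z; rewrite (jac_lr polar_sigma GE) det_m3 -/z; ring. Qed.

Lemma jac_rho G A M : (forall x, G x = A *m ev rho (M *m x)) ->
  forall x, let z := M *m x in
  jac G x = - 2%:R * \det A * \det M * (z i1 0 * z i2 0 ^+ 2).
Proof. by move=> GE x z; rewrite (jac_lr polar_rho GE) det_m3 -/z; ring. Qed.

Lemma jac_tau G A M : (forall x, G x = A *m ev tau (M *m x)) ->
  forall x, let z := M *m x in
  jac G x = - 2%:R * \det A * \det M * z i0 0 ^+ 3.
Proof. by move=> GE x z; rewrite (jac_lr polar_tau GE) det_m3 -/z; ring. Qed.

Lemma cubic_hessian_cube (l : 'rV[K]_3) k (C : 'cV[K]_3 -> K) x y :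
  (forall z, C z = k * (l *m z) 0 0 ^+ 3) -> cubic_hessian C x y = 0.
Proof.
move=> CE; rewrite /cubic_hessian /cubic_b /cubic_c !CE mulmxBr mulmxDr !mxE.
by move: (\sum_j _) (\sum_j _) => a b; ring.
Qed.

Lemma cubic_disc_square (l m : 'rV[K]_3) k (C : 'cV[K]_3 -> K) x y :
  (forall z, C z = k * ((l *m z) 0 0 * (m *m z) 0 0 ^+ 2)) -> cubic_disc C x y = 0.
Proof.
move=> CE; rewrite /cubic_disc /cubic_b /cubic_c !CE !mulmxBr !mulmxDr !mxE.
by move: (\sum_j _) (\sum_j _) (\sum_j _) (\sum_j _) => a b c d; ring.
Qed.

Lemma lines_to_lines_zeta G x y : lr_equiv (ev zeta) G -> lines_to_lines G x y = 0.
Proof.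
move=> [A [M [_ _ GE]]]; rewrite /lines_to_lines !GE det3_mul mulmxDr.
move: (M *m x) (M *m y) => u v; rewrite [u]v3_eta [v]v3_eta add_v3 !ev_zeta det3_v3.
by ring.
Qed.

Lemma lr_equiv_det A M : A \in unitmx -> M \in unitmx -> \det A * \det M != 0 :> K.
Proof. by rewrite !unitmxE !unitfE => a b; rewrite mulf_neq0. Qed.

Lemma lines_to_lines_neq0 F G : lr_equiv F G ->
  (exists x y, lines_to_lines F x y != 0) -> exists x y, lines_to_lines G x y != 0.
Proof.
move=> [A [M [uA uM GE]]] [x [y xy]]; exists (invmx M *m x), (invmx M *m y).
rewrite /lines_to_lines !GE det3_mul -mulmxDr !mulKVmx //.
by rewrite mulf_neq0 // -unitfE -unitmxE.
Qed.

Lemma lines_to_lines_sigma : exists x y, lines_to_lines (ev sigma) x y != 0 :> K.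
Proof.
exists (v3 1 0 1), (v3 0 1 1); rewrite /lines_to_lines add_v3 !ev_sigma det3_v3.
rewrite [X in X != 0](_ : _ = - 1) ?oppr_eq0 ?oner_eq0 //; ring.
Qed.

Lemma lines_to_lines_rho : exists x y, lines_to_lines (ev rho) x y != 0 :> K.
Proof.
exists (v3 0 0 1), (v3 1 1 0); rewrite /lines_to_lines add_v3 !ev_rho det3_v3.
rewrite [X in X != 0](_ : _ = - 1) ?oppr_eq0 ?oner_eq0 //; ring.
Qed.

Lemma lines_to_lines_tau : exists x y, lines_to_lines (ev tau) x y != 0 :> K.
Proof.
exists (v3 1 0 0), (v3 0 1 0); rewrite /lines_to_lines add_v3 !ev_tau det3_v3.
rewrite [X in X != 0](_ : _ = - 1) ?oppr_eq0 ?oner_eq0 //; ring.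
Qed.

Lemma jac_hessian_sigma G : lr_equiv (ev sigma) G ->
  exists x y, cubic_hessian (jac G) x y != 0.
Proof.
(* In the coordinates [z = M x] the Jacobian restricts to a multiple of [1 + t] on this line, which
   is not a cube. *)
move=> [A [M [uA uM GE]]]; exists (invmx M *m v3 1 1 1), (invmx M *m v3 1 0 0).
rewrite /cubic_hessian /cubic_b /cubic_c !(jac_sigma GE) mulmxDr mulmxBr !mulKVmx //.
rewrite opp_v3 !add_v3 !v3E; have k0 := lr_equiv_det uA uM.
rewrite [X in X != 0](_ : _ = 16%:R * (\det A * \det M) ^+ 2); last by ring.
by rewrite mulf_neq0 ?expf_neq0 // pnatr_eq0.
Qed.

Lemma jac_hessian_rho G : lr_equiv (ev rho) G ->
  exists x y, cubic_hessian (jac G) x y != 0.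
Proof.
move=> [A [M [uA uM GE]]]; exists (invmx M *m v3 0 1 1), (invmx M *m v3 0 1 0).
rewrite /cubic_hessian /cubic_b /cubic_c !(jac_rho GE) mulmxDr mulmxBr !mulKVmx //.
rewrite opp_v3 !add_v3 !v3E; have k0 := lr_equiv_det uA uM.
rewrite [X in X != 0](_ : _ = 16%:R * (\det A * \det M) ^+ 2); last by ring.
by rewrite mulf_neq0 ?expf_neq0 // pnatr_eq0.
Qed.

Lemma jac_disc_sigma G : lr_equiv (ev sigma) G ->
  exists x y, cubic_disc (jac G) x y != 0.
Proof.
(* This line meets the three lines [z_i = 0] at the distinct values [t = 0, -1, 1]. *)
move=> [A [M [uA uM GE]]]; exists (invmx M *m v3 0 1 1), (invmx M *m v3 1 1 (-1)).
rewrite /cubic_disc /cubic_b /cubic_c !(jac_sigma GE) mulmxDr mulmxBr !mulKVmx //.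
rewrite opp_v3 !add_v3 !v3E; have k0 := lr_equiv_det uA uM.
rewrite [X in X != 0](_ : _ = - 3072%:R * (\det A * \det M) ^+ 4); last by ring.
by rewrite mulf_neq0 ?expf_neq0 // oppr_eq0 pnatr_eq0.
Qed.

Lemma jac_hessian_tau G x y : lr_equiv (ev tau) G -> cubic_hessian (jac G) x y = 0.
Proof.
move=> [A [M [_ _ GE]]]; apply: (cubic_hessian_cube (l := row i0 M)) => z.
by rewrite (jac_tau GE) (row0_mulmx _ (erefl (row i0 M))).
Qed.

Lemma jac_disc_rho G x y : lr_equiv (ev rho) G -> cubic_disc (jac G) x y = 0.
Proof.
move=> [A [M [_ _ GE]]]; apply: (cubic_disc_square (l := row i1 M) (m := row i2 M)) => z.
by rewrite (jac_rho GE) -!row_mul !mxE.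
Qed.

End ClosedConditions.

(** * Homogeneous conditions, degenerations and orbit closures *)

Section ZariskiClosedSets.
Context {K : numFieldType} {V : vectType K}.
Local Open Scope classical_set_scope.

Definition homog_fun d (phi : V -> K) : Prop :=
  exists2 p : {mpoly K[\dim {:V}]}, p \is d.-homog & polyfun p =1 phi.

Lemma homog_funD d phi psi : homog_fun d phi -> homog_fun d psi ->
  homog_fun d (fun v => phi v + psi v).
Proof.
move=> [p pd pE] [q qd qE]; exists (p + q); first exact: rpredD.
by move=> v; rewrite /polyfun mevalD -pE -qE.
Qed.

Lemma homog_funZ d c phi : homog_fun d phi -> homog_fun d (fun v => c * phi v).
Proof.
move=> [p pd pE]; exists (c *: p); first exact: rpredZ.
by move=> v; rewrite /polyfun mevalZ -pE.
Qed.

Lemma homog_funM d e phi psi : homog_fun d phi -> homog_fun e psi ->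
  homog_fun (d + e) (fun v => phi v * psi v).
Proof.
move=> [p pd pE] [q qd qE]; exists (p * q); first exact: dhomogM.
by move=> v; rewrite /polyfun mevalM -pE -qE.
Qed.

Lemma eq_homog_fun d phi psi : homog_fun d phi -> phi =1 psi -> homog_fun d psi.
Proof. by move=> [p pd pE] e; exists p => // v; rewrite pE. Qed.

Lemma homog_funN d phi : homog_fun d phi -> homog_fun d (fun v => - phi v).
Proof. by move/(homog_funZ (-1))/eq_homog_fun; apply => v; rewrite mulN1r. Qed.

Lemma zclosed_family (I : Type) d (phi : I -> V -> K) :
  (forall i, homog_fun d (phi i)) ->
  zclosed [set L : proj V | forall v, represents v L -> forall i, phi i v = 0].
Proof.
move=> phiP; pose S : set {mpoly K[\dim {:V}]} :=
  [set p | p \is d.-homog /\ exists i, polyfun p =1 phi i].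
exists S; split=> [p [pd _]|]; first by exists d.
apply/seteqP; split=> L.
  by move=> H p v [_ [i pE]] vL; rewrite pE H.
by move=> H v vL i; have [p pd pE] := phiP i; rewrite -pE; apply: H vL; split => //; exists i.
Qed.

(** An equation of [Z] restricted to the line is a polynomial in [e] that vanishes for [e != 0],
    hence also at [0]. *)
Lemma zclosed_limit (Z : set (proj V)) (v h : V) L : zclosed Z ->
  (forall e, e != 0 -> cone Z (v + e *: h)) -> represents v L -> Z L.
Proof.
move=> [S [Sh ->]] ZS vL p v' Sp v'L; have [d pd] := Sh _ Sp.
have [c _ ->] := represents_colinear vL v'L; rewrite (polyfunZ _ _ pd).
have [q qE] := mpoly_along_polys p (fun i =>
  (coord (vbasis {:V}) i v)%:P + coord (vbasis {:V}) i h *: 'X).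
have {}qE e : q.[e] = polyfun p (v + e *: h).
  rewrite qE; apply: meval_eq => i.
  by rewrite !hornerE linearD linearZ /= mulrC.
have q0 : q * 'X = 0.
  apply: poly_eval_eq0 => e; rewrite !hornerE qE.
  have [->|e0] := eqVneq e 0; first by rewrite mulr0.
  by have [L' ZL' uL'] := ZS e e0; rewrite (ZL' _ _ Sp uL') mul0r.
have : q.[0] = 0.
  by move/eqP: q0; rewrite mulf_eq0 polyX_eq0 orbF => /eqP ->; rewrite horner0.
by rewrite qE scale0r addr0 => ->; rewrite mulr0.
Qed.

End ZariskiClosedSets.

Section OrbitClosures.
Context {K : numFieldType}.
Local Open Scope classical_set_scope.
Implicit Types (f h s u : quadtriple K) (x y : 'cV[K]_3) (L : Rat2 K).

Lemma homog_fun_ev x i : homog_fun 1 (fun f : quadtriple K => ev f x i 0).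
Proof.
exists (\sum_(k < \dim {:quadtriple K}) ev (vbasis {:quadtriple K})`_k x i 0 *: 'X_k).
  by apply: rpred_sum => k _; apply: rpredZ; rewrite dhomogX /= mdeg1.
move=> f; rewrite /polyfun raddf_sum /= [in RHS](coord_vbasis (memvf f)).
rewrite ev_sum summxE; apply: eq_bigr => k _.
by rewrite mevalZ mevalXU mulrC evZ [RHS]mxE.
Qed.

Lemma homog_fun_det3 (a b c : quadtriple K -> 'cV[K]_3) :
  (forall i, homog_fun 1 (fun f => a f i 0)) ->
  (forall i, homog_fun 1 (fun f => b f i 0)) ->
  (forall i, homog_fun 1 (fun f => c f i 0)) ->
  homog_fun 3 (fun f => det3 (a f) (b f) (c f)).
Proof.
move=> aP bP cP.
have M2 i j k (u v w : quadtriple K -> 'cV[K]_3) :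
    (forall i, homog_fun 1 (fun f => u f i 0)) ->
    (forall i, homog_fun 1 (fun f => v f i 0)) ->
    (forall i, homog_fun 1 (fun f => w f i 0)) ->
    homog_fun 3 (fun f => u f i 0 * (v f j 0 * w f k 0)).
  by move=> uP vP wP; exact: (homog_funM (uP i) (homog_funM (vP j) (wP k))).
have H := homog_funD (homog_funD (homog_funD (M2 i0 i1 i2 _ _ _ aP bP cP)
  (homog_funN (M2 i0 i1 i2 _ _ _ aP cP bP)))
  (homog_funD (homog_funN (M2 i0 i1 i2 _ _ _ bP aP cP)) (M2 i0 i1 i2 _ _ _ bP cP aP)))
  (homog_funD (M2 i0 i1 i2 _ _ _ cP aP bP) (homog_funN (M2 i0 i1 i2 _ _ _ cP bP aP))).
by apply: (eq_homog_fun H) => f; rewrite det3E; ring.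
Qed.

Lemma homog_fun_polar x y i : homog_fun 1 (fun f => polar (ev f) x y i 0).
Proof.
have H := homog_funD (homog_funD (homog_fun_ev (x + y) i)
  (homog_funN (homog_fun_ev x i))) (homog_funN (homog_fun_ev y i)).
by apply: (eq_homog_fun H) => f; rewrite /polar !mxE.
Qed.

Lemma homog_fun_lines x y : homog_fun 3 (fun f => lines_to_lines (ev f) x y).
Proof. by apply: homog_fun_det3 => i; exact: homog_fun_ev. Qed.

Lemma homog_fun_jac x : homog_fun 3 (fun f => jac (ev f) x).
Proof. by apply: homog_fun_det3 => i; exact: homog_fun_polar. Qed.

Lemma homog_fun_cubic_b x y : homog_fun 3 (fun f => cubic_b (jac (ev f)) x y).
Proof.
exact: (homog_funD (homog_funD (homog_fun_jac (x + y)) (homog_funN (homog_fun_jac (x - y))))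
  (homog_funN (homog_funZ 2%:R (homog_fun_jac y)))).
Qed.

Lemma homog_fun_cubic_c x y : homog_fun 3 (fun f => cubic_c (jac (ev f)) x y).
Proof.
exact: (homog_funD (homog_funD (homog_fun_jac (x + y)) (homog_fun_jac (x - y)))
  (homog_funN (homog_funZ 2%:R (homog_fun_jac x)))).
Qed.

Lemma homog_fun_hessian x y : homog_fun 6 (fun f => cubic_hessian (jac (ev f)) x y).
Proof.
have b := homog_fun_cubic_b x y; have c := homog_fun_cubic_c x y.
have a := homog_fun_jac x.
apply: (eq_homog_fun (homog_funD (homog_funM b b) (homog_funZ (- 6%:R) (homog_funM a c)))).
by move=> f; rewrite /cubic_hessian; ring.
Qed.

Lemma homog_fun_disc x y : homog_fun 12 (fun f => cubic_disc (jac (ev f)) x y).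
Proof.
have b := homog_fun_cubic_b x y; have c := homog_fun_cubic_c x y.
have a := homog_fun_jac x; have d := homog_fun_jac y.
have M4 (p q r s : quadtriple K -> K) : homog_fun 3 p -> homog_fun 3 q ->
    homog_fun 3 r -> homog_fun 3 s -> homog_fun 12 (fun f => (p f * q f) * (r f * s f)).
  by move=> P Q R S; exact: (homog_funM (homog_funM P Q) (homog_funM R S)).
apply: (eq_homog_fun (homog_funD (homog_funD (homog_funD (homog_funD
  (homog_funZ 1296%:R (M4 _ _ _ _ a a d d)) (homog_funZ (- 216%:R) (M4 _ _ _ _ a b c d)))
  (homog_funZ 24%:R (M4 _ _ _ _ a c c c))) (homog_funZ 24%:R (M4 _ _ _ _ b b b d)))
  (homog_funZ (- 3%:R) (M4 _ _ _ _ b b c c)))).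
by move=> f; rewrite /cubic_disc; ring.
Qed.

(** The group acts linearly on triples and moves lines to lines, so one degeneration to the normal
    form serves for its whole orbit. *)
Lemma lrorbit_limit s f h (Z : set (Rat2 K)) :
  (exists x, ev s x != 0) ->
  (forall e, e != 0 -> lr_equiv (ev s) (ev (f + e *: h))) ->
  zclosed Z -> lrorbit s `<=` Z -> lrorbit f `<=` Z.
Proof.
move=> [x sx] sf Zc sZ L [A [B [uA uB vL]]].
apply: (zclosed_limit (h := lract A B h) Zc _ vL) => e e0.
have -> : lract A B f + e *: lract A B h = lract A B (f + e *: h).
  by apply: ev_inj => y; rewrite evD evZ !ev_lract evD evZ mulmxDr scalemxAr.
have E := lr_equiv_trans (sf e e0) (lr_equiv_lract (f + e *: h) uA uB).
have [|L' uL'] := represents_exists (v := lract A B (f + e *: h)).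
  apply: contra sx => /eqP u0; have [A' [M' [_ _ H]]] := lr_equiv_sym E.
  by rewrite H u0 ev0 mulmx0.
by exists L' => //; apply: sZ; apply/(lrorbitP _ uL').
Qed.

Lemma Sigma0_orbit : Sigma0 K = lrorbit zeta.
Proof.
apply/seteqP; split=> L; have [v vL] := representative_exists L.
  by move/(Sigma0P vL)/factored_zeta/(lrorbitP _ vL).
by move/(lrorbitP _ vL)/factored_zeta/(Sigma0P vL).
Qed.

Lemma ev_neq0 s (a b c : K) p q r : ev s (v3 a b c) = v3 p q r ->
  (p != 0) || (q != 0) || (r != 0) -> exists x, ev s x != 0.
Proof.
move=> E n0; exists (v3 a b c); rewrite E; apply: contraTneq n0 => /v3_eq0[-> -> ->].
by rewrite !eqxx.
Qed.

(** The line is [(x0 x1 : x2 (x2 - e x0) : x1 x2)]: up to a left factor, this is [sigma] in the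
    linear forms [x1, x2, x2 - e x0], two of which merge at [e = 0]. *)
Lemma Sigma2_limit (Z : set (Rat2 K)) : zclosed Z ->
  Sigma3 K `<=` Z -> Sigma2 K `<=` Z.
Proof.
apply: (lrorbit_limit (h := mkquad 0 (- lmul x0 x2) 0)).
  by apply: (ev_neq0 (ev_sigma 1 1 1)); rewrite mulr1 oner_eq0.
move=> e e0; exists (m3 0 (- e^-1) e^-1 1 0 0 0 0 1), (m3 0 1 0 0 0 1 (- e) 0 1); split.
- by apply: m3_unit; rewrite [X in X != 0](_ : _ = e^-1) ?invr_eq0 //; ring.
- by apply: m3_unit; rewrite [X in X != 0](_ : _ = - e) ?oppr_eq0 //; ring.
move=> x; rewrite [x]v3_eta; move: (x i0 0) (x i1 0) (x i2 0) => a b c.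
rewrite evD evZ ev_rho ev_mkquad m3_v3 ev_sigma m3_v3 scale_v3 add_v3 /=.
rewrite meval0 mevalN mevalM !mevalXU -/i0 -/i2 !v3E.
by congr v3; field.
Qed.

(** Here [rho] is taken in the linear forms [x1 - e x2, x0 + e x1, x0], the last two of which merge
    at [e = 0]; the left factor has poles in [e] that compensate for this. *)
Lemma Sigma1_limit (Z : set (Rat2 K)) : zclosed Z ->
  Sigma2 K `<=` Z -> Sigma1 K `<=` Z.
Proof.
apply: (lrorbit_limit (h := mkquad 0 0 (- lmul x1 x2))).
  by apply: (ev_neq0 (ev_rho 1 1 1)); rewrite mulr1 oner_eq0.
move=> e e0; exists (m3 0 1 0 0 (- e^-1) e^-1 e^-1 (e ^- 2) (- e ^- 2)),
  (m3 0 1 (- e) 1 e 0 1 0 0); split.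
- apply: m3_unit; rewrite [X in X != 0](_ : _ = e ^- 2) ?invr_eq0 ?expf_neq0 //.
  by field.
- by apply: m3_unit; rewrite [X in X != 0](_ : _ = e ^+ 2) ?expf_neq0 //; ring.
move=> x; rewrite [x]v3_eta; move: (x i0 0) (x i1 0) (x i2 0) => a b c.
rewrite evD evZ ev_tau ev_mkquad m3_v3 ev_rho m3_v3 scale_v3 add_v3 /=.
rewrite meval0 mevalN mevalM !mevalXU -/i1 -/i2 !v3E.
by congr v3; field.
Qed.

(** Scaling [x2] by [e^-1] turns [tau], up to a left factor, into
    [(x0^2 : x0 x1 : x0 x2 - e x1^2)]. *)
Lemma Sigma0_limit (Z : set (Rat2 K)) : zclosed Z ->
  Sigma1 K `<=` Z -> Sigma0 K `<=` Z.
Proof.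
rewrite Sigma0_orbit; apply: (lrorbit_limit (h := mkquad 0 0 (- lmul x1 x1))).
  by apply: (ev_neq0 (ev_tau 1 0 0)); rewrite mulr1 oner_eq0.
move=> e e0; exists (m3 1 0 0 0 1 0 0 0 (- e)), (m3 1 0 0 0 1 0 0 0 e^-1); split.
- by apply: m3_unit; rewrite [X in X != 0](_ : _ = - e) ?oppr_eq0 //; ring.
- by apply: m3_unit; rewrite [X in X != 0](_ : _ = e^-1) ?invr_eq0 //; ring.
move=> x; rewrite [x]v3_eta; move: (x i0 0) (x i1 0) (x i2 0) => a b c.
rewrite evD evZ ev_zeta ev_mkquad m3_v3 ev_tau m3_v3 scale_v3 add_v3 /=.
rewrite meval0 mevalN mevalM !mevalXU -/i1 !v3E.
by congr v3; field.
Qed.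

Lemma Sigma_lr s L : lrorbit s L -> exists2 v, represents v L & lr_equiv (ev s) (ev v).
Proof.
by move=> sL; have [v vL] := representative_exists L; exists v => //; apply/(lrorbitP _ vL).
Qed.

Definition lines_locus : set (Rat2 K) :=
  [set L | forall v, represents v L -> forall p : _ * _, lines_to_lines (ev v) p.1 p.2 = 0].
Definition hessian_locus : set (Rat2 K) :=
  [set L | forall v, represents v L -> forall p : _ * _, cubic_hessian (jac (ev v)) p.1 p.2 = 0].
Definition disc_locus : set (Rat2 K) :=
  [set L | forall v, represents v L -> forall p : _ * _, cubic_disc (jac (ev v)) p.1 p.2 = 0].

Lemma zclosed_lines : zclosed lines_locus.
Proof. by apply: zclosed_family => p; exact: homog_fun_lines. Qed.
Lemma zclosed_hessian : zclosed hessian_locus.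
Proof. by apply: zclosed_family => p; exact: homog_fun_hessian. Qed.
Lemma zclosed_disc : zclosed disc_locus.
Proof. by apply: zclosed_family => p; exact: homog_fun_disc. Qed.

(** Established below over algebraically closed fields, as [Bir2_decomposition]. It reduces each
    closure to excluding the remaining orbits one by one. *)
Hypothesis Bir2E : Bir2 K = Sigma0 K `|` Sigma1 K `|` Sigma2 K `|` Sigma3 K.

Lemma zclosure_Sigma0 : zclosure_in (Bir2 K) (Sigma0 K) = Sigma0 K.
Proof.
apply/seteqP; split=> L; last first.
  by move=> L0; split; [rewrite Bir2E; left; left; left|move=> Z _; apply].
have nl s : (exists x y, lines_to_lines (ev s) x y != 0) -> lrorbit s L ->
    ~ lines_locus L.
  move=> sn /Sigma_lr[v vL vE] H; have [x [y]] := lines_to_lines_neq0 vE sn.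
  by rewrite (H v vL (x, y)) eqxx.
move=> [+ /(_ _ zclosed_lines)]; rewrite Bir2E => B H.
have {}H : lines_locus L.
  apply: H => L'; rewrite Sigma0_orbit => L0 v vL' p.
  by apply: lines_to_lines_zeta; apply/(lrorbitP _ vL').
case: B => [[[//|]|]|] LS.
- by case: (nl _ lines_to_lines_tau LS).
- by case: (nl _ lines_to_lines_rho LS).
- by case: (nl _ lines_to_lines_sigma LS).
Qed.

Lemma zclosure_Sigma1 :
  zclosure_in (Bir2 K) (Sigma1 K) = Sigma0 K `|` Sigma1 K.
Proof.
apply/seteqP; split=> L; last first.
  move=> L01; split; first by rewrite Bir2E; left; left.
  by move=> Z Zc sZ; case: L01; [exact: Sigma0_limit|exact: sZ].
move=> [+ /(_ _ zclosed_hessian)]; rewrite Bir2E => B H.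
have {}H : hessian_locus L.
  apply: H => L' L1 v vL' p.
  by apply: jac_hessian_tau; apply/(lrorbitP _ vL').
case: B => [[//|]|] /Sigma_lr[v vL vE]; exfalso.
- by have [x [y]] := jac_hessian_rho vE; rewrite (H v vL (x, y)) eqxx.
- by have [x [y]] := jac_hessian_sigma vE; rewrite (H v vL (x, y)) eqxx.
Qed.

Lemma zclosure_Sigma2 :
  zclosure_in (Bir2 K) (Sigma2 K) = Sigma0 K `|` Sigma1 K `|` Sigma2 K.
Proof.
apply/seteqP; split=> L; last first.
  move=> L012; split; first by rewrite Bir2E; left.
  move=> Z Zc sZ; have sZ1 := Sigma1_limit Zc sZ.
  by case: L012 => [[]|]; [exact: Sigma0_limit|exact: sZ1|exact: sZ].
move=> [+ /(_ _ zclosed_disc)]; rewrite Bir2E => B H.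
have {}H : disc_locus L.
  apply: H => L' L2 v vL' p.
  by apply: jac_disc_rho; apply/(lrorbitP _ vL').
case: B => [//|] /Sigma_lr[v vL vE]; exfalso.
by have [x [y]] := jac_disc_sigma vE; rewrite (H v vL (x, y)) eqxx.
Qed.

Lemma zclosure_Sigma3 : zclosure_in (Bir2 K) (Sigma3 K) = Bir2 K.
Proof.
apply/seteqP; split=> L; first by case.
move=> BL; split => // Z Zc sZ; have sZ2 := Sigma2_limit Zc sZ.
have sZ1 := Sigma1_limit Zc sZ2; have sZ0 := Sigma0_limit Zc sZ1.
by move: BL; rewrite Bir2E => -[[[]|]|]; [exact: sZ0|exact: sZ1|exact: sZ2|exact: sZ].
Qed.

End OrbitClosures.

(** * Birational maps *)

Section RationalMapsOfPlane.
Context {K : numClosedFieldType}.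
Implicit Types (F G : triple K) (v : quadtriple K) (x y : 'cV[K]_3).

Definition evt F x : 'cV[K]_3 := \col_i (F i).@[fun j => x j 0].

Lemma evt_triple_of v x : evt (triple_of v) x = ev v x.
Proof. by apply/colP => i; rewrite !mxE. Qed.

Lemma evt_inj F G : (forall x, evt F x = evt G x) -> forall i, F i = G i.
Proof.
move=> FG i; apply: mpoly_eval_inj => u.
have /colP/(_ i) := FG (\col_j u j); rewrite !mxE => E.
transitivity ((F i).@[fun j => (\col_j u j) j (0 : 'I_1)]).
  by apply: meval_eq => j; rewrite mxE.
by rewrite E; apply: meval_eq => j; rewrite mxE.
Qed.

Lemma evt_comp F G x : evt (comp_triple G F) x = evt G (evt F x).
Proof.
apply/colP => i; rewrite !mxE comp_mpoly_meval; apply: meval_eq => j.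
by rewrite tnth_mktuple mxE.
Qed.

Lemma evt_neq0 F x : evt F x != 0 -> nonzero_triple F.
Proof.
move=> Fx; apply: contrapT => nF; case/eqP: Fx; apply/colP => i; rewrite !mxE.
have [->|Fi] := eqVneq (F i) 0; first by rewrite meval0.
by case: nF; exists i.
Qed.

Lemma left_inverse_evt F G (h : 'cV[K]_3 -> K) :
  (forall x, evt G (evt F x) = h x *: x) -> (exists2 x, h x != 0 & x != 0) ->
  left_inverse_map G F.
Proof.
move=> GF [x hx xn0]; split.
  by apply: (evt_neq0 (x := x)); rewrite evt_comp GF scaler_eq0 negb_or hx.
have E := fun x => etrans (evt_comp F G x) (GF x).
move=> i j; apply: mpoly_eval_inj => u; rewrite !mevalM /id_triple !mevalXU.
pose y : 'cV[K]_3 := \col_l u l.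
have Ei l : (comp_triple G F l).@[u] = h y * u l.
  have /colP/(_ l) := E y; rewrite !mxE => <-.
  by apply: meval_eq => k; rewrite mxE.
by rewrite !Ei; ring.
Qed.

Lemma birational_evt F G (h k : 'cV[K]_3 -> K) :
  homog_triple F -> homog_triple G ->
  (forall x, evt G (evt F x) = h x *: x) -> (exists2 x, h x != 0 & x != 0) ->
  (forall x, evt F (evt G x) = k x *: x) -> (exists2 x, k x != 0 & x != 0) ->
  (exists x, evt F x != 0) -> (exists x, evt G x != 0) -> birational F.
Proof.
move=> Fh Gh GF h0 FG k0 [x Fx] [y Gy]; split=> //; first exact: evt_neq0 Fx.
by exists G; split => //; [exact: evt_neq0 Gy|exact: left_inverse_evt h0|exact: left_inverse_evt k0].
Qed.

Lemma homog_triple_of v : homog_triple (triple_of v).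
Proof. by exists 2%N => i; exact: (dhomog_is_dhomog (v i)). Qed.

(** As [s] is an involution up to the factor [h], the triple with left factor [invmx M] and
    substitution [invmx A] inverts [v]. All three normal forms are such involutions. *)
Lemma birational_lr_equiv s v (h : 'cV[K]_3 -> K) :
  (forall x, ev s (ev s x) = h x *: x) -> (exists2 x, h x != 0 & x != 0) ->
  (exists x, ev s x != 0) ->
  lr_equiv (ev s) (ev v) -> birational (triple_of v).
Proof.
move=> ss [x hx x0] [y sy] [A [M [uA uM vE]]].
have A0 (B : 'M[K]_3) (z : 'cV[K]_3) : B \in unitmx -> z != 0 -> B *m z != 0.
  by move=> uB; apply: contra => /eqP e; rewrite -[z](mulKmx uB) e mulmx0.
have gE z : ev (lract (invmx M) A s) z = invmx M *m ev s (invmx A *m z).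
  exact: ev_lract.
have uA' : invmx A \in unitmx by rewrite unitmx_inv.
have uM' : invmx M \in unitmx by rewrite unitmx_inv.
apply: (@birational_evt (triple_of v) (triple_of (lract (invmx M) A s))
  (fun z => h (M *m z)) (fun z => h (invmx A *m z))).
- exact: homog_triple_of.
- exact: homog_triple_of.
- move=> z; rewrite !evt_triple_of gE vE mulKmx // ss -scalemxAr mulKmx //.
- by exists (invmx M *m x); [rewrite mulKVmx|apply: A0].
- move=> z; rewrite !evt_triple_of vE gE mulKVmx // ss -scalemxAr mulKVmx //.
- by exists (A *m x); [rewrite mulKmx|apply: A0].
- by exists (invmx M *m y); rewrite evt_triple_of vE mulKVmx // A0.
- by exists (A *m y); rewrite evt_triple_of gE mulKmx // A0.
Qed.

Lemma sigma_involution x : ev sigma (ev sigma x) =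
  (x i0 0 * x i1 0 * x i2 0) *: x.
Proof. by rewrite [x]v3_eta !ev_sigma scale_v3 !v3E; congr v3; ring. Qed.

Lemma rho_involution x : ev rho (ev rho x) = (x i1 0 * x i2 0 ^+ 2) *: x.
Proof. by rewrite [x]v3_eta !ev_rho scale_v3 !v3E; congr v3; ring. Qed.

Lemma tau_involution x : ev tau (ev tau x) = x i0 0 ^+ 3 *: x.
Proof. by rewrite [x]v3_eta !ev_tau scale_v3 !v3E; congr v3; ring. Qed.

Lemma ones_neq0 : v3 1 1 1 != 0 :> 'cV[K]_3.
Proof. by apply/eqP => /v3_eq0[/eqP]; rewrite oner_eq0. Qed.

Lemma ev_sigma_neq0 : exists x : 'cV[K]_3, ev sigma x != 0.
Proof. by apply: (ev_neq0 (ev_sigma 1 1 1)); rewrite mulr1 oner_eq0. Qed.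

Lemma ev_rho_neq0 : exists x : 'cV[K]_3, ev rho x != 0.
Proof. by apply: (ev_neq0 (ev_rho 1 1 1)); rewrite mulr1 oner_eq0. Qed.

Lemma ev_tau_neq0 : exists x : 'cV[K]_3, ev tau x != 0.
Proof. by apply: (ev_neq0 (ev_tau 1 1 1)); rewrite mulr1 oner_eq0. Qed.

Lemma birational_sigma v : lr_equiv (ev sigma) (ev v) -> birational (triple_of v).
Proof.
apply: (birational_lr_equiv sigma_involution _ ev_sigma_neq0).
by exists (v3 1 1 1); rewrite ?ones_neq0 // !v3E !mulr1 oner_eq0.
Qed.

Lemma birational_rho v : lr_equiv (ev rho) (ev v) -> birational (triple_of v).
Proof.
apply: (birational_lr_equiv rho_involution _ ev_rho_neq0).
by exists (v3 1 1 1); rewrite ?ones_neq0 // !v3E expr1n mulr1 oner_eq0.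
Qed.

Lemma birational_tau v : lr_equiv (ev tau) (ev v) -> birational (triple_of v).
Proof.
apply: (birational_lr_equiv tau_involution _ ev_tau_neq0).
by exists (v3 1 1 1); rewrite ?ones_neq0 // !v3E expr1n oner_eq0.
Qed.

(** Nonzero when the line through [(1, 1, 1)] in direction [y] misses the points where two
    coordinates vanish, since [1 + t y_i] and [1 + t y_j] have a common root only if [y_i = y_j].
    The base points of the normal forms are among these points. *)
Definition distinct_coords (y : 'I_3 -> K) : K :=
  (y i0 - y i1) * ((y i0 - y i2) * (y i1 - y i2)).

(* A common factor has no zero on a line avoiding the base locus, hence is
   constant along it; almost all lines through a general point are such. *)
Lemma no_common_factor_lines F (M : 'M[K]_3) : M \in unitmx ->
  (forall y : 'I_3 -> K, distinct_coords y != 0 ->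
     forall t, evt F (M *m (v3 1 1 1 + t *: \col_i y i)) != 0) ->
  no_common_factor F.
Proof.
move=> uM Fline h hF.
pose pt (y : 'I_3 -> K) : 'cV[K]_3 := M *m (v3 1 1 1 + \col_i y i).
pose H (y : 'I_3 -> K) : K := h.@[fun j => pt y j 0].
have F0 x : h.@[fun j => x j 0] = 0 -> evt F x = 0.
  move=> hx; apply/colP => i; rewrite !mxE; have [q ->] := hF i.
  by rewrite mevalM hx mul0r.
have ptE (y : 'I_3 -> K) j : pt y j 0 = \sum_k M j k * (1 + y k).
  rewrite /pt mxE; apply: eq_bigr => k _; rewrite !mxE; congr (_ * (_ + _)).
  by move: k; apply: ord3_ind.
have Hline (y : 'I_3 -> K) : distinct_coords y != 0 -> H y = H (fun=> 0).
  move=> dy; have [p pE] := mpoly_along_polys h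
    (fun j => \sum_k M j k *: (1 + y k *: 'X)).
  have {}pE t : p.[t] = h.@[fun j => (M *m (v3 1 1 1 + t *: \col_i y i)) j 0].
    rewrite pE; apply: meval_eq => j; rewrite horner_sum mxE.
    apply: eq_bigr => k _; rewrite !hornerE !mxE; congr (_ * _); rewrite mulrC; congr (_ + _).
    by move: k; apply: ord3_ind.
  have : size p == 1%N.
    apply: contraT => /closed_rootP[t /rootP]; rewrite pE => /F0 e.
    by have := Fline y dy t; rewrite e eqxx.
  move=> /size_poly1P[c _ pc].
  transitivity p.[1].
    by rewrite pE; apply: meval_eq => j; rewrite scale1r.
  rewrite pc hornerC -(hornerC c 0) -pc pE; apply: meval_eq => j.
  rewrite scale0r /pt; congr ((_ *m (_ + _)) _ _).
  by apply/colP => l; rewrite !mxE.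
have linP j : polynomial_fun (fun y : 'I_3 -> K => pt y j 0).
  have [q qE] := polynomial_fun_sum (index_enum 'I_3) predT (fun k =>
    polynomial_funM (polynomial_fun_cst 'I_3 (M j k))
      (polynomial_funD (polynomial_fun_cst 'I_3 1) (polynomial_fun_var k))).
  by exists q => y; rewrite ptE -qE.
have HP := polynomial_fun_mpoly h linP.
have dP : polynomial_fun distinct_coords.
  have P a b := polynomial_funD (polynomial_fun_var (a : 'I_3)) (polynomial_funN (polynomial_fun_var b)).
  exact: (polynomial_funM (P K i0 i1) (polynomial_funM (P K i0 i2) (P K i1 i2))).
(* The difference times [distinct_coords] vanishes identically, and the second factor is nonzero at
   [(0, 1, 2)]. *)
have HC : forall y : 'I_3 -> K, H y - H (fun=> 0) = 0.
  case: (polynomial_fun_mul_eq0 (polynomial_funD HP (polynomial_fun_cst _ (- H (fun=> 0)))) dP) => //.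
    move=> y; have [->|dy] := eqVneq (distinct_coords y) 0; first by rewrite mulr0.
    by rewrite -/(H y) (Hline y dy) subrr mul0r.
  move/(_ (fun i => i%:R)); rewrite /distinct_coords /= => /eqP.
  by rewrite !mulf_eq0 !subr_eq0 !eqr_nat.
have hC : h = (H (fun=> 0))%:MP.
  apply: mpoly_eval_inj => u; rewrite mevalC.
  pose y (l : 'I_3) := (invmx M *m \col_j u j) l 0 - 1.
  have /subr0_eq <- := HC y; apply: meval_eq => j.
  rewrite /pt (_ : v3 1 1 1 + _ = invmx M *m \col_j u j) ?mulKVmx ?mxE //.
  apply/colP => l; rewrite [LHS]mxE [X in _ + X]mxE /y.
  have -> : v3 1 1 1 l 0 = 1 :> K by move: l; apply: ord3_ind; rewrite v3E.
  by rewrite addrC subrK.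
have c0 : H (fun=> 0) != 0.
  apply/eqP => c0; have dn : distinct_coords (fun i => i%:R) != 0.
    by rewrite /distinct_coords /= !mulf_eq0 !subr_eq0 !eqr_nat.
  by have := Fline _ dn 0; rewrite F0 ?eqxx // hC c0 mevalC.
by rewrite hC; apply: rmorph_unit; rewrite unitfE.
Qed.

End RationalMapsOfPlane.

(** Comparing components of degree [d + k] gives the claim. It makes the common factor in
    [reduction] homogeneous, so that its degree is determined. *)
Lemma dhomog_mul_dvd (R : idomainType) n d k (h p : {mpoly R[n]}) :
  p != 0 -> p \is d.-homog -> h * p \is (d + k).-homog -> h \is k.-homog.
Proof.
move=> p0 pd hp.
have E : pihomog mdeg (d + k) (h * p) = pihomog mdeg k h * p.
  rewrite {1}[h](pihomog_partitionE (mf := mdeg) (leqnn (msize h))).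
  rewrite mulr_suml linear_sum /=.
  have hj j : pihomog mdeg (d + k) (pihomog mdeg j h * p) =
      if j == k then pihomog mdeg k h * p else 0.
    have jd : pihomog mdeg j h * p \is (j + d).-homog by rewrite dhomogM ?pihomogP.
    case: eqP => [<-|jk]; first by rewrite addnC pihomog_dE.
    by rewrite (pihomog_ne0 _ jd) // addnC eqn_add2l; apply/eqP.
  under eq_bigr do rewrite hj.
  have [ltk|lek] := ltnP k (msize h).
    rewrite (bigD1 (Ordinal ltk)) //= eqxx big1 ?addr0 // => j ne.
    by case: eqP => // e; case/eqP: ne; apply/val_inj.
  rewrite big1 => [|j _]; last first.
    by case: eqP => // e; move: lek; rewrite -e leqNgt ltn_ord.
  rewrite pihomogE big_seq_cond big_pred0 ?mul0r // => m.
  apply/negbTE/negP => /andP[/msize_mdeg_lt lt /eqP e].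
  by move: lek; rewrite -e leqNgt lt.
move: E; rewrite pihomog_dE // => /(mulIf p0) ->; exact: pihomogP.
Qed.

Lemma dhomog_msizeE (R : idomainType) n d (p : {mpoly R[n]}) :
  p != 0 -> p \is d.-homog -> msize p = d.+1.
Proof.
move=> p0 /dhomogP pd; rewrite -mlead_deg //; congr _.+1.
exact: (pd _ (mlead_supp p0)).
Qed.

(** * The orbits inside [Bir2], and the degree of the reduced map *)

Section QuadraticBirationalMaps.
Context {K : numClosedFieldType}.
Local Open Scope classical_set_scope.
Implicit Types (F G : triple K) (s v : quadtriple K) (x : 'cV[K]_3) (L : Rat2 K).

Lemma distinct_coordsP (y : 'I_3 -> K) i j t : distinct_coords y != 0 -> i != j ->
  1 + t * y i = 0 -> 1 + t * y j != 0.
Proof.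
rewrite !mulf_eq0 !subr_eq0 !negb_or => /andP[n01 /andP[n02 n12]] ij ei.
have yij : y i != y j.
  move: i j ij ei; apply: ord3_ind => j; move: j; apply: ord3_ind => //.
  - by move=> _ _; rewrite eq_sym.
  - by move=> _ _; rewrite eq_sym.
  - by move=> _ _; rewrite eq_sym.
apply: contra yij => /eqP ej; have t0 : t != 0.
  by apply: contra_eq_neq ei => ->; rewrite mul0r addr0 oner_neq0.
by apply/eqP/(mulfI t0)/(addrI 1); rewrite ei ej.
Qed.

Lemma no_common_factor_lr_equiv s v :
  (forall y : 'I_3 -> K, distinct_coords y != 0 -> forall t,
     ev s (v3 (1 + t * y i0) (1 + t * y i1) (1 + t * y i2)) != 0) ->
  lr_equiv (ev s) (ev v) -> no_common_factor (triple_of v).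
Proof.
move=> sy [A [M [uA uM vE]]].
apply: (@no_common_factor_lines _ _ (invmx M)); first by rewrite unitmx_inv.
move=> y dy t; rewrite evt_triple_of vE mulKVmx //.
have -> : v3 1 1 1 + t *: \col_i y i = v3 (1 + t * y i0) (1 + t * y i1) (1 + t * y i2).
  by apply: cv3P; rewrite !v3E !mxE.
by apply: contra (sy y dy t) => /eqP e; rewrite -[ev s _](mulKmx uA) e mulmx0.
Qed.

Lemma no_common_factor_sigma v : lr_equiv (ev sigma) (ev v) ->
  no_common_factor (triple_of v).
Proof.
apply: no_common_factor_lr_equiv => y dy t; rewrite ev_sigma.
have n := fun i j => @distinct_coordsP y i j t dy.
apply/eqP => /v3_eq0[/eqP + /eqP + /eqP]; rewrite !mulf_eq0.
have [/n e0|_] := eqVneq (1 + t * y i0) 0.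
  by rewrite (negbTE (e0 i1 isT)) (negbTE (e0 i2 isT)).
have [/n e1|//] := eqVneq (1 + t * y i1) 0.
by rewrite (negbTE (e1 i2 isT)).
Qed.

Lemma no_common_factor_rho v : lr_equiv (ev rho) (ev v) ->
  no_common_factor (triple_of v).
Proof.
apply: no_common_factor_lr_equiv => y dy t; rewrite ev_rho.
have n := fun i j => @distinct_coordsP y i j t dy.
apply/eqP => /v3_eq0[/eqP + /eqP + /eqP]; rewrite !mulf_eq0 orbb => + /eqP e2 _.
by rewrite (negbTE (n i2 i0 isT e2)) (negbTE (n i2 i1 isT e2)).
Qed.

Lemma no_common_factor_tau v : lr_equiv (ev tau) (ev v) ->
  no_common_factor (triple_of v).
Proof.
apply: no_common_factor_lr_equiv => y dy t; rewrite ev_tau.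
have n := fun i j => @distinct_coordsP y i j t dy.
apply/eqP => /v3_eq0[/eqP + _]; rewrite mulf_eq0 orbb => /eqP e0.
rewrite e0 mul0r subr0 => /eqP; rewrite mulf_eq0 orbb.
by rewrite (negbTE (n i0 i1 isT e0)).
Qed.

Lemma oBir2_intro v L : represents v L -> no_common_factor (triple_of v) ->
  birational (triple_of v) -> oBir2 K L.
Proof.
move=> vL ncf bir; split; last by exists v.
exists v => //; exists (triple_of v) => //; split => //.
by exists 1 => i; rewrite mul1r.
Qed.

Lemma Sigma3_oBir2 : Sigma3 K `<=` oBir2 K.
Proof.
move=> L /Sigma_lr[v vL vE].
exact: (oBir2_intro vL (no_common_factor_sigma vE) (birational_sigma vE)).
Qed.

Lemma Sigma2_oBir2 : Sigma2 K `<=` oBir2 K.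
Proof.
move=> L /Sigma_lr[v vL vE].
exact: (oBir2_intro vL (no_common_factor_rho vE) (birational_rho vE)).
Qed.

Lemma Sigma1_oBir2 : Sigma1 K `<=` oBir2 K.
Proof.
move=> L /Sigma_lr[v vL vE].
exact: (oBir2_intro vL (no_common_factor_tau vE) (birational_tau vE)).
Qed.

Definition linear_triple (N : 'M[K]_3) : triple K := fun i => lin (row i N).

Lemma evt_linear N x : evt (linear_triple N) x = N *m x.
Proof. by apply/colP => i; rewrite mxE lin_meval -row_mul mxE. Qed.

Lemma homog_linear N : homog_triple (linear_triple N).
Proof. by exists 1%N => i; exact: (dhomog_is_dhomog (lin (row i N))). Qed.

Lemma mulmx_ones_neq0 (N : 'M[K]_3) : N \in unitmx -> N *m v3 1 1 1 != 0.
Proof.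
move=> uN; apply: contra (@ones_neq0 K) => /eqP e.
by rewrite -[v3 1 1 1](mulKmx uN) e mulmx0.
Qed.

Lemma birational_linear N : N \in unitmx -> birational (linear_triple N).
Proof.
move=> uN; have uN' : invmx N \in unitmx by rewrite unitmx_inv.
apply: (@birational_evt K _ (linear_triple (invmx N)) (fun=> 1) (fun=> 1)).
- exact: homog_linear.
- exact: homog_linear.
- by move=> x; rewrite !evt_linear mulKmx // scale1r.
- by exists (v3 1 1 1); rewrite ?oner_neq0 ?ones_neq0.
- by move=> x; rewrite !evt_linear mulKVmx // scale1r.
- by exists (v3 1 1 1); rewrite ?oner_neq0 ?ones_neq0.
- by exists (v3 1 1 1); rewrite evt_linear mulmx_ones_neq0.
- by exists (v3 1 1 1); rewrite evt_linear mulmx_ones_neq0.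
Qed.

Lemma no_common_factor_linear N : N \in unitmx ->
  no_common_factor (linear_triple N).
Proof.
move=> uN; apply: (@no_common_factor_lines _ _ (invmx N)); first by rewrite unitmx_inv.
move=> y dy t; rewrite evt_linear mulKVmx //.
apply/eqP => e; have ei i : 1 + t * y i = 0.
  have /colP/(_ i) := e; rewrite !mxE => <-; congr (_ + _).
  by move: i; apply: ord3_ind.
by have := distinct_coordsP dy (isT : i0 != i1) (ei i0); rewrite ei eqxx.
Qed.

Lemma triple_of_factored v (a : 'rV[K]_3) N :
  (forall x, ev v x = (a *m x) 0 0 *: (N *m x)) ->
  forall i, triple_of v i = (lin a : {mpoly K[3]}) * linear_triple N i.
Proof.
move=> vE; apply: evt_inj => x; rewrite evt_triple_of vE.
by apply/colP => i; rewrite [LHS]mxE [RHS]mxE mevalM !lin_meval -row_mul [row _ _ _ _]mxE.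
Qed.

Lemma Sigma0_Bir2 : Sigma0 K `<=` Bir2 K.
Proof.
move=> L; have [v vL] := representative_exists L.
move=> /(Sigma0P vL)[a [N [a0 uN vE]]]; exists v => //.
exists (linear_triple N); last exact: birational_linear.
split; first exact: no_common_factor_linear.
by exists (lin a); exact: triple_of_factored.
Qed.

Lemma unit_lin_eq0 (a : 'rV[K]_3) :
  ((lin a : {mpoly K[3]}) \is a GRing.unit) = false.
Proof.
apply/negbTE/negP => /unitrP[q [_ aq]].
have := congr1 (meval (fun j => (0 : 'cV[K]_3) j 0)) aq.
rewrite mevalM meval1 lin_meval mulmx0 mxE mul0r => /eqP.
by rewrite eq_sym oner_eq0.
Qed.

Lemma no_common_factor_linear_factor v (a : 'rV[K]_3) N :
  no_common_factor (triple_of v) ->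
  ~ (forall x, ev v x = (a *m x) 0 0 *: (N *m x)).
Proof.
move=> ncf vE; have := ncf (lin a); rewrite unit_lin_eq0 => H.
suff : false by []; apply: H => i; exists (linear_triple N i).
exact: triple_of_factored.
Qed.

Lemma lin_eq0 (a : 'rV[K]_3) : (lin a : {mpoly K[3]}) = 0 -> a = 0.
Proof. by move=> e; apply: lin_inj; rewrite lin0; apply: DHomog_inj. Qed.

Lemma constant_not_inverse F G : (forall i, exists c, F i = c%:MP) ->
  ~ left_inverse_map F G.
Proof.
move=> Fc [[i Fi] FX]; have /choice[c cE] := Fc.
case/eqP: Fi; have FE j : comp_triple F G j = (c j)%:MP.
  by rewrite /comp_triple cE comp_mpolyC.
rewrite FE; have [j ij] : exists j : 'I_3, i != j.
  by move: {FX FE} i; apply: ord3_ind; [exists i1|exists i0|exists i0].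
have := FX i j; rewrite !FE /id_triple !mul_mpolyC => /(congr1 (mcoeff U_(j))).
rewrite !mcoeffZ !mcoeffX eqxx mulr1.
have -> : (U_(i) == U_(j))%MM = false.
  by apply/negbTE; apply: contra ij => /eqP/mnmP/(_ i); rewrite !mnm1E eqxx; case: eqP => // -> .
by rewrite mulr0 => ->; rewrite mpolyC0.
Qed.

(** A relation [u *m N = 0] would hold for the composite, hence for the three variables, which are
    linearly independent. *)
Lemma linear_inverse_unit N G : left_inverse_map (linear_triple N) G -> N \in unitmx.
Proof.
move=> [[j Hj] HX]; rewrite unitmxE unitfE; apply/negP => /det0P[u u0 uN].
case/eqP: u0; apply: lin_eq0; apply/eqP; rewrite -(mulrI_eq0 _ (mulfI Hj)).
have linE (a : 'rV[K]_3) : (lin a : {mpoly K[3]}) = \sum_k a 0 k *: 'X_k.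
  by rewrite /= raddf_sum.
rewrite linE mulr_sumr.
under eq_bigr => k _ do rewrite -scalerAr [_ * _]HX scalerAl.
rewrite -mulr_suml.
have -> : \sum_i u 0 i *: comp_triple (linear_triple N) G i =
    (lin (u *m N) : {mpoly K[3]}) \mPo [tuple G j | j < 3].
  by rewrite sum3 lin_sum3 /= !comp_mpolyD !comp_mpolyZ.
by rewrite uN lin0 comp_mpoly0 mul0r.
Qed.

(** The reduced map [F] has degree [e <= 2]. A constant map has no inverse; for [e = 1] an
    invertible linear map remains; for [e = 2] the common factor is a constant, and the inverse of
    [F] serves for [f]. *)
Lemma Bir2_cases L : Bir2 K L -> Sigma0 K L \/
  exists2 v, represents v L & no_common_factor (triple_of v) /\
    exists2 G, homog_triple G & left_inverse_map (triple_of v) G.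
Proof.
move=> [f fL [F [ncf [h hF]] [[e Fe] [i Fi] [G [Gh _ _ FG]]]]].
have fn0 := represents_neq0 fL.
have h0 : h != 0.
  apply: contra fn0 => /eqP h0; apply/eqP/ev_inj => x; rewrite ev0.
  by apply/colP => k; rewrite !mxE -/(triple_of f k) hF h0 mul0r meval0.
have fi0 : triple_of f i != 0 by rewrite hF mulf_neq0.
have fh k : triple_of f k \is 2.-homog by exact: (dhomog_is_dhomog (f k)).
have lee : (e <= 2)%N.
  have := dhomog_msizeE fi0 (fh i); rewrite hF msizeM // (dhomog_msizeE Fi (Fe i)).
  by rewrite (mpolySpred _ h0) addSn /= addnS => -[<-]; rewrite leq_addl.
have hd : h \is (2 - e).-homog.
  by apply: (dhomog_mul_dvd Fi (Fe i)); rewrite subnKC // -hF.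
case: e => [|[|[|//]]] in lee Fe hd *.
- exfalso; apply: (@constant_not_inverse F G) => // k.
  exact: (dhomog0_mpolyC (Fe k)).
- left; have [a hE] := lin_surj (DHomog hd).
  have /choice[b bE] : forall k, exists b, F k = lin b.
    by move=> k; have [b bE] := lin_surj (DHomog (Fe k)); exists b; rewrite -bE.
  pose N := \matrix_k b k.
  have FN : F = linear_triple N.
    by apply/funext => k; rewrite bE /linear_triple rowK.
  have uN : N \in unitmx by apply: (@linear_inverse_unit _ G); rewrite -FN.
  have {}hE : h = lin a by rewrite -hE.
  apply/(Sigma0P fL); exists a, N; split => //.
    by apply: contra h0 => /eqP a0; rewrite hE a0 lin0.
  move=> x; rewrite -evt_triple_of; apply/colP => k.
  rewrite [LHS]mxE [RHS]mxE hF mevalM hE lin_meval FN lin_meval -row_mul.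
  by rewrite [row _ _ _ _]mxE.
- right; exists f => //; have [c hc] := dhomog0_mpolyC hd.
  have c0 : c != 0 by apply: contra h0 => /eqP c0; rewrite hc c0 mpolyC0.
  have fF k : triple_of f k = c *: F k by rewrite hF hc mul_mpolyC.
  split.
    move=> g gf; apply: ncf => k; have [q qE] := gf k; exists (c^-1 *: q).
    by rewrite -scalerAr -qE fF scalerA mulVf // scale1r.
  exists G => //; case: FG => -[j Hj] HX.
  have cE k : comp_triple (triple_of f) G k = c *: comp_triple F G k.
    by rewrite /comp_triple fF comp_mpolyZ.
  split; first by exists j; rewrite cE scaler_eq0 negb_or c0.
  by move=> k l; rewrite !cE -!scalerAl HX.
Qed.

End QuadraticBirationalMaps.

(** * Rational sections over lines *)

Lemma mpoly_along_polys2 (R : comNzRingType) n (q : {mpoly R[n]})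
    (s : 'I_n -> {poly {poly R}}) :
  {r : {poly {poly R}} | forall e z, r.[e%:P].[z] = q.@[fun a => (s a).[e%:P].[z]]}.
Proof.
exists (mmap (polyC \o @polyC R) s q) => e z.
rewrite mevalE !horner_sum; apply: eq_bigr => m _.
rewrite !hornerE; congr (_ * _); rewrite /mmap1 !horner_prod.
by apply: eq_bigr => i _; rewrite !horner_exp.
Qed.

Lemma poly_vector_order (R : idomainType) (p : 'I_3 -> {poly R}) :
  (exists i, p i != 0) -> exists s (q : 'I_3 -> {poly R}),
    (forall i, p i = q i * 'X^s) /\ exists i, (q i).[0] != 0.
Proof.
move=> [i pi]; have [m] := ubnP (size (p i)).
elim: m p pi => // m IH p pi ltm.
have [[j pj]|n0] := pselect (exists j, (p j).[0] != 0).
  by exists 0%N, p; split; [move=> k; rewrite expr0 mulr1|exists j].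
have /choice[r rE] : forall j, exists r, p j = r * ('X - 0%:P).
  move=> j; apply/factor_theorem/rootP/eqP.
  by apply: contrapT => /negP pj; apply: n0; exists j.
have {}rE j : p j = r j * 'X by rewrite rE subr0.
have ri : r i != 0 by apply: contra pi => /eqP r0; rewrite rE r0 mul0r.
have [|s [q [qE q0]]] := IH r ri.
  by move: ltm; rewrite rE size_mulX.
exists s.+1, q; split => // j.
by rewrite rE qE exprSr mulrA.
Qed.

Section Sections.
Context {K : numClosedFieldType}.
Implicit Types (F : 'cV[K]_3 -> 'cV[K]_3) (A M : 'M[K]_3) (v : quadtriple K).

(* F has a rational section over almost all lines t |-> A (t, c, 1) ... *)
Definition generic_sections F : Prop := forall A, A \in unitmx ->
  exists2 d : {poly K}, d != 0 & forall c, d.[c] != 0 ->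
    exists (g : 'I_3 -> {poly K}) (k : {poly K}), k != 0 /\
      forall z, F (\col_i (g i).[z]) = k.[z] *: (A *m v3 z c 1).

(* ... and, when it has no base point, over all lines. *)
Definition limit_sections F : Prop := (forall x, F x = 0 -> x = 0) ->
  forall A, A \in unitmx -> exists (g : 'I_3 -> {poly K}) (k : {poly K}), k != 0 /\
    forall z, F (\col_i (g i).[z]) = k.[z] *: (A *m v3 0 z 1).

Lemma generic_sections_lr F F' : lr_equiv F F' ->
  generic_sections F -> generic_sections F'.
Proof.
move=> [B [M [uB uM FE]]] sF A uA.
have [|d d0 dP] := sF (invmx B *m A); first by rewrite unitmx_mul unitmx_inv uB.
exists d => // c /dP[g [k [k0 gE]]].
exists (fun i => \sum_j invmx M i j *: g j), k; split => // z.
rewrite FE (_ : M *m _ = \col_i (g i).[z]).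
  by rewrite gE -scalemxAr !mulmxA mulmxV // mul1mx.
rewrite -[RHS](mulKVmx uM); congr (M *m _); apply/colP => i; rewrite !mxE horner_sum.
by apply: eq_bigr => j _; rewrite !hornerE mxE.
Qed.

Lemma limit_sections_lr F F' : F 0 = 0 -> lr_equiv F F' ->
  limit_sections F -> limit_sections F'.
Proof.
move=> F00 [B [M [uB uM FE]]] sF nb A uA.
have [x Fx||g [k [k0 gE]]] := sF _ (invmx B *m A).
- by rewrite -[x](mulKVmx uM) (nb (invmx M *m x)) ?mulmx0 // FE mulKVmx // Fx mulmx0.
- by rewrite unitmx_mul unitmx_inv uB.
exists (fun i => \sum_j invmx M i j *: g j), k; split => // z.
rewrite FE (_ : M *m _ = \col_i (g i).[z]).
  by rewrite gE -scalemxAr !mulmxA mulmxV // mul1mx.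
rewrite -[RHS](mulKVmx uM); congr (M *m _); apply/colP => i; rewrite !mxE horner_sum.
by apply: eq_bigr => j _; rewrite !hornerE mxE.
Qed.

Variables (v : quadtriple K) (G : triple K).
Hypothesis Gh : homog_triple G.
Hypothesis vG : left_inverse_map (triple_of v) G.

Let H x := ev v (evt G x).

Let HE : H = evt (comp_triple (triple_of v) G).
Proof. by apply/funext => x; rewrite evt_comp evt_triple_of. Qed.

Let H_colinear x : H x *m x^T = x *m (H x)^T.
Proof.
have [_ HX] := vG; apply/matrixP => i j; rewrite HE !mxE !big_ord1 !mxE.
have := congr1 (meval (fun j => x j 0)) (HX i j).
by rewrite /id_triple !mevalM !mevalXU => ->; rewrite mulrC.
Qed.

(** Of two proportional vectors, [u] has third coordinate [1], so the factor is the third coordinate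
    of the other one; along a line it is therefore a polynomial. *)
Let H_along A (u : 'cV[K]_3) : A \in unitmx -> u i2 0 = 1 ->
  H (A *m u) = ((invmx A *m H (A *m u)) i2 0) *: (A *m u).
Proof.
move=> uA u1; set w := invmx A *m _.
have wu : w *m u^T = u *m w^T.
  have := congr1 (fun B => invmx A *m B *m (invmx A)^T) (H_colinear (A *m u)).
  by rewrite !trmx_mul !mulmxA mulVmx // mul1mx -/w -[_ *m A^T *m _]mulmxA -trmx_mul mulVmx // trmx1 mulmx1 -mulmxA -trmx_mul.
have wE : w = w i2 0 *: u.
  apply/colP => i; have := congr1 (fun B : 'M_3 => B i i2) wu.
  by rewrite !mxE !big_ord1 !mxE u1 mulr1 => ->; rewrite mulrC.
by rewrite scalemxAr -wE mulKVmx.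
Qed.

Let H_neq0 A : A \in unitmx -> exists a b, H (A *m v3 a b 1) != 0.
Proof.
move=> uA; have [[j Hj] _] := vG.
have [e Ge] := Gh.
pose r := lin (row i2 (invmx A)).
have r0 : (r : {mpoly K[3]}) != 0.
  apply/eqP => /lin_eq0 r0; have : invmx A \in unitmx by rewrite unitmx_inv.
  rewrite unitmxE (expand_det_row _ i2) big1 ?unitr0 // => k _.
  by move/rowP/(_ k): r0; rewrite !mxE => ->; rewrite mul0r.
(* The form [r] is the third coordinate with respect to [A]; where it is nonzero, the point can be
   scaled to the form [A *m v3 a b 1]. *)
have [y] : exists y : 'I_3 -> K, (comp_triple (triple_of v) G j * r).@[y] != 0.
  apply: contrapT => n0; have /negP := mulf_neq0 Hj r0; apply.
  apply/eqP/mpoly_eval_eq0 => y; apply/eqP; apply: contrapT => /negP ny.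
  by apply: n0; exists y.
rewrite mevalM mulf_eq0 negb_or => /andP[Hy ry].
pose x : 'cV[K]_3 := \col_j y j.
have xy (p : {mpoly K[3]}) : p.@[y] = p.@[fun j => x j 0].
  by apply: meval_eq => k; rewrite mxE.
have Hx : H x != 0.
  rewrite HE; apply/eqP => /colP/(_ j); rewrite mxE [RHS]mxE -xy => /eqP.
  by rewrite (negbTE Hy).
pose u := invmx A *m x.
have u2 : u i2 0 != 0 by move: ry; rewrite xy lin_meval -row_mul mxE.
exists (u i0 0 / u i2 0), (u i1 0 / u i2 0).
have -> : v3 (u i0 0 / u i2 0) (u i1 0 / u i2 0) 1 = (u i2 0)^-1 *: u.
  by apply: cv3P; rewrite v3E [RHS]mxE [RHS]mulrC // mulfV.
rewrite -scalemxAr mulKVmx //.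
have GZ (c : K) : evt G (c *: x) = c ^+ e *: evt G x.
  apply/colP => k; rewrite !mxE -(dhomog_mevalZ c _ (Ge k)).
  by apply: meval_eq => l; rewrite !mxE.
by rewrite /H GZ evXZ !scaler_eq0 !negb_or !expf_neq0 ?invr_eq0.
Qed.

Let H_polynomial (s : 'I_3 -> {poly K}) i (A : 'M[K]_3) :
  exists p : {poly K}, forall z, p.[z] = (A *m H (\col_j (s j).[z])) i 0.
Proof.
have [p pE] := mpoly_along_polys (\sum_j A i j *: comp_triple (triple_of v) G j) s.
exists p => z; rewrite pE mxE raddf_sum; apply: eq_bigr => j _ /=.
by rewrite mevalZ HE mxE; congr (_ * _); apply: meval_eq => l; rewrite mxE.
Qed.

(** In the coordinates given by [A], [d] is a component of [H] on the line [(a : z : 1)], nonzero at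
    [z = b]. If [d.[c] != 0], then [H] does not vanish identically on the line [(t : c : 1)], and
    [G] restricted to that line is the section. *)
Lemma section_generic : generic_sections (ev v).
Proof.
move=> A uA; have [a [b Hab]] := H_neq0 uA.
have [j Hj] : exists j, H (A *m v3 a b 1) j 0 != 0.
  apply: contrapT => n0; case/eqP: Hab; apply/colP => j; rewrite [RHS]mxE.
  by apply/eqP; apply: contrapT => /negP nj; apply: n0; exists j.
have lineE (p q r : {poly K}) z : A *m v3 p.[z] q.[z] r.[z] =
    \col_j (A j i0 *: p + A j i1 *: q + A j i2 *: r).[z].
  by apply/colP => k; rewrite !mxE sum3 !v3E !hornerE.
have [d dE] := H_polynomial (fun j => A j i0 *: a%:P + A j i1 *: 'X + A j i2 *: 1) j 1%:M.
have {}dE z : d.[z] = H (A *m v3 a z 1) j 0.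
  by rewrite dE mul1mx -lineE !hornerE.
exists d; first by apply: contra Hj => /eqP d0; rewrite -dE d0 horner0.
move=> c dc.
pose s j := A j i0 *: 'X + A j i1 *: c%:P + A j i2 *: 1.
have sE z : \col_j (s j).[z] = A *m v3 z c 1 by rewrite -lineE !hornerE.
have [k kE] := H_polynomial s i2 (invmx A).
pose g i := sval (mpoly_along_polys (G i) s).
have gE i : forall z, (g i).[z] = (G i).@[fun a => (s a).[z]] := svalP (mpoly_along_polys (G i) s).
have gE' z : ev v (\col_i (g i).[z]) = H (A *m v3 z c 1).
  rewrite /H; congr (ev v _); apply/colP => i; rewrite !mxE gE.
  by apply: meval_eq => l; rewrite -sE mxE.
exists g, k; split; last by move=> z; rewrite gE' kE sE; apply: H_along; rewrite ?v3E.
apply: contra dc => /eqP k0; rewrite dE H_along ?v3E // -sE -kE k0 horner0.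
by rewrite scale0r mxE.
Qed.

(* Restricting G to A (e, z, 1) and dividing by the largest power of e gives a
   section over the line e = 0. *)
Lemma section_limit : limit_sections (ev v).
Proof.
move=> nb A uA; have [a [b Hab]] := H_neq0 uA.
(* The outer variable stands for [e], the variable of the coefficients for [z]. *)
pose s j : {poly {poly K}} := ((A j i0)%:P)%:P * 'X + (A j i1 *: 'X)%:P + ((A j i2)%:P)%:P.
have sE e z : \col_j (s j).[e%:P].[z] = A *m v3 e z 1.
  by apply/colP => k; rewrite !mxE sum3 !v3E !hornerE.
pose p i := sval (mpoly_along_polys2 (G i) s).
have pE e z i : (p i).[e%:P].[z] = evt G (A *m v3 e z 1) i 0.
  rewrite (svalP (mpoly_along_polys2 (G i) s)) mxE.
  by apply: meval_eq => l; rewrite -sE mxE.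
have ev00 : ev v 0 = 0.
  by have := evXZ v 0 0; rewrite scale0r expr0n scale0r.
have [i pi] : exists i, p i != 0.
  apply: contrapT => n0; case/eqP: Hab.
  rewrite /H (_ : evt G _ = 0) //; apply/colP => i; rewrite -pE [RHS]mxE.
  have [->|pi] := eqVneq (p i) 0; first by rewrite !horner0.
  by case: n0; exists i.
have [n [q [qE [j qj]]]] := poly_vector_order (ex_intro _ i pi).
pose w e z : 'cV[K]_3 := \col_i (q i).[e%:P].[z].
have wE e z : evt G (A *m v3 e z 1) = e ^+ n *: w e z.
  by apply/colP => l; rewrite -pE qE !mxE !hornerE mulrC.
pose P l e z := (invmx A *m ev v (w e z)) l 0.
have scE (c : K) (X : 'cV[K]_3) l : (c *: X) l 0 = c * X l 0 by rewrite mxE.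
have PE e z : e != 0 -> invmx A *m ev v (w e z) = P i2 e z *: v3 e z 1.
  move=> e0; have := @H_along A (v3 e z 1) uA (v3E2 _ _ _).
  rewrite /H wE evXZ -scalemxAr scE -[(_ * _) *: (A *m _)]scalerA.
  move/(scalerI (expf_neq0 2 (expf_neq0 n e0))) => ->.
  by rewrite -scalemxAr mulKmx.
have Ppoly z l : exists r : {poly K}, forall e, r.[e] = P l e z.
  have [r rE] := mpoly_along_polys (\sum_k invmx A l k *: triple_of v k)
    (fun a => map_poly (horner_eval z) (q a)).
  exists r => e; rewrite rE /P mxE raddf_sum; apply: eq_bigr => k _ /=.
  rewrite mevalZ mxE; congr (_ * _); apply: meval_eq => l'.
  by rewrite mxE -{1}(hornerC e z) -/(horner_eval z e%:P) horner_map.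
(* [PE] only covers [e != 0]; for fixed [z] both sides are polynomial in [e], so the proportionality
   persists at [e = 0]. *)
have P0 z : invmx A *m ev v (w 0 z) = P i2 0 z *: v3 0 z 1.
  have at0 (r : {poly K}) : (forall e, e != 0 -> r.[e] = 0) -> r.[0] = 0.
    move=> r0; have : r * 'X = 0.
      apply: poly_eval_eq0 => e; rewrite !hornerE.
      by have [->|/r0 ->] := eqVneq e 0; rewrite ?mulr0 ?mul0r.
    by move/eqP; rewrite mulf_eq0 polyX_eq0 orbF => /eqP ->; rewrite horner0.
  have [r0 r0E] := Ppoly z i0; have [r1 r1E] := Ppoly z i1; have [r2 r2E] := Ppoly z i2.
  have E e : e != 0 -> r0.[e] = r2.[e] * e /\ r1.[e] = r2.[e] * z.
    by move=> e0; rewrite r0E r1E r2E; split; rewrite {1}/P PE // scE v3E.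
  rewrite scale_v3 mulr0 mulr1; apply: cv3P; rewrite v3E -/(P _ 0 z) -?r0E -?r1E -?r2E //.
    have := at0 (r0 - r2 * 'X); rewrite !hornerE ?mulr0 ?subr0; apply => e e0.
    by rewrite !hornerE; have [-> _] := E e e0; rewrite subrr.
  have := at0 (r1 - z *: r2); rewrite !hornerE => H1; apply/subr0_eq; rewrite mulrC.
  by apply: H1 => e e0; rewrite !hornerE; have [_ ->] := E e e0; rewrite mulrC subrr.
have [k kE] := mpoly_along_polys (\sum_l invmx A i2 l *: triple_of v l)
  (fun a => (q a).[0]).
have {}kE z : k.[z] = P i2 0 z.
  rewrite kE /P mxE raddf_sum; apply: eq_bigr => l _ /=.
  by rewrite mevalZ mxE; congr (_ * _); apply: meval_eq => l'; rewrite mxE polyC0.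
exists (fun i => (q i).[0]), k; split; last first.
  move=> z; have := P0 z; rewrite -kE => /(congr1 (mulmx A)).
  by rewrite mulKVmx // -scalemxAr => <-; rewrite /w polyC0.
(* If [k = 0], every [w 0 z] is a zero of [v], hence is [0] as there is no base point; but the
   division by the power of [e] left [q j] nonzero at [e = 0]. *)
apply/eqP => k0; case/eqP: qj; apply: poly_eval_eq0 => z.
have : w 0 z = 0.
  apply: nb; rewrite -[ev v _](mulKVmx uA) P0 -kE k0 horner0 scale0r mulmx0 //.
by move=> /(congr1 (fun X : 'cV_3 => X j 0)); rewrite !mxE polyC0.
Qed.

End Sections.

(** * Binary forms and the sections they do not admit *)

Section BinaryForms.

Definition bform (R : comNzRingType) (c : nat -> R) n (a b : R) : R :=
  \sum_(i < n.+1) c i * a ^+ i * b ^+ (n - i).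

Lemma size_coef_mul_top (R : comNzRingType) (p q : {poly R}) m n :
  (size p <= m.+1)%N -> (size q <= n.+1)%N ->
  (size (p * q)%R <= (m + n).+1)%N /\ (p * q)`_(m + n) = p`_m * q`_n.
Proof.
move=> sp sq; split.
  apply: leq_trans; first exact: size_polyMleq.
  by have := leq_add sp sq; rewrite addSn addnS; case: (_ + _)%N.
rewrite coefM (bigD1 (Ordinal (leq_addr n m : (m < (m + n).+1)%N))) //= addKn.
rewrite big1 ?addr0 // => i ne; have [ltm|lei] := ltnP m i.
  by rewrite [p`_i]nth_default ?mul0r // (leq_trans sp).
have lti : (i < m)%N.
  by rewrite ltn_neqAle lei andbT; apply: contra ne => /eqP e; apply/eqP/val_inj.
rewrite [q`__]nth_default ?mulr0 //; apply: leq_trans sq _.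
by rewrite ltn_subRL ltn_add2r.
Qed.

Lemma size_coef_exp_top (R : comNzRingType) (p : {poly R}) m k :
  (size p <= m.+1)%N ->
  (size (p ^+ k)%R <= (k * m).+1)%N /\ (p ^+ k)`_(k * m) = p`_m ^+ k.
Proof.
move=> sp; elim: k => [|k [IHs IHc]].
  by rewrite mul0n !expr0 size_poly1 coef1.
rewrite exprS mulSn; have [s c] := size_coef_mul_top sp IHs.
by split => //; rewrite c IHc exprS.
Qed.

Lemma bform_coef_top (K : fieldType) (c : nat -> K) n m (g0 g1 : {poly K}) :
  (size g0 <= m.+1)%N -> (size g1 <= m.+1)%N ->
  (bform (fun i => (c i)%:P) n g0 g1)`_(n * m) = bform c n g0`_m g1`_m.
Proof.
move=> s0 s1; rewrite coef_sum; apply: eq_bigr => i _.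
rewrite -mulrA coefCM -mulrA; congr (_ * _).
have le : (i <= n)%N by rewrite -ltnS.
have [si ci] := size_coef_exp_top i s0; have [sj cj] := size_coef_exp_top (n - i) s1.
have [_] := size_coef_mul_top si sj.
by rewrite -mulnDl subnKC // => ->; rewrite ci cj.
Qed.

Lemma bform_horner (K : fieldType) (c : nat -> K) n (g0 g1 : {poly K}) z :
  (bform (fun i => (c i)%:P) n g0 g1).[z] = bform c n g0.[z] g1.[z].
Proof.
rewrite horner_sum; apply: eq_bigr => i _.
by rewrite !hornerM hornerC !horner_exp.
Qed.

Lemma bformZ (R : comNzRingType) (c : nat -> R) n (e a b : R) :
  bform c n (e * a) (e * b) = e ^+ n * bform c n a b.
Proof.
rewrite mulr_sumr; apply: eq_bigr => i _.
have le : (i <= n)%N by rewrite -ltnS.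
have -> : e ^+ n = e ^+ i * e ^+ (n - i) by rewrite -exprD subnKC.
by rewrite !exprMn; ring.
Qed.

Context {K : numClosedFieldType}.

(* A rational function of degree n has a rational right inverse only if n <= 1:
   after removing the common factor of g0 and g1, the denominator has no zero,
   so that it is constant, and the leading coefficients of g0 and g1 would be a
   common zero of the two forms. *)
Lemma bform_section n (c d : nat -> K) (g0 g1 : {poly K}) :
  (g0 != 0) || (g1 != 0) ->
  (forall a b, bform c n a b = 0 -> bform d n a b = 0 -> a = 0 /\ b = 0) ->
  (forall z, bform c n g0.[z] g1.[z] = z * bform d n g0.[z] g1.[z]) -> (n <= 1)%N.
Proof.
move=> gn0 cd sec; pose e := gcdp g0 g1.
have e0 : e != 0 by rewrite gcdp_eq0 negb_and.
pose h0 := g0 %/ e; pose h1 := g1 %/ e.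
have h0E : g0 = e * h0 by rewrite mulrC divpK ?dvdp_gcdl.
have h1E : g1 = e * h1 by rewrite mulrC divpK ?dvdp_gcdr.
have cop : coprimep h0 h1.
  by apply: coprimep_div_gcd; rewrite -negb_and -gcdp_eq0.
pose U := bform (fun i => (c i)%:P) n h0 h1; pose W := bform (fun i => (d i)%:P) n h0 h1.
have UW : U = 'X * W.
  have /eqP : e ^+ n * (U - 'X * W) = 0.
    apply: poly_eval_eq0 => z; have := sec z; rewrite h0E h1E !hornerM !bformZ.
    rewrite hornerD hornerN hornerM hornerX !bform_horner horner_exp => E.
    by rewrite mulrBr E; ring.
  by rewrite mulf_eq0 expf_eq0 (negbTE e0) andbF /= subr_eq0 => /eqP.
have W1 : size W == 1%N.
  apply: contraT => /closed_rootP[z /rootP Wz].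
  have Uz : U.[z] = 0 by rewrite UW hornerM Wz mulr0.
  rewrite !bform_horner in Wz Uz; have [z0 z1] := cd _ _ Uz Wz.
  by have := coprimep_root cop (introT rootP z0); rewrite z1 eqxx.
have {W1}[w w0 WE] := size_poly1P _ W1.
pose m := (maxn (size h0) (size h1)).-1.
have s0 : (size h0 <= m.+1)%N by rewrite /m; lia.
have s1 : (size h1 <= m.+1)%N by rewrite /m; lia.
have Um := bform_coef_top c n s0 s1; have Wm := bform_coef_top d n s0 s1.
rewrite -/U UW WE mulrC coefCM coefX in Um; rewrite -/W WE coefC in Wm.
have lead0 : ~ (h0`_m = 0 /\ h1`_m = 0).
  have lc (p : {poly K}) : p`_(size p).-1 = 0 -> p = 0 by move/eqP; rewrite -lead_coefE lead_coef_eq0 => /eqP.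
  have h0n : (h0 != 0) || (h1 != 0).
    by move: gn0; rewrite h0E h1E !mulf_eq0 (negbTE e0).
  rewrite /m => -[a b]; case: (leqP (size h0) (size h1)) => le.
    rewrite (maxn_idPr le) in a b; have h10 := lc _ b.
    move: h0n le; rewrite h10 eqxx orbF size_poly0 leqn0 size_poly_eq0 => /negbTE ->.
    by [].
  rewrite (maxn_idPl (ltnW le)) in a b; have h00 := lc _ a.
  by move: le; rewrite h00 size_poly0 ltn0.
(* For [m = 0] the polynomial [U = 'X * W] would be constant. For [m > 0] and [n > 1] the index
   [n * m] exceeds the degree [1] of [U], so both forms vanish at the coefficients of index [m]. *)
rewrite leqNgt; apply/negP => n2; have [m0|m0] := posnP m.
  have U0 : size U = 2%N by rewrite UW WE mulrC size_Cmul // size_polyX.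
  have hc (p : {poly K}) : (size p <= m.+1)%N -> exists a, p = a%:P.
    by rewrite m0 => /size1_polyC ->; exists p`_0.
  have [a aE] := hc _ s0; have [b bE] := hc _ s1.
  have : U = (bform c n a b)%:P.
    apply: poly_eval_inj => z; rewrite bform_horner aE bE !hornerC //.
  by move=> UC; move: U0; rewrite UC size_polyC; case: (_ != 0).
apply: lead0; apply: cd.
  by rewrite -Um (_ : (n * m == 1)%N = false) ?mulr0 //; apply/negbTE/eqP; nia.
by rewrite -Wm (_ : (n * m == 0)%N = false) //; apply/negbTE/eqP; nia.
Qed.

Lemma quadratic_no_section (p0 p1 p2 q0 q1 q2 : K) (g0 g1 : {poly K}) :
  (g0 != 0) || (g1 != 0) ->
  (forall a b, p0 * a ^+ 2 + p1 * (a * b) + p2 * b ^+ 2 = 0 ->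
     q0 * a ^+ 2 + q1 * (a * b) + q2 * b ^+ 2 = 0 -> a = 0 /\ b = 0) ->
  ~ forall z, let a := g0.[z] in let b := g1.[z] in
     p0 * a ^+ 2 + p1 * (a * b) + p2 * b ^+ 2 =
     z * (q0 * a ^+ 2 + q1 * (a * b) + q2 * b ^+ 2).
Proof.
move=> gn0 pq sec.
have bE (x0 x1 x2 a b : K) : bform (nth 0 [:: x2; x1; x0]) 2 a b =
    x0 * a ^+ 2 + x1 * (a * b) + x2 * b ^+ 2.
  by rewrite /bform sum3 /=; ring.
suff : (2 <= 1)%N by [].
apply: (bform_section (c := nth 0 [:: p2; p1; p0]) (d := nth 0 [:: q2; q1; q0]) gn0).
  by move=> a b; rewrite !bE; apply: pq.
by move=> z; rewrite !bE; apply: sec.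
Qed.

Lemma cubic_no_section (p0 p1 p2 p3 q0 q1 q2 q3 : K) (g0 g1 : {poly K}) :
  (g0 != 0) || (g1 != 0) ->
  (forall a b, p0 * a ^+ 3 + p1 * (a ^+ 2 * b) + p2 * (a * b ^+ 2) + p3 * b ^+ 3 = 0 ->
     q0 * a ^+ 3 + q1 * (a ^+ 2 * b) + q2 * (a * b ^+ 2) + q3 * b ^+ 3 = 0 ->
     a = 0 /\ b = 0) ->
  ~ forall z, let a := g0.[z] in let b := g1.[z] in
     p0 * a ^+ 3 + p1 * (a ^+ 2 * b) + p2 * (a * b ^+ 2) + p3 * b ^+ 3 =
     z * (q0 * a ^+ 3 + q1 * (a ^+ 2 * b) + q2 * (a * b ^+ 2) + q3 * b ^+ 3).
Proof.
move=> gn0 pq sec.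
have bE (x0 x1 x2 x3 a b : K) : bform (nth 0 [:: x3; x2; x1; x0]) 3 a b =
    x0 * a ^+ 3 + x1 * (a ^+ 2 * b) + x2 * (a * b ^+ 2) + x3 * b ^+ 3.
  by rewrite /bform !big_ord_recl big_ord0 /= /bump /=; ring.
suff : (3 <= 1)%N by [].
apply: (bform_section (c := nth 0 [:: p3; p2; p1; p0]) (d := nth 0 [:: q3; q2; q1; q0]) gn0).
  by move=> a b; rewrite !bE; apply: pq.
by move=> z; rewrite !bE; apply: sec.
Qed.

(** Over an algebraically closed field a binary quadratic form splits into linear factors, which
    become coordinates when they are independent. The zero form is included, with [k = 0]. *)
Lemma binary_quadratic_normal (r s t : K) : exists n00 n01 n10 n11 k : K,
  n00 * n11 - n01 * n10 != 0 /\
  let q a b := r * a ^+ 2 + s * (a * b) + t * b ^+ 2 in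
  ((forall a b, q (n00 * a + n01 * b) (n10 * a + n11 * b) = k * (a * b)) \/
   (forall a b, q (n00 * a + n01 * b) (n10 * a + n11 * b) = k * a ^+ 2)).
Proof.
have [->|r0] := eqVneq r 0.
  have [->|s0] := eqVneq s 0.
    exists 0, 1, 1, 0, t; split; last by right => a b; ring.
    by rewrite mul0r mul1r sub0r oppr_eq0 oner_eq0.
  exists (- t / s), s^-1, 1, 0, 1; split; last by left => a b; field.
  by rewrite mulr0 mulr1 sub0r oppr_eq0 invr_eq0.
pose D := sqrtC (s ^+ 2 - 4%:R * r * t).
have tE : t = (s ^+ 2 - D ^+ 2) / (4%:R * r).
  by rewrite sqrtCK; field; rewrite ?r0 ?pnatr_eq0.
have two : 2%:R != 0 :> K by rewrite pnatr_eq0.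
have four : 4%:R != 0 :> K by rewrite pnatr_eq0.
have [D0|D0] := eqVneq D 0.
  exists 1, (- s / (2%:R * r)), 0, 1, r; split; last first.
    by right => a b; rewrite tE D0; field; rewrite ?r0 ?pnatr_eq0.
  by rewrite mulr0 mulr1 subr0 oner_eq0.
(* This inverts [a = x + (s - D) y / (2 r)], [b = x + (s + D) y / (2 r)], the two factors of the
   form divided by [r]. *)
exists ((D + s) / (2%:R * D)), ((D - s) / (2%:R * D)), (- r / D), (r / D), r; split.
  rewrite [X in X != 0](_ : _ = r / D); last by field; rewrite ?D0 ?pnatr_eq0.
  by rewrite mulf_neq0 ?invr_eq0.
by left => a b; rewrite tE; field; rewrite ?D0 ?r0 ?pnatr_eq0.
Qed.

End BinaryForms.

(** * Classification of quadratic Cremona maps *)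

Section Classification.
Context {K : numClosedFieldType}.
Implicit Types (F : 'cV[K]_3 -> 'cV[K]_3) (A M N : 'M[K]_3) (x y : 'cV[K]_3).

Definition standard F : Prop := [\/ lr_equiv (ev tau) F, lr_equiv (ev rho) F
  | lr_equiv (ev sigma) F].

Lemma standard_lr F F' : lr_equiv F F' -> standard F' -> standard F.
Proof.
move=> /lr_equiv_sym FF' []; [constructor 1|constructor 2|constructor 3];
  exact: lr_equiv_trans FF'.
Qed.

(** What the classification uses of a birational map without common factor. Each property passes to
    equivalent maps, so coordinates can be changed without carrying the inverse along. *)
Definition cremona_like F : Prop :=
  [/\ exists v, F =1 ev v, forall (a : 'rV_3) N, ~ (forall x, F x = (a *m x) 0 0 *: (N *m x)),
      generic_sections F & limit_sections F].

Lemma cremona_like_lr F F' : lr_equiv F F' -> cremona_like F -> cremona_like F'.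
Proof.
move=> FF' [[v vE] nf gF lF]; have [A [M [uA uM F'E]]] := FF'.
split; last 2 first.
- exact: generic_sections_lr gF.
- apply: limit_sections_lr lF => //; rewrite vE.
  by have := evXZ v 0 0; rewrite scale0r expr0n scale0r.
- by exists (lract A (invmx M) v) => x; rewrite ev_lract invmxK F'E vE.
move=> a N F'l; apply: (nf (a *m invmx M) (invmx A *m N *m invmx M)) => x.
have := F'E (invmx M *m x); rewrite mulKVmx // F'l => /(congr1 (mulmx (invmx A))).
by rewrite mulKmx // => <-; rewrite -scalemxAr !mulmxA.
Qed.

Lemma quadratic_coefs F : (exists v, F =1 ev v) ->
  exists p0 p1 p2 p3 p4 p5 : 'I_3 -> K, forall a b c i,
    F (v3 a b c) i 0 = p0 i * a ^+ 2 + p1 i * (a * b) + p2 i * b ^+ 2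
      + p3 i * (a * c) + p4 i * (b * c) + p5 i * c ^+ 2.
Proof.
move=> [v vE]; have [q qE] := quad_surj v.
exists (fun i => q i i0 i0), (fun i => q i i0 i1 + q i i1 i0), (fun i => q i i1 i1),
  (fun i => q i i0 i2 + q i i2 i0), (fun i => q i i1 i2 + q i i2 i1), (fun i => q i i2 i2).
move=> a b c i; rewrite vE qE ev_quad sum3 !sum3 !v3E; ring.
Qed.

Lemma col_complete (x : 'cV[K]_3) : x != 0 ->
  exists2 M : 'M[K]_3, M \in unitmx & M *m v3 0 0 1 = x.
Proof.
move=> x0; have [|M uM Mx] := @row_complete _ x^T.
  by apply: contra x0 => /eqP e; rewrite -[x]trmxK e trmx0.
pose P : 'M[K]_3 := m3 0 0 1 0 1 0 1 0 0.
have uP : P \in unitmx.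
  by apply: m3_unit; rewrite [X in X != 0](_ : _ = - 1) ?oppr_eq0 ?oner_eq0 //; ring.
exists (M^T *m P); first by rewrite unitmx_mul unitmx_tr uM.
rewrite -mulmxA m3_v3 mulmx_v3.
have E i : M i0 i = x i 0 by move/rowP/(_ i): Mx; rewrite !mxE.
by apply: cv3P; rewrite v3E !mxE E; ring.
Qed.

Lemma row_complete_col (u : 'rV[K]_3) : u != 0 ->
  exists2 A : 'M[K]_3, A \in unitmx & forall x, (A *m x) i0 0 = (u *m x) 0 0.
Proof.
move=> /row_complete[A uA Au]; exists A => // x.
by rewrite (row0_mulmx _ Au).
Qed.

(** On the points [(s : 1 : 0)] the cubic is a polynomial in [s]. If it has no root it is a constant
    [c]; then the cubic is [c t^3] at [(1 : t : 0)], and vanishes at [(1 : 0 : 0)]. *)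
Lemma jac_ev_zero v : exists2 x : 'cV[K]_3, x != 0 & jac (ev v) x = 0.
Proof.
have [p0 [p1 [p2 [p3 [p4 [p5 vE]]]]]] := quadratic_coefs (ex_intro (fun w => ev v =1 ev w) v (fun=> erefl)).
have mE (X Y Z : 'cV[K]_3) i : (X - Y - Z) i 0 = X i 0 - Y i 0 - Z i 0.
  by rewrite !mxE.
have jacZ s x : jac (ev v) (s *: x) = jac (ev v) x * s ^+ 3.
  have polarZ y : polar (ev v) (s *: x) y = s *: polar (ev v) x y.
    apply/colP => i; rewrite [RHS]mxE /polar !mE [x]v3_eta [y]v3_eta scale_v3.
    by rewrite !add_v3 !vE; ring.
  rewrite /jac !polarZ -!mul_scalar_mx det3_mul det_scalar; ring.
pose L0 (a b : {poly K}) i := (2%:R * p0 i) *: a + p1 i *: b.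
pose L1 (a b : {poly K}) i := p1 i *: a + (2%:R * p2 i) *: b.
pose L2 (a b : {poly K}) i := p3 i *: a + p4 i *: b.
pose q a b := L0 a b i0 * (L1 a b i1 * L2 a b i2 - L2 a b i1 * L1 a b i2)
  - L1 a b i0 * (L0 a b i1 * L2 a b i2 - L2 a b i1 * L0 a b i2)
  + L2 a b i0 * (L0 a b i1 * L1 a b i2 - L1 a b i1 * L0 a b i2).
have qE a b s : (q a b).[s] = jac (ev v) (v3 a.[s] b.[s] 0).
  rewrite /jac /polar !add_v3 det3E /q /L0 /L1 /L2 !hornerE.
  by rewrite !mE !vE; ring.
have [q1|q1] := boolP (size (q 'X 1) == 1%N); last first.
  have [s /rootP] := closed_rootP _ q1; rewrite qE hornerX hornerC => e.
  by exists (v3 s 1 0) => //; apply/eqP => /v3_eq0[_ /eqP]; rewrite oner_eq0.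
have [c _ qc] := size_poly1P _ q1.
exists (v3 1 0 0); first by apply/eqP => /v3_eq0[/eqP]; rewrite oner_eq0.
have rE : q 1 'X = c *: 'X^3.
  have X0 : 'X != 0 :> {poly K} by rewrite polyX_eq0.
  apply/subr0_eq/(mulIf X0); rewrite mul0r.
  apply: poly_eval_eq0 => t.
  rewrite hornerM hornerX hornerD hornerN hornerZ hornerXn qE hornerX hornerC.
  have [->|t0] := eqVneq t 0; first by rewrite mulr0.
  have : (q 'X 1).[t^-1] = c by rewrite qc hornerC.
  rewrite qE hornerX hornerC => <-.
  have <- := jacZ t (v3 t^-1 1 0).
  by rewrite scale_v3 mulfV // mulr1 mulr0 subrr mul0r.
have := qE 1 'X 0; rewrite rE hornerX hornerC => <-.
by rewrite hornerZ hornerXn expr0n mulr0.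
Qed.

(* The member u of the net of conics is singular at x. *)
Lemma singular_member F : (exists v, F =1 ev v) ->
  exists (u : 'rV[K]_3) x, [/\ u != 0, x != 0 &
    forall c y, (u *m F (y + c *: x)) 0 0 = (u *m F y) 0 0].
Proof.
move=> Fv; have [v vE] := Fv; have [x x0 jx] := jac_ev_zero v.
(* A vector [u] in the left kernel of the Jacobian matrix kills all partial derivatives at [x]. *)
have := jx; rewrite /jac /det3 => /eqP/det0P[u u0 uM].
exists u, x; split => // c y.
have [p0 [p1 [p2 [p3 [p4 [p5 FE]]]]]] := quadratic_coefs Fv.
pose s (p : 'I_3 -> K) := \sum_i u 0 i * p i.
have uE a b d : (u *m F (v3 a b d)) 0 0 = s p0 * a ^+ 2 + s p1 * (a * b) + s p2 * b ^+ 2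
    + s p3 * (a * d) + s p4 * (b * d) + s p5 * d ^+ 2.
  by rewrite mxE /s !sum3 !FE; ring.
have pol z : (u *m polar (ev v) x z) 0 0 = (u *m F (x + z)) 0 0 - (u *m F x) 0 0 - (u *m F z) 0 0.
  by rewrite /polar -!vE !mulmxBr !mxE.
have uj j : (u *m polar (ev v) x (tnth [tuple v3 1 0 0; v3 0 1 0; v3 0 0 1] j)) 0 0 = 0.
  have /rowP/(_ j) := uM; rewrite [LHS]mxE [RHS]mxE => E.
  rewrite [LHS]mxE -[RHS]E; apply: eq_bigr => i _; congr (_ * _).
  by rewrite [RHS]mxE; move: j {E}; apply: ord3_ind.
have := (uj i0, uj i1, uj i2); rewrite !pol !(tnth_nth 0) /= [x]v3_eta [y]v3_eta.
move: (x i0 0) (x i1 0) (x i2 0) (y i0 0) (y i1 0) (y i2 0) => x0' x1' x2' y0 y1 y2.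
rewrite scale_v3 !add_v3 !uE => -[[E0 E1] E2].
have two : 2%:R != 0 :> K by rewrite pnatr_eq0.
apply/eqP; rewrite -subr_eq0; apply/eqP.
move: (s p0) (s p1) (s p2) (s p3) (s p4) (s p5) E0 E1 E2 => q0 q1 q2 q3 q4 q5 E0 E1 E2.
have {}E0 : 2%:R * q0 * x0' + q1 * x1' + q3 * x2' = 0 by rewrite -[RHS]E0; ring.
have {}E1 : q1 * x0' + 2%:R * q2 * x1' + q4 * x2' = 0 by rewrite -[RHS]E1; ring.
have {}E2 : q3 * x0' + q4 * x1' + 2%:R * q5 * x2' = 0 by rewrite -[RHS]E2; ring.
apply: (mulfI two); rewrite mulr0.
(* Twice the difference is a combination of the three partial derivatives at [x]; the part in
   [c ^+ 2] is Euler's relation. *)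
transitivity (2%:R * c * (y0 * (2%:R * q0 * x0' + q1 * x1' + q3 * x2')
  + y1 * (q1 * x0' + 2%:R * q2 * x1' + q4 * x2') + y2 * (q3 * x0' + q4 * x1' + 2%:R * q5 * x2'))
  + c ^+ 2 * (x0' * (2%:R * q0 * x0' + q1 * x1' + q3 * x2')
  + x1' * (q1 * x0' + 2%:R * q2 * x1' + q4 * x2') + x2' * (q3 * x0' + q4 * x1' + 2%:R * q5 * x2'))).
  by ring.
by rewrite E0 E1 E2; ring.
Qed.

End Classification.

(** * Base points and normal forms *)

Section ClassificationCases.
Context {K : numClosedFieldType}.
Implicit Types (F : 'cV[K]_3 -> 'cV[K]_3) (A M N : 'M[K]_3) (x y : 'cV[K]_3).

Lemma poly_nonroot (p : {poly K}) : p != 0 -> exists z, p.[z] != 0.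
Proof.
move=> p0; apply: contrapT => n0; case/eqP: p0; apply: poly_eval_eq0 => z.
by apply/eqP; apply: contrapT => /negP pz; apply: n0; exists z.
Qed.

Lemma poly_mul_eval_eq0 (g p : {poly K}) : g != 0 ->
  (forall z, g.[z] * p.[z] = 0) -> p = 0.
Proof.
move=> g0 gp; have /eqP : g * p = 0 by apply: poly_eval_eq0 => z; rewrite hornerM.
by rewrite mulf_eq0 (negbTE g0) => /eqP.
Qed.

Lemma col_v3 (g : 'I_3 -> K) : \col_i g i = v3 (g i0) (g i1) (g i2).
Proof. by rewrite [LHS]v3_eta !mxE. Qed.

Lemma generic_sections_coords F : generic_sections F -> exists2 d : {poly K}, d != 0 &
  forall c, d.[c] != 0 -> exists g0 g1 g2 k : {poly K}, k != 0 /\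
    forall z, F (v3 g0.[z] g1.[z] g2.[z]) = v3 (k.[z] * z) (k.[z] * c) k.[z].
Proof.
move=> /(_ 1%:M (unitmx1 _ _))[d d0 dP]; exists d => // c /dP[g [k [k0 gE]]].
exists (g i0), (g i1), (g i2), k; split => // z.
by have := gE z; rewrite mul1mx scale_v3 mulr1 col_v3.
Qed.

(** A map into a line has no section over a general line: after moving that line to [x0 = 0], the
    first coordinates [0] and [k z] would agree. *)
Lemma cremona_like_nondegenerate F (u : 'rV[K]_3) : cremona_like F ->
  (forall x, (u *m F x) 0 0 = 0) -> u = 0.
Proof.
move=> cF uF; apply/eqP; apply: contraT => /row_complete_col[A uA Au].
have [_ _ sF _] : cremona_like (fun x => A *m F x).
  apply: cremona_like_lr cF; exists A, 1%:M; rewrite unitmx1; split => // x.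
  by rewrite mul1mx.
have [d d0 dP] := generic_sections_coords sF.
have [c /dP[g0 [g1 [g2 [k [k0 gE]]]]]] := poly_nonroot d0.
case/eqP: k0; apply: (@poly_mul_eval_eq0 'X); first by rewrite polyX_eq0.
move=> z; have := congr1 (fun x : 'cV_3 => x i0 0) (gE z).
by rewrite /= Au uF v3E hornerX mulrC.
Qed.

(** This spares the computation of a determinant for the left factor in each normal form below. *)
Lemma cremona_like_unit F (G : 'cV[K]_3 -> 'cV[K]_3) A : cremona_like F ->
  (forall x, F x = A *m G x) -> A \in unitmx.
Proof.
move=> cF FE; rewrite unitmxE unitfE; apply/negP => /det0P[u u0 uA].
case/eqP: u0; apply: (cremona_like_nondegenerate cF) => x.
by rewrite FE mulmxA uA mul0mx mxE.
Qed.

Lemma no_base_point_lr F F' : lr_equiv F F' -> (forall x, F x = 0 -> x = 0) ->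
  forall x, F' x = 0 -> x = 0.
Proof.
move=> [A [M [uA uM FE]]] nb x; rewrite FE => /(congr1 (mulmx (invmx A))).
by rewrite mulKmx // mulmx0 => /nb Mx; rewrite -[x](mulKmx uM) Mx mulmx0.
Qed.

Definition block2 (n00 n01 n10 n11 : K) : 'M[K]_3 := m3 n00 n01 0 n10 n11 0 0 0 1.

Lemma block2_unit n00 n01 n10 n11 : n00 * n11 - n01 * n10 != 0 ->
  block2 n00 n01 n10 n11 \in unitmx.
Proof.
by move=> d0; apply: m3_unit; rewrite [X in X != 0](_ : _ = n00 * n11 - n01 * n10) //; ring.
Qed.

Lemma block2_v3 n00 n01 n10 n11 a b c : block2 n00 n01 n10 n11 *m v3 a b c =
  v3 (n00 * a + n01 * b) (n10 * a + n11 * b) c.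
Proof. by rewrite m3_v3; congr v3; ring. Qed.

(* A reducible member of the net always has a base point on each of its lines:
   otherwise the net would restrict there to a map of degree 2 onto a line, which
   has no rational section. *)
Lemma base_point_exists F : cremona_like F -> exists2 x, x != 0 & F x = 0.
Proof.
move=> cF; apply: contrapT => nx.
have nb x : F x = 0 -> x = 0.
  by move=> Fx; apply/eqP; apply: contrapT => /negP x0; apply: nx; exists x.
have [Fv _ _ _] := cF; have [u [x [u0 x0 ux]]] := singular_member Fv.
have [M uM Mx] := col_complete x0; have [A uA Au] := row_complete_col u0.
pose F1 y := A *m F (M *m y).
have eF1 : lr_equiv F F1 by exists A, M.
have [F1v _ _ _] := cremona_like_lr eF1 cF.
have [p0 [p1 [p2 [p3 [p4 [p5 F1E]]]]]] := quadratic_coefs F1v.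
have F1c a b c : F1 (v3 a b c) i0 0 = F1 (v3 a b 0) i0 0.
  rewrite /F1 !Au -(ux c (M *m v3 a b 0)); congr ((u *m F _) 0 0).
  by rewrite -Mx scalemxAr -mulmxDr scale_v3 add_v3 !mulr0 !addr0 add0r mulr1.
have [n00 [n01 [n10 [n11 [k [n0 Nq]]]]]] := binary_quadratic_normal (p0 i0) (p1 i0) (p2 i0).
pose D := block2 n00 n01 n10 n11; pose F2 y := F1 (D *m y).
have eF2 : lr_equiv F F2.
  apply: lr_equiv_trans eF1 _; exists 1%:M, D; rewrite unitmx1 block2_unit //.
  by split => // y; rewrite mul1mx.
have cF2 := cremona_like_lr eF2 cF; have nb2 := no_base_point_lr eF2 nb.
have F2q : (forall a b c, F2 (v3 a b c) i0 0 = k * (a * b)) \/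
    (forall a b c, F2 (v3 a b c) i0 0 = k * a ^+ 2).
  have E a b c : F2 (v3 a b c) i0 0 = p0 i0 * (n00 * a + n01 * b) ^+ 2 +
      p1 i0 * ((n00 * a + n01 * b) * (n10 * a + n11 * b)) + p2 i0 * (n10 * a + n11 * b) ^+ 2.
    by rewrite /F2 block2_v3 F1c F1E; ring.
  by case: Nq => Nq; [left|right] => a b c; rewrite E Nq.
have k0 : k != 0.
  apply/eqP => k0; have H y : ((row i0 1%:M : 'rV[K]_3) *m F2 y) 0 0 = 0.
    rewrite -row_mul mul1mx mxE [y]v3_eta.
    by case: F2q => ->; rewrite k0 mul0r.
  have /rowP/(_ i0) := cremona_like_nondegenerate cF2 H.
  by rewrite !mxE eqxx => /eqP; rewrite oner_eq0.
have [[F2v _ _ lF2]] := (cF2, tt); move=> _.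
(* The section over the line [x0 = 0] of the target runs inside the singular conic given by the
   first component of [F2], hence in one of its lines. *)
have [g [l [l0 gE]]] := lF2 nb2 1%:M (unitmx1 _ _).
have {}gE z : F2 (v3 (g i0).[z] (g i1).[z] (g i2).[z]) = v3 0 (l.[z] * z) l.[z].
  by have := gE z; rewrite col_v3 mul1mx scale_v3 mulr0 mulr1.
have [q0 [q1 [q2 [q3 [q4 [q5 F2E]]]]]] := quadratic_coefs F2v.
have gE0 z : F2 (v3 (g i0).[z] (g i1).[z] (g i2).[z]) i0 0 = 0 by rewrite gE v3E.
have gE1 z : F2 (v3 (g i0).[z] (g i1).[z] (g i2).[z]) i1 0 = z * l.[z].
  by rewrite gE v3E mulrC.
have gE2 z : F2 (v3 (g i0).[z] (g i1).[z] (g i2).[z]) i2 0 = l.[z] by rewrite gE v3E.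
have l00 (h : 'I_3 -> {poly K}) : (forall i, h i = 0) ->
    ~ (forall z, F2 (v3 (h i0).[z] (h i1).[z] (h i2).[z]) i2 0 = l.[z]).
  move=> h0 hE; case/eqP: l0; apply: poly_eval_eq0 => z; rewrite -hE !h0 !horner0 F2E.
  by rewrite !(mul0r, mulr0, expr0n) /= !(mulr0, addr0).
(* On the line [a = 0] the other two components of [F2] are binary quadratic forms, without common
   zero since there is no base point. *)
have line0 : g i0 <> 0.
  move=> g00; have gn : (g i1 != 0) || (g i2 != 0).
    rewrite -negb_and; apply/negP => /andP[/eqP g10 /eqP g20].
    by apply: (l00 g) => //; apply: ord3_ind.
  apply: (@quadratic_no_section _ (q2 i1) (q4 i1) (q5 i1) (q2 i2) (q4 i2) (q5 i2) _ _ gn).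
    move=> a b e1 e2; have : F2 (v3 0 a b) = 0.
      apply: cv3P; rewrite [RHS]mxE; first by case: F2q => ->; rewrite ?mul0r ?expr0n ?mulr0.
        by rewrite F2E -[RHS]e1; ring.
      by rewrite F2E -[RHS]e2; ring.
    by move=> /nb2/v3_eq0[].
  move=> z a b; have e2 := gE2 z; have := gE1 z; rewrite -e2 !F2E g00 horner0 -/a -/b => e1.
  transitivity (z * (q0 i2 * 0 ^+ 2 + q1 i2 * (0 * a) + q2 i2 * a ^+ 2 +
    q3 i2 * (0 * b) + q4 i2 * (a * b) + q5 i2 * b ^+ 2)); last by ring.
  by rewrite -e1; ring.
case: F2q => F2q.
  have [g00|g10] : g i0 = 0 \/ g i1 = 0; [|exact: line0|].
    have /eqP : g i0 * g i1 = 0.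
      apply: poly_eval_eq0 => z; have /eqP := gE0 z.
      by rewrite F2q mulf_eq0 (negbTE k0) /= hornerM => /eqP.
    by rewrite mulf_eq0 => /orP[] /eqP; [left|right].
  have gn : (g i0 != 0) || (g i2 != 0).
    rewrite -negb_and; apply/negP => /andP[/eqP g00 /eqP g20].
    by apply: (l00 g) => //; apply: ord3_ind.
  apply: (@quadratic_no_section _ (q0 i1) (q3 i1) (q5 i1) (q0 i2) (q3 i2) (q5 i2) _ _ gn).
    move=> a b e1 e2; have : F2 (v3 a 0 b) = 0.
      apply: cv3P; rewrite [RHS]mxE; first by rewrite F2q !mulr0.
        by rewrite F2E -[RHS]e1; ring.
      by rewrite F2E -[RHS]e2; ring.
    by move=> /nb2/v3_eq0[].
  move=> z a b; have e2 := gE2 z; have := gE1 z; rewrite -e2 !F2E g10 horner0 -/a -/b => e1.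
  transitivity (z * (q0 i2 * a ^+ 2 + q1 i2 * (a * 0) + q2 i2 * 0 ^+ 2 +
    q3 i2 * (a * b) + q4 i2 * (0 * b) + q5 i2 * b ^+ 2)); last by ring.
  by rewrite -e1; ring.
apply: line0; apply: poly_eval_eq0 => z; have /eqP := gE0 z.
by rewrite F2q mulf_eq0 (negbTE k0) expf_eq0 /= => /eqP.
Qed.

(** Such an [F] factors through [(a^2 : a b : b^2)]; a section of the latter over a general line
    would give one of [(a : b) |-> (a^2 : b^2)]. *)
Lemma cremona_like_not_cone F : cremona_like F ->
  ~ (forall a b c, F (v3 a b c) = F (v3 a b 0)).
Proof.
move=> cF Fc; have [Fv _ _ _] := cF.
have [p0 [p1 [p2 [p3 [p4 [p5 FE]]]]]] := quadratic_coefs Fv.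
pose B : 'M[K]_3 := \matrix_(i, j) tnth [tuple p0 i; p1 i; p2 i] j.
pose G (x : 'cV[K]_3) := v3 (x i0 0 ^+ 2) (x i0 0 * x i1 0) (x i1 0 ^+ 2).
have FB x : F x = B *m G x.
  apply/colP => i; rewrite [x]v3_eta Fc FE mulmx_v3 !v3E.
  by move: i; apply: ord3_ind; rewrite v3E !mxE !(tnth_nth 0) /=; ring.
have uB := cremona_like_unit cF FB.
have cG : cremona_like G.
  apply: cremona_like_lr cF; exists (invmx B), 1%:M; rewrite unitmx_inv uB unitmx1.
  by split => // x; rewrite mul1mx FB mulKmx.
have [_ _ sG _] := cG; have [d d0 dP] := generic_sections_coords sG.
have [c /dP[g0 [g1 [g2 [k [k0 gE]]]]]] := poly_nonroot d0.
have {}gE z : [/\ g0.[z] ^+ 2 = k.[z] * z, g0.[z] * g1.[z] = k.[z] * c & g1.[z] ^+ 2 = k.[z]].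
  by have := gE z; rewrite /G !v3E => /v3_inj.
have gn : (g0 != 0) || (g1 != 0).
  rewrite orbC; apply/orP; left; apply: contra k0 => /eqP g10.
  apply/eqP/poly_eval_eq0 => z; have [_ _ <-] := gE z.
  by rewrite g10 horner0 expr0n.
apply: (@quadratic_no_section _ 1 0 0 0 0 1 _ _ gn).
  move=> a b; rewrite !(mul0r, mul1r, addr0, add0r) => /eqP + /eqP.
  by rewrite !expf_eq0 => /eqP -> /eqP ->.
move=> z a b; have [e1 _ e2] := gE z.
by rewrite !(mul0r, mul1r, addr0, add0r) /a /b e1 e2 mulrC.
Qed.

Lemma binary_coefs F : (exists v, F =1 ev v) ->
  exists r0 r1 r2 s0 s1 s2 t0 t1 t2, forall a b, F (v3 a b 0) =
    v3 (r0 * a ^+ 2 + r1 * (a * b) + r2 * b ^+ 2)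
       (s0 * a ^+ 2 + s1 * (a * b) + s2 * b ^+ 2)
       (t0 * a ^+ 2 + t1 * (a * b) + t2 * b ^+ 2).
Proof.
move=> /quadratic_coefs[p0 [p1 [p2 [p3 [p4 [p5 FE]]]]]].
exists (p0 i0), (p1 i0), (p2 i0), (p0 i1), (p1 i1), (p2 i1), (p0 i2), (p1 i2), (p2 i2).
by move=> a b; apply: cv3P; rewrite v3E FE; ring.
Qed.

(** The first two components are binary forms in [a, b]; without a common zero they would define a
    map of degree 2 between lines with a section. If the zero found is [(0 : 1)], the type is [tau],
    as otherwise [a] would be a common factor; any other zero leads to [rho]. *)
Lemma standard_rank1 F : cremona_like F ->
  (forall a b c, F (v3 a b c) = F (v3 a b 0) + v3 0 0 (c * a)) -> standard F.
Proof.
move=> cF Fc; have [Fv nf sF _] := cF.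
have [r0 [r1 [r2 [s0 [s1 [s2 [t0 [t1 [t2 Fb]]]]]]]]] := binary_coefs Fv.
have FE a b c : F (v3 a b c) =
    v3 (r0 * a ^+ 2 + r1 * (a * b) + r2 * b ^+ 2)
       (s0 * a ^+ 2 + s1 * (a * b) + s2 * b ^+ 2)
       (t0 * a ^+ 2 + t1 * (a * b) + t2 * b ^+ 2 + c * a).
  by rewrite Fc Fb add_v3 !addr0.
have [a1 [b1 [n0 er es]]] : exists a b, [/\ (a != 0) || (b != 0),
    r0 * a ^+ 2 + r1 * (a * b) + r2 * b ^+ 2 = 0 &
    s0 * a ^+ 2 + s1 * (a * b) + s2 * b ^+ 2 = 0].
  (* Exchanging the last two coordinates gives the line [(z : 1 : c)], so that the first two
     components of [F] have ratio [z]. *)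
  apply: contrapT => nz; pose P : 'M[K]_3 := m3 1 0 0 0 0 1 0 1 0.
  have uP : P \in unitmx.
    by apply: m3_unit; rewrite [X in X != 0](_ : _ = - 1) ?oppr_eq0 ?oner_eq0 //; ring.
  have [d d0 dP] := sF P uP; have [c /dP[g [k [k0 gE]]]] := poly_nonroot d0.
  have {}gE z : r0 * (g i0).[z] ^+ 2 + r1 * ((g i0).[z] * (g i1).[z]) + r2 * (g i1).[z] ^+ 2
      = k.[z] * z /\
    s0 * (g i0).[z] ^+ 2 + s1 * ((g i0).[z] * (g i1).[z]) + s2 * (g i1).[z] ^+ 2 = k.[z].
    have := gE z; rewrite col_v3 FE m3_v3 scale_v3 => /v3_inj[-> -> _].
    by split; ring.
  have gn : (g i0 != 0) || (g i1 != 0).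
    apply/negP => /negP; rewrite negb_or !negbK => /andP[/eqP g00 /eqP g10].
    case/eqP: k0; apply: poly_eval_eq0 => z; have [_ <-] := gE z.
    by rewrite g00 g10 horner0; ring.
  apply: (@quadratic_no_section _ r0 r1 r2 s0 s1 s2 _ _ gn) => [a b e1 e2|z a b].
    have [a0|a0] := eqVneq a 0; last by case: nz; exists a, b; rewrite a0.
    have [b0|b0] := eqVneq b 0; last by case: nz; exists a, b; rewrite b0 orbT.
    by [].
  by have [-> ->] := gE z; rewrite mulrC.
have [a10|a10] := eqVneq a1 0.
  move: n0 er es; rewrite a10 eqxx /= => b10.
  rewrite expr0n /= !mul0r !mulr0 !add0r => /eqP er /eqP es.
  have r20 : r2 = 0 by move: er; rewrite mulf_eq0 expf_eq0 (negbTE b10) andbF orbF => /eqP.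
  have s20 : s2 = 0 by move: es; rewrite mulf_eq0 expf_eq0 (negbTE b10) andbF orbF => /eqP.
  have [t20|t20] := eqVneq t2 0.
    case: (nf (delta_mx 0 i0) (m3 r0 r1 0 s0 s1 0 t0 t1 1)) => x.
    have dE j : (delta_mx 0 i0 : 'rV[K]_3) 0 j = (j == i0)%:R by rewrite mxE.
    rewrite [x]v3_eta FE m3_v3 row_v3 scale_v3 !dE r20 s20 t20 /=.
    by congr v3; ring.
  pose A : 'M[K]_3 := m3 r0 r1 0 s0 s1 0 t0 t1 t2.
  pose M : 'M[K]_3 := m3 1 0 0 0 1 0 0 0 (- t2^-1).
  have FA x : F x = A *m ev tau (M *m x).
    rewrite [x]v3_eta FE !m3_v3 ev_tau m3_v3 r20 s20.
    by congr v3; [ring|ring|field].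
  constructor 1; exists A, M; split => //.
    exact: (cremona_like_unit (G := fun x => ev tau (M *m x)) cF FA).
  apply: m3_unit; rewrite [X in X != 0](_ : _ = - t2^-1); last by ring.
  by rewrite oppr_eq0 invr_eq0.
(* The first two components share the factor [b - l a]; the equations for [r0] and [s0] express
   this. *)
pose l := b1 / a1; have b1E : b1 = l * a1 by rewrite divfK.
have a20 : a1 ^+ 2 != 0 by rewrite expf_neq0.
have {}er : r0 = - (r1 * l + r2 * l ^+ 2).
  apply: (mulIf a20); apply/subr0_eq; rewrite -[RHS]er b1E; ring.
have {}es : s0 = - (s1 * l + s2 * l ^+ 2).
  apply: (mulIf a20); apply/subr0_eq; rewrite -[RHS]es b1E; ring.
(* With [y = b - l a], the first two components are combinations of [a y] and [y^2]; so is the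
   third, up to the product of [a] with the first coordinate given by [M]. *)
pose A : 'M[K]_3 := m3 0 r2 (r1 + 2%:R * r2 * l) 0 s2 (s1 + 2%:R * s2 * l) 1 t2 (t1 + 2%:R * t2 * l).
pose M : 'M[K]_3 := m3 (t0 + t1 * l + t2 * l ^+ 2) 0 1 1 0 0 (- l) 1 0.
have FA x : F x = A *m ev rho (M *m x).
  rewrite [x]v3_eta FE !m3_v3 ev_rho m3_v3 er es.
  by congr v3; ring.
constructor 2; exists A, M; split => //.
  exact: (cremona_like_unit (G := fun x => ev rho (M *m x)) cF FA).
by apply: m3_unit; rewrite [X in X != 0](_ : _ = 1) ?oner_eq0 //; ring.
Qed.

Section Rank2.
Variables (F : 'cV[K]_3 -> 'cV[K]_3) (r0 r1 r2 s0 s1 s2 k : K).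
Hypothesis cF : cremona_like F.

(** The section gives an identity of binary cubics with right-hand side [z k a b^2]. The left-hand
    form is [r2 b^3] at [a = 0] and [- s0 a^3] at [b = 0]. If both are nonzero there is no common
    zero; if just one is, a factor cancels and an impossible quadratic identity is left. So
    [r2 = s0 = 0], and [sigma] appears. *)
Lemma standard_rank2_distinct :
  (forall a b c, F (v3 a b c) = v3 (r0 * a ^+ 2 + r1 * (a * b) + r2 * b ^+ 2 + c * a)
     (s0 * a ^+ 2 + s1 * (a * b) + s2 * b ^+ 2 + c * b) (k * (a * b))) -> standard F.
Proof.
move=> FE; have [_ _ sF _] := cF.
have [d d0 dP] := generic_sections_coords sF.
(* The combination [b F_0 - a F_1] is free of the third coordinate of the section; the third
   component of [F] gives the factor [k a b]. *)
have sec c : d.[c] != 0 -> exists g0 g1 : {poly K}, [/\ g0 != 0, g1 != 0, k != 0 & forall z,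
    let a := g0.[z] in let b := g1.[z] in
    - s0 * a ^+ 3 + (r0 - s1 + c * k) * (a ^+ 2 * b) + (r1 - s2) * (a * b ^+ 2) + r2 * b ^+ 3 =
    z * (k * (a * b ^+ 2))].
  move=> /dP[g0 [g1 [g2 [h [h0 gE]]]]]; exists g0, g1.
  have {}gE z := gE z; have E z : k * (g0.[z] * g1.[z]) = h.[z].
    by have := gE z; rewrite FE => /v3_inj[].
  split.
  - by apply: contra h0 => /eqP g00; apply/eqP/poly_eval_eq0 => z; rewrite -E g00 horner0 mul0r mulr0.
  - by apply: contra h0 => /eqP g10; apply/eqP/poly_eval_eq0 => z; rewrite -E g10 horner0 !mulr0.
  - by apply: contra h0 => /eqP k0; apply/eqP/poly_eval_eq0 => z; rewrite -E k0 mul0r.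
  move=> z a b; have := gE z; rewrite FE -E -/a -/b => /v3_inj[e0 e1 _].
  apply/subr0_eq.
  transitivity (b * (r0 * a ^+ 2 + r1 * (a * b) + r2 * b ^+ 2 + g2.[z] * a - k * (a * b) * z)
     - a * (s0 * a ^+ 2 + s1 * (a * b) + s2 * b ^+ 2 + g2.[z] * b - k * (a * b) * c)); first by ring.
  by rewrite e0 e1 !subrr !mulr0 subrr.
have [c0 dc0] := poly_nonroot d0; have [_ [_ [_ _ k0 _]]] := sec c0 dc0.
(* This choice of [c] keeps the coefficient of [a^2 b] nonzero, which is needed after a factor [b]
   is cancelled. *)
have [c] : exists c, (d * ((r0 - s1)%:P + k *: 'X)).[c] != 0.
  apply/poly_nonroot/mulf_neq0 => //; apply/eqP => /polyP/(_ 1%N).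
  by rewrite coefD coefC coefZ coefX !coef0 add0r mulr1 => /eqP; rewrite (negbTE k0).
rewrite !hornerE mulf_eq0 negb_or mulrC => /andP[/sec[g0 [g1 [g00 g10 _ gE]]] rsc].
have gn : (g0 != 0) || (g1 != 0) by rewrite g00.
have [r20|r20] := eqVneq r2 0; last first.
  exfalso; have [s00|s00] := eqVneq s0 0; last first.
    apply: (@cubic_no_section _ (- s0) (r0 - s1 + c * k) (r1 - s2) r2 0 0 k 0 _ _ gn).
      move=> a b e1; rewrite !mul0r !add0r addr0 => /eqP.
      rewrite mulf_eq0 (negbTE k0) mulf_eq0 expf_eq0 /= => /orP[] /eqP z0; move: e1; rewrite z0.
        rewrite !expr0n /= !mul0r !mulr0 !add0r => /eqP.
        by rewrite mulf_eq0 (negbTE r20) expf_eq0 /= => /eqP.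
      rewrite !expr0n /= !mulr0 !addr0 => /eqP.
      by rewrite mulf_eq0 oppr_eq0 (negbTE s00) expf_eq0 /= => /eqP.
    by move=> z /=; rewrite gE; ring.
  apply: (@quadratic_no_section _ (r0 - s1 + c * k) (r1 - s2) r2 0 k 0 _ _ gn).
    move=> a b e1; rewrite !mul0r !add0r addr0 => /eqP.
    rewrite !mulf_eq0 (negbTE k0) /= => /orP[] /eqP z0; move: e1; rewrite z0.
      rewrite !expr0n /= !mul0r !mulr0 !add0r => /eqP.
      by rewrite mulf_eq0 (negbTE r20) expf_eq0 /= => /eqP.
    rewrite !expr0n /= !mulr0 !addr0 => /eqP.
    by rewrite mulf_eq0 (negbTE rsc) expf_eq0 /= => /eqP.
  move=> z /=; have [p pE] : exists p : {poly K}, forall y : K, p.[y] =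
      (r0 - s1 + c * k) * g0.[y] ^+ 2 + (r1 - s2) * (g0.[y] * g1.[y]) + r2 * g1.[y] ^+ 2
      - y * (k * (g0.[y] * g1.[y])).
    exists ((r0 - s1 + c * k)%:P * g0 ^+ 2 + (r1 - s2)%:P * (g0 * g1) + r2%:P * g1 ^+ 2
      - 'X * (k%:P * (g0 * g1))) => y.
    by rewrite !(hornerD, hornerN, hornerM, hornerC, hornerX, horner_exp).
  have p0 : p = 0.
    apply: (poly_mul_eval_eq0 g10) => y; have := gE y; rewrite pE s00 => e.
    rewrite mulrBr; apply/eqP; rewrite subr_eq0; apply/eqP.
    transitivity (y * (k * (g0.[y] * g1.[y] ^+ 2))); last by ring.
    by rewrite -e; ring.
  by have := pE z; rewrite p0 horner0 => /esym/subr0_eq ->; ring.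
have [s00|s00] := eqVneq s0 0; last first.
  exfalso; apply: (@quadratic_no_section _ (- s0) (r0 - s1 + c * k) (r1 - s2) 0 0 k _ _ gn).
    move=> a b e1; rewrite !mul0r !add0r => /eqP.
    rewrite mulf_eq0 (negbTE k0) expf_eq0 /= => /eqP z0; move: e1; rewrite z0.
    rewrite !expr0n /= !mulr0 !addr0 => /eqP.
    by rewrite mulf_eq0 oppr_eq0 (negbTE s00) expf_eq0 /= => /eqP.
  move=> z /=; have [p pE] : exists p : {poly K}, forall y : K, p.[y] =
      - s0 * g0.[y] ^+ 2 + (r0 - s1 + c * k) * (g0.[y] * g1.[y]) + (r1 - s2) * g1.[y] ^+ 2
      - y * (k * g1.[y] ^+ 2).
    exists ((- s0)%:P * g0 ^+ 2 + (r0 - s1 + c * k)%:P * (g0 * g1) + (r1 - s2)%:P * g1 ^+ 2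
      - 'X * (k%:P * g1 ^+ 2)) => y.
    by rewrite !(hornerD, hornerN, hornerM, hornerC, hornerX, horner_exp).
  have p0 : p = 0.
    apply: (poly_mul_eval_eq0 g00) => y; have := gE y; rewrite pE r20 => e.
    rewrite mulrBr; apply/eqP; rewrite subr_eq0; apply/eqP.
    transitivity (y * (k * (g0.[y] * g1.[y] ^+ 2))); last by ring.
    by rewrite -e; ring.
  by have := pE z; rewrite p0 horner0 => /esym/subr0_eq ->; ring.
(* Now [a] divides the first component and [b] the second; the third linear form is
   [r0 a + s2 b + c], up to multiples of [a b] added by [A]. *)
pose A : 'M[K]_3 := m3 0 1 (r1 - s2) 1 0 (s1 - r0) 0 0 k.
pose M : 'M[K]_3 := m3 1 0 0 0 1 0 r0 s2 1.
have FA x : F x = A *m ev sigma (M *m x).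
  rewrite [x]v3_eta FE !m3_v3 ev_sigma m3_v3 r20 s00.
  by congr v3; ring.
constructor 3; exists A, M; split => //.
  exact: (cremona_like_unit (G := fun x => ev sigma (M *m x)) cF FA).
by apply: m3_unit; rewrite [X in X != 0](_ : _ = 1) ?oner_eq0 //; ring.
Qed.

(** The right-hand side is now [z k a^2 b]. The cubic identity excludes [r2 != 0]; then a factor [a]
    cancels, and the quadratic identity excludes [r1 != s2]. What remains is [rho]. *)
Lemma standard_rank2_double :
  (forall a b c, F (v3 a b c) = v3 (r0 * a ^+ 2 + r1 * (a * b) + r2 * b ^+ 2 + c * a)
     (s0 * a ^+ 2 + s1 * (a * b) + s2 * b ^+ 2 + c * b) (k * a ^+ 2)) -> standard F.
Proof.
move=> FE; have [_ _ sF _] := cF.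
have [d d0 dP] := generic_sections_coords sF.
have sec c : d.[c] != 0 -> exists g0 g1 : {poly K}, [/\ g0 != 0, k != 0 & forall z,
    let a := g0.[z] in let b := g1.[z] in
    (c * k - s0) * a ^+ 3 + (r0 - s1) * (a ^+ 2 * b) + (r1 - s2) * (a * b ^+ 2) + r2 * b ^+ 3 =
    z * (k * (a ^+ 2 * b))].
  move=> /dP[g0 [g1 [g2 [h [h0 gE]]]]]; exists g0, g1.
  have {}gE z := gE z; have E z : k * g0.[z] ^+ 2 = h.[z].
    by have := gE z; rewrite FE => /v3_inj[].
  split.
  - apply: contra h0 => /eqP g00; apply/eqP/poly_eval_eq0 => z.
    by rewrite -E g00 horner0 expr0n mulr0.
  - by apply: contra h0 => /eqP k0; apply/eqP/poly_eval_eq0 => z; rewrite -E k0 mul0r.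
  move=> z a b; have := gE z; rewrite FE -E -/a -/b => /v3_inj[e0 e1 _].
  apply/subr0_eq.
  transitivity (b * (r0 * a ^+ 2 + r1 * (a * b) + r2 * b ^+ 2 + g2.[z] * a - k * a ^+ 2 * z)
     - a * (s0 * a ^+ 2 + s1 * (a * b) + s2 * b ^+ 2 + g2.[z] * b - k * a ^+ 2 * c)); first by ring.
  by rewrite e0 e1 !subrr !mulr0 subrr.
have [c0 dc0] := poly_nonroot d0; have [_ [_ [_ k0 _]]] := sec c0 dc0.
(* With this [c] the left-hand form does not vanish at [b = 0], [a != 0]. *)
have [c] : exists c, (d * (k *: 'X - s0%:P)).[c] != 0.
  apply/poly_nonroot/mulf_neq0 => //; apply/eqP => /polyP/(_ 1%N).
  by rewrite coefB coefC coefZ coefX !coef0 subr0 mulr1 => /eqP; rewrite (negbTE k0).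
rewrite !hornerE mulf_eq0 negb_or (mulrC k) => /andP[/sec[g0 [g1 [g00 _ gE]]] rsc].
have gn : (g0 != 0) || (g1 != 0) by rewrite g00.
have [r20|r20] := eqVneq r2 0; last first.
  exfalso; apply: (@cubic_no_section _ (c * k - s0) (r0 - s1) (r1 - s2) r2 0 k 0 0 _ _ gn).
    move=> a b e1; rewrite !mul0r !add0r !addr0 => /eqP.
    rewrite mulf_eq0 (negbTE k0) mulf_eq0 expf_eq0 /= => /orP[] /eqP z0; move: e1; rewrite z0.
      rewrite !expr0n /= !mul0r !mulr0 !add0r => /eqP.
      by rewrite mulf_eq0 (negbTE r20) expf_eq0 /= => /eqP.
    rewrite !expr0n /= !mulr0 !addr0 => /eqP.
    by rewrite mulf_eq0 (negbTE rsc) expf_eq0 /= => /eqP.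
  by move=> z /=; rewrite gE; ring.
have [rs|rs] := eqVneq (r1 - s2) 0; last first.
  exfalso; apply: (@quadratic_no_section _ (c * k - s0) (r0 - s1) (r1 - s2) 0 k 0 _ _ gn).
    move=> a b e1; rewrite !mul0r !add0r addr0 => /eqP.
    rewrite !mulf_eq0 (negbTE k0) /= => /orP[] /eqP z0; move: e1; rewrite z0.
      rewrite !expr0n /= !mul0r !mulr0 !add0r => /eqP.
      by rewrite mulf_eq0 (negbTE rs) expf_eq0 /= => /eqP.
    rewrite !expr0n /= !mulr0 !addr0 => /eqP.
    by rewrite mulf_eq0 (negbTE rsc) expf_eq0 /= => /eqP.
  move=> z /=; have [p pE] : exists p : {poly K}, forall y : K, p.[y] =
      (c * k - s0) * g0.[y] ^+ 2 + (r0 - s1) * (g0.[y] * g1.[y]) + (r1 - s2) * g1.[y] ^+ 2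
      - y * (k * (g0.[y] * g1.[y])).
    exists ((c * k - s0)%:P * g0 ^+ 2 + (r0 - s1)%:P * (g0 * g1) + (r1 - s2)%:P * g1 ^+ 2
      - 'X * (k%:P * (g0 * g1))) => y.
    by rewrite !(hornerD, hornerN, hornerM, hornerC, hornerX, horner_exp).
  have p0 : p = 0.
    apply: (poly_mul_eval_eq0 g00) => y; have := gE y; rewrite pE r20 => e.
    rewrite mulrBr; apply/eqP; rewrite subr_eq0; apply/eqP.
    transitivity (y * (k * (g0.[y] ^+ 2 * g1.[y]))); last by ring.
    by rewrite -e; ring.
  by have := pE z; rewrite p0 horner0 => /esym/subr0_eq ->; ring.
(* The net is spanned by [a^2] and the products of [s1 a + r1 b + c] with [a] and [b]. *)
pose A : 'M[K]_3 := m3 0 (r0 - s1) 1 1 s0 0 0 k 0.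
pose M : 'M[K]_3 := m3 0 1 0 s1 r1 1 1 0 0.
have FA x : F x = A *m ev rho (M *m x).
  rewrite [x]v3_eta FE !m3_v3 ev_rho m3_v3 r20 -(subr0_eq rs).
  by congr v3; ring.
constructor 2; exists A, M; split => //.
  exact: (cremona_like_unit (G := fun x => ev rho (M *m x)) cF FA).
by apply: m3_unit; rewrite [X in X != 0](_ : _ = 1) ?oner_eq0 //; ring.
Qed.

End Rank2.

(** A change [D] of the coordinates [a, b], undone on the target by [invmx D], preserves the terms
    in [c] and normalizes the third component. *)
Lemma standard_rank2 F : cremona_like F ->
  (forall a b c, F (v3 a b c) = F (v3 a b 0) + v3 (c * a) (c * b) 0) -> standard F.
Proof.
move=> cF Fc; have [Fv _ _ _] := cF.
have [r0 [r1 [r2 [s0 [s1 [s2 [t0 [t1 [t2 Fb]]]]]]]]] := binary_coefs Fv.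
have [n00 [n01 [n10 [n11 [k [n0 Nq]]]]]] := binary_quadratic_normal t0 t1 t2.
pose D := block2 n00 n01 n10 n11; have uD : D \in unitmx by exact: block2_unit.
pose F' x := invmx D *m F (D *m x).
have eF : lr_equiv F F' by exists (invmx D), D; rewrite unitmx_inv uD.
have cF' := cremona_like_lr eF cF; have [F'v _ _ _] := cF'.
apply: (standard_lr eF).
have F'c a b c : F' (v3 a b c) = F' (v3 a b 0) + v3 (c * a) (c * b) 0.
  rewrite /F' !block2_v3 Fc mulmxDr; congr (_ + _).
  rewrite -[RHS](mulKmx uD) block2_v3; congr (_ *m _); congr v3; ring.
have F'2 a b : F' (v3 a b 0) i2 0 = t0 * (n00 * a + n01 * b) ^+ 2 +
    t1 * ((n00 * a + n01 * b) * (n10 * a + n11 * b)) + t2 * (n10 * a + n11 * b) ^+ 2.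
  have : D *m F' (v3 a b 0) = F (D *m v3 a b 0) by rewrite mulKVmx.
  move/(congr1 (fun x : 'cV_3 => x i2 0)).
  by rewrite [F' _]v3_eta !block2_v3 Fb !v3E.
have [p0 [p1 [p2 [q0 [q1 [q2 [w0 [w1 [w2 F'b]]]]]]]]] := binary_coefs F'v.
have F'E a b c : F' (v3 a b c) = v3 (p0 * a ^+ 2 + p1 * (a * b) + p2 * b ^+ 2 + c * a)
    (q0 * a ^+ 2 + q1 * (a * b) + q2 * b ^+ 2 + c * b) (F' (v3 a b 0) i2 0).
  by rewrite F'c F'b add_v3 v3E addr0.
case: Nq => Nq.
  apply: (@standard_rank2_distinct F' p0 p1 p2 q0 q1 q2 k cF') => a b c.
  by rewrite F'E F'2 Nq.
apply: (@standard_rank2_double F' p0 p1 p2 q0 q1 q2 k cF') => a b c.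
by rewrite F'E F'2 Nq.
Qed.

Lemma colinear_or_basis (P Q : 'cV[K]_3) :
  (exists a b, ((a != 0) || (b != 0)) /\ a *: P + b *: Q = 0) \/
  (exists2 B : 'M[K]_3, B \in unitmx & forall a b, B *m v3 a b 0 = a *: P + b *: Q).
Proof.
rewrite [P]v3_eta [Q]v3_eta.
move: (P i0 0) (P i1 0) (P i2 0) (Q i0 0) (Q i1 0) (Q i2 0) => p0 p1 p2 q0 q1 q2.
have basis w0 w1 w2 : p0 * (q1 * w2 - w1 * q2) - q0 * (p1 * w2 - w1 * p2)
      + w0 * (p1 * q2 - q1 * p2) != 0 ->
    exists2 B : 'M[K]_3, B \in unitmx & forall a b, B *m v3 a b 0 =
      a *: v3 p0 p1 p2 + b *: v3 q0 q1 q2.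
  move=> d0; exists (m3 p0 q0 w0 p1 q1 w1 p2 q2 w2).
    by apply: m3_unit; apply: contra d0 => /eqP e; rewrite -e; apply/eqP; ring.
  by move=> a b; rewrite m3_v3 !scale_v3 add_v3; congr v3; ring.
have [m01|m01] := eqVneq (p0 * q1 - p1 * q0) 0; last first.
  by right; apply: (basis 0 0 1); rewrite [X in X != 0](_ : _ = p0 * q1 - p1 * q0) //; ring.
have [m02|m02] := eqVneq (p0 * q2 - p2 * q0) 0; last first.
  right; apply: (basis 0 1 0); rewrite [X in X != 0](_ : _ = - (p0 * q2 - p2 * q0)) ?oppr_eq0 //.
  by ring.
have [m12|m12] := eqVneq (p1 * q2 - p2 * q1) 0; last first.
  by right; apply: (basis 1 0 0); rewrite [X in X != 0](_ : _ = p1 * q2 - p2 * q1) //; ring.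
left; have [p00|p00] := eqVneq p0 0; last first.
  exists q0, (- p0); rewrite oppr_eq0 p00 orbT !scale_v3 add_v3; split => //.
  apply: cv3P; rewrite v3E mxE; first by ring.
    by transitivity (- (p0 * q1 - p1 * q0)); [ring|rewrite m01 oppr0].
  by transitivity (- (p0 * q2 - p2 * q0)); [ring|rewrite m02 oppr0].
have [p10|p10] := eqVneq p1 0; last first.
  exists q1, (- p1); rewrite oppr_eq0 p10 orbT !scale_v3 add_v3; split => //.
  apply: cv3P; rewrite v3E mxE; last first.
    by transitivity (- (p1 * q2 - p2 * q1)); [ring|rewrite m12 oppr0].
    by ring.
  by transitivity (p0 * q1 - p1 * q0); [ring|].
have [p20|p20] := eqVneq p2 0; last first.
  exists q2, (- p2); rewrite oppr_eq0 p20 orbT !scale_v3 add_v3; split => //.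
  apply: cv3P; rewrite v3E mxE; last by ring.
    by transitivity (p0 * q2 - p2 * q0); [ring|].
  by transitivity (p1 * q2 - p2 * q1); [ring|].
exists 1, 0; rewrite oner_neq0 p00 p10 p20 !scale_v3 add_v3; split => //.
by apply: cv3P; rewrite v3E mxE; ring.
Qed.

Theorem cremona_like_standard F : cremona_like F -> standard F.
Proof.
move=> cF; have [x x0 Fx] := base_point_exists cF.
have [M uM Mx] := col_complete x0; pose F1 y := F (M *m y).
have eF1 : lr_equiv F F1.
  by exists 1%:M, M; rewrite unitmx1; split => // y; rewrite mul1mx.
apply: (standard_lr eF1); have cF1 := cremona_like_lr eF1 cF.
have [F1v _ _ _] := cF1.
have [p0 [p1 [p2 [p3 [p4 [p5 F1E]]]]]] := quadratic_coefs F1v.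
have p50 i : p5 i = 0.
  have := F1E 0 0 1 i; rewrite /F1 Mx Fx mxE => ->.
  by rewrite !expr0n expr1n /= !(mul0r, mulr0, addr0, add0r) mulr1.
pose P := \col_i p3 i; pose Q := \col_i p4 i.
have F1c a b c : F1 (v3 a b c) = F1 (v3 a b 0) + c *: (a *: P + b *: Q).
  by apply/colP => i; rewrite F1E [RHS]mxE F1E p50 !mxE; ring.
case: (colinear_or_basis P Q) => [[a1 [b1 [n0 PQ]]]|[B uB BE]]; last first.
  pose F2 y := invmx B *m F1 y.
  have eF2 : lr_equiv F1 F2.
    by exists (invmx B), 1%:M; rewrite unitmx1 unitmx_inv; split => // y; rewrite mul1mx.
  apply: (standard_lr eF2); apply: (standard_rank2 (cremona_like_lr eF2 cF1)) => a b c.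
  by rewrite /F2 F1c mulmxDr -BE -scalemxAr mulKmx // scale_v3 mulr0.
(* The kernel vector [(a1, b1)] becomes the second basis vector of the coordinates [a, b]. *)
have [n00 [n01 [n10 [n11 [R [dn RE]]]]]] : exists n00 n01 n10 n11 (R : 'cV[K]_3),
    n00 * n11 - n01 * n10 != 0 /\
    forall a b, (n00 * a + n01 * b) *: P + (n10 * a + n11 * b) *: Q = a *: R.
  have [b10|b10] := eqVneq b1 0; last first.
    exists 1, a1, 0, b1, P; split=> [|a b]; first by rewrite mul1r mulr0 subr0.
    rewrite -[RHS]addr0 -(scaler0 _ b) -PQ scalerDr !scalerA.
    by apply/colP => i; rewrite !mxE; ring.
  have a10 : a1 != 0 by move: n0; rewrite b10 eqxx orbF.
  exists 0, a1, 1, 0, Q; split=> [|a b]; first by rewrite mul0r mulr1 sub0r oppr_eq0.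
  rewrite -[RHS]addr0 -(scaler0 _ b) -PQ b10 scalerDr !scalerA.
  by apply/colP => i; rewrite !mxE; ring.
pose D := block2 n00 n01 n10 n11; have uD : D \in unitmx by exact: block2_unit.
pose F2 y := F1 (D *m y).
have eF2 : lr_equiv F1 F2.
  by exists 1%:M, D; rewrite unitmx1; split => // y; rewrite mul1mx.
apply: (standard_lr eF2); have cF2 := cremona_like_lr eF2 cF1.
have F2c a b c : F2 (v3 a b c) = F2 (v3 a b 0) + (c * a) *: R.
  by rewrite /F2 !block2_v3 F1c RE scalerA.
have [R0|R0] := eqVneq R 0.
  by case: (cremona_like_not_cone cF2) => a b c; rewrite F2c R0 scaler0 addr0.
have [B uB BR] := col_complete R0; pose F3 y := invmx B *m F2 y.
have eF3 : lr_equiv F2 F3.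
  by exists (invmx B), 1%:M; rewrite unitmx1 unitmx_inv; split => // y; rewrite mul1mx.
apply: (standard_lr eF3); apply: (standard_rank1 (cremona_like_lr eF3 cF2)) => a b c.
by rewrite /F3 F2c mulmxDr -BR -scalemxAr mulKmx // scale_v3 !mulr0 mulr1.
Qed.

End ClassificationCases.

Section OrbitDecomposition.
Context {K : numClosedFieldType}.
Local Open Scope classical_set_scope.
Implicit Types (L : Rat2 K) (v : quadtriple K).

Lemma Bir2_decomposition :
  Bir2 K = Sigma0 K `|` Sigma1 K `|` Sigma2 K `|` Sigma3 K.
Proof.
apply/seteqP; split=> L; last first.
  case=> [[[]|]|]; [exact: Sigma0_Bir2|..].
  - by case/Sigma1_oBir2.
  - by case/Sigma2_oBir2.
  - by case/Sigma3_oBir2.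
move=> /Bir2_cases[|[v vL [ncf [G Gh vG]]]]; first by left; left; left.
have [] : standard (ev v).
- apply: cremona_like_standard; split; first by exists v.
  + by move=> a N; exact: no_common_factor_linear_factor.
  + exact: (section_generic Gh vG).
  + exact: (section_limit Gh vG).
- by move=> /(lrorbitP _ vL); left; left; right.
- by move=> /(lrorbitP _ vL); left; right.
- by move=> /(lrorbitP _ vL); right.
Qed.

Lemma oBir2_decomposition : oBir2 K = Sigma1 K `|` Sigma2 K `|` Sigma3 K.
Proof.
apply/seteqP; split=> L.
  move=> [+ [v vL ncf]]; rewrite Bir2_decomposition => -[[[|]|]|].
  - move=> /(Sigma0P vL)[a [N [_ _ vE]]].
    by case: (no_common_factor_linear_factor ncf vE).
  - by left; left.
  - by left; right.
  - by right.
case=> [[]|]; [exact: Sigma1_oBir2|exact: Sigma2_oBir2|exact: Sigma3_oBir2].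
Qed.

End OrbitDecomposition.

(** * Dimensions of the orbits *)

Section OrbitDimension.
Context {K : numFieldType}.
Local Open Scope classical_set_scope.

Lemma polynomial_map_bigsum (V : vectType K) (I J : finType) (w : J -> (I -> K) -> V) :
  (forall j, polynomial_map (w j)) -> polynomial_map (fun t => \sum_j w j t).
Proof.
move=> wP i; have [p pE] := polynomial_fun_sum (index_enum J) predT (fun j => wP j i).
by exists p => t; rewrite linear_sum -pE.
Qed.

Lemma polynomial_map_cst (V : vectType K) (I : finType) (v : V) :
  polynomial_map (fun _ : I -> K => v).
Proof. by move=> i; exact: polynomial_fun_cst. Qed.

Lemma polynomial_map_quad (I : finType) (c : (I -> K) -> 'I_3 -> 'I_3 -> 'I_3 -> K) :
  (forall i k l, polynomial_fun (fun t => c t i k l)) ->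
  polynomial_map (fun t => quad (c t)).
Proof.
move=> cP; pose E (i k l : 'I_3) : quadtriple K :=
  [ffun j => if j == i then lmul (var k) (var l) else 0].
have -> : (fun t => quad (c t)) =
    fun t => \sum_i \sum_k \sum_l c t i k l *: E i k l.
  apply/funext => t; apply: ev_inj => x; apply/colP => j.
  have EE i k l : ev (E i k l) x j 0 = if j == i then x k 0 * x l 0 else 0.
    by rewrite mxE ffunE; case: eqP => _; rewrite ?meval0 //= mevalM !mevalXU.
  rewrite ev_quad ev_sum summxE [RHS](bigD1 j) //= [X in _ = _ + X]big1 ?addr0 => [|i ne].
    rewrite ev_sum summxE; apply: eq_bigr => k _.
    rewrite ev_sum summxE; apply: eq_bigr => l _.
    by rewrite evZ mxE EE eqxx mulrA.
  rewrite ev_sum summxE big1 // => k _; rewrite ev_sum summxE big1 // => l _.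
  by rewrite evZ mxE EE eq_sym (negbTE ne) mulr0.
do 3 (apply: polynomial_map_bigsum => ?).
by apply: polynomial_mapZ (polynomial_map_cst _ _).
Qed.

Variable s : 'I_3 -> 'I_3 -> 'I_3 -> K.
Implicit Types (A M N : 'M[K]_3) (x y : 'cV[K]_3).

Definition bil x y : 'cV[K]_3 := \col_j \sum_a \sum_b s j a b * x a 0 * y b 0.

Lemma mxD (x y : 'cV[K]_3) i : (x + y) i 0 = x i 0 + y i 0. Proof. by rewrite mxE. Qed.
Lemma mxZ c (x : 'cV[K]_3) i : (c *: x) i 0 = c * x i 0. Proof. by rewrite mxE. Qed.

Lemma bilDl x x' y : bil (x + x') y = bil x y + bil x' y.
Proof.
apply/colP => j; rewrite !mxE -big_split; apply: eq_bigr => a _ /=.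
by rewrite -big_split; apply: eq_bigr => b _ /=; rewrite !mxE; ring.
Qed.

Lemma bilDr x y y' : bil x (y + y') = bil x y + bil x y'.
Proof.
apply/colP => j; rewrite !mxE -big_split; apply: eq_bigr => a _ /=.
by rewrite -big_split; apply: eq_bigr => b _ /=; rewrite !mxE; ring.
Qed.

Lemma bilZl c x y : bil (c *: x) y = c *: bil x y.
Proof.
apply/colP => j; rewrite !mxE mulr_sumr; apply: eq_bigr => a _ /=.
by rewrite mulr_sumr; apply: eq_bigr => b _ /=; rewrite !mxE; ring.
Qed.

Lemma bilZr c x y : bil x (c *: y) = c *: bil x y.
Proof.
apply/colP => j; rewrite !mxE mulr_sumr; apply: eq_bigr => a _ /=.
by rewrite mulr_sumr; apply: eq_bigr => b _ /=; rewrite !mxE; ring.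
Qed.

(* Splitting the two occurrences of M in A f(M x) makes it trilinear. *)
Definition lrquad A M N : quadtriple K :=
  quad (fun i k l => \sum_j \sum_a \sum_b A i j * s j a b * M a k * N b l).

Lemma ev_lrquad A M N x : ev (lrquad A M N) x = A *m bil (M *m x) (N *m x).
Proof.
apply/colP => i; rewrite ev_quad mxE.
under eq_bigr => k _ do under eq_bigr => l _ do rewrite !mulr_suml.
under eq_bigr => k _ do rewrite exchange_big.
rewrite exchange_big; apply: eq_bigr => j _; rewrite mxE mulr_sumr.
under eq_bigr => k _ do under eq_bigr => l _ do rewrite !mulr_suml.
under eq_bigr => k _ do rewrite exchange_big.
rewrite exchange_big; apply: eq_bigr => a _; rewrite mulr_sumr.
under eq_bigr => k _ do under eq_bigr => l _ do rewrite !mulr_suml.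
under eq_bigr => k _ do rewrite exchange_big.
rewrite exchange_big; apply: eq_bigr => b _; rewrite !mxE.
rewrite -!mulrA big_distrlr /= !mulr_sumr; apply: eq_bigr => k _ /=.
by rewrite !mulr_sumr; apply: eq_bigr => l _ /=; ring.
Qed.

Lemma polynomial_map_lrquad (I : finType) (A M N : (I -> K) -> 'M[K]_3) :
  (forall i j, polynomial_fun (fun t => A t i j)) ->
  (forall i j, polynomial_fun (fun t => M t i j)) ->
  (forall i j, polynomial_fun (fun t => N t i j)) ->
  polynomial_map (fun t => lrquad (A t) (M t) (N t)).
Proof.
move=> AP MP NP; apply: polynomial_map_quad => i k l.
do 3 (apply: polynomial_fun_sum => ?).
apply: polynomial_funM (NP _ _); apply: polynomial_funM (MP _ _).
exact: polynomial_funM (AP _ _) (polynomial_fun_cst _ _).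
Qed.

Lemma lrquadDA A A' M N : lrquad (A + A') M N = lrquad A M N + lrquad A' M N.
Proof. by apply: ev_inj => x; rewrite evD !ev_lrquad mulmxDl. Qed.

Lemma lrquadZA c A M N : lrquad (c *: A) M N = c *: lrquad A M N.
Proof. by apply: ev_inj => x; rewrite evZ !ev_lrquad scalemxAl. Qed.

Lemma lrquadDM A M M' N : lrquad A (M + M') N = lrquad A M N + lrquad A M' N.
Proof. by apply: ev_inj => x; rewrite evD !ev_lrquad mulmxDl bilDl mulmxDr. Qed.

Lemma lrquadZM c A M N : lrquad A (c *: M) N = c *: lrquad A M N.
Proof. by apply: ev_inj => x; rewrite evZ !ev_lrquad -scalemxAl bilZl scalemxAr. Qed.

Lemma lrquadDN A M N N' : lrquad A M (N + N') = lrquad A M N + lrquad A M N'.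
Proof. by apply: ev_inj => x; rewrite evD !ev_lrquad mulmxDl bilDr mulmxDr. Qed.

Lemma lrquadZN c A M N : lrquad A M (c *: N) = c *: lrquad A M N.
Proof. by apply: ev_inj => x; rewrite evZ !ev_lrquad -scalemxAl bilZr scalemxAr. Qed.

Variable f : quadtriple K.
Hypothesis fE : f = quad s.

Lemma ev_bil x : ev f x = bil x x.
Proof.
rewrite fE; apply/colP => j; rewrite ev_quad mxE.
by apply: eq_bigr => a _; apply: eq_bigr.
Qed.

Lemma polar_bil x y : polar (ev f) x y = bil x y + bil y x.
Proof.
rewrite /polar !ev_bil bilDl !bilDr.
by apply/colP => i; rewrite !mxE; ring.
Qed.

Lemma ev_lrquad_diag A M x : ev (lrquad A M M) x = A *m ev f (M *m x).
Proof. by rewrite ev_lrquad ev_bil. Qed.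

Section LowerBound.
Variables (d : nat) (A1 M1 : ('I_d -> K) -> 'M[K]_3).
Hypothesis A1_linear : forall c t u, A1 (fun j => c * t j + u j) = c *: A1 t + A1 u.
Hypothesis M1_linear : forall c t u, M1 (fun j => c * t j + u j) = c *: M1 t + M1 u.
Hypothesis A1P : forall i j, polynomial_fun (fun t => A1 t i j).
Hypothesis M1P : forall i j, polynomial_fun (fun t => M1 t i j).
Hypothesis f_neq0 : exists x, ev f x != 0.
(* The tangent map of (A, M) |-> A f(M x) at the identity is injective. *)
Hypothesis tangent_inj : forall (c : K) u,
  (forall x, (c%:M + A1 u) *m ev f x + polar (ev f) x (M1 u *m x) = 0) ->
  c = 0 /\ forall j, u j = 0.

Let linear0 (B : ('I_d -> K) -> 'M[K]_3) :
  (forall c t u, B (fun j => c * t j + u j) = c *: B t + B u) -> B (fun=> 0) = 0.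
Proof.
move=> Bl; have := Bl 1 (fun=> 0) (fun=> 0).
rewrite (_ : (fun _ => _) = fun=> 0); last by apply/funext => j; rewrite mulr0 addr0.
rewrite scale1r => e; apply: (addrI (B (fun=> 0))).
by rewrite addr0; exact: esym e.
Qed.

Let w t := lrquad (1%:M + A1 t) (1%:M + M1 t) (1%:M + M1 t).

Let tangent u := lrquad (A1 u) 1%:M 1%:M
  + (lrquad 1%:M (M1 u) 1%:M + lrquad 1%:M 1%:M (M1 u)).

Let dir (j : 'I_d) : 'I_d -> K := fun k => (k == j)%:R.

Let tangent_sum u : tangent u = \sum_j u j *: tangent (dir j).
Proof.
have tl c t u' : tangent (fun j => c * t j + u' j) = c *: tangent t + tangent u'.
  rewrite /tangent A1_linear M1_linear !(lrquadDA, lrquadZA, lrquadDM, lrquadZM, lrquadDN, lrquadZN).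
  move: (lrquad _ _ _) (lrquad _ _ _) (lrquad _ _ _) (lrquad _ _ _) (lrquad _ _ _) (lrquad _ _ _).
  move=> v1 v2 v3 v4 v5 v6; rewrite !scalerDr.
  by rewrite (addrACA (c *: v4)); exact: addrACA.
have t0 : tangent (fun=> 0) = 0.
  have := tl 1 (fun=> 0) (fun=> 0).
  rewrite (_ : (fun _ => _) = fun=> 0); last by apply/funext => j; rewrite mulr0 addr0.
  rewrite scale1r => e; apply: (addrI (tangent (fun=> 0))).
  by rewrite addr0; exact: esym e.
have E (r : seq 'I_d) : tangent (fun k => \sum_(j <- r) u j * dir j k) =
    \sum_(j <- r) u j *: tangent (dir j).
  elim: r => [|j r IH].
    by rewrite big_nil -t0; congr tangent; apply/funext => k; rewrite big_nil.
  rewrite big_cons -IH -tl; congr tangent; apply/funext => k.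
  by rewrite big_cons.
rewrite -E; congr tangent; apply/funext => k; rewrite (bigD1 k) //= /dir eqxx mulr1.
by rewrite big1 ?addr0 // => j ne; rewrite eq_sym (negbTE ne) mulr0.
Qed.

Lemma lrorbit_chain_exists : exists c, irreducible_chain (lrorbit f) d c.
Proof.
have w0 : w (fun=> 0) = lrquad 1%:M 1%:M 1%:M.
  by rewrite /w (linear0 A1_linear) (linear0 M1_linear) !addr0.
have oneP (B : ('I_d -> K) -> 'M[K]_3) : (forall i j, polynomial_fun (fun t => B t i j)) ->
    forall i j, polynomial_fun (fun t => (1%:M + B t) i j).
  move=> BP i j; have [p pE] := polynomial_funD (polynomial_fun_cst 'I_d ((1%:M : 'M[K]_3) i j)) (BP i j).
  by exists p => t; rewrite -pE [LHS]mxE.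
have detP (B : ('I_d -> K) -> 'M[K]_3) : (forall i j, polynomial_fun (fun t => B t i j)) ->
    polynomial_fun (fun t => \det (B t)).
  move=> BP; apply: polynomial_fun_sum => p; apply: polynomial_funM.
    exact: polynomial_fun_cst.
  by apply: polynomial_fun_prod => i; exact: BP.
apply: (@irreducible_chain_exists _ _ _ _ w
  (fun t => \det (1%:M + A1 t) * \det (1%:M + M1 t)) (fun j => tangent (dir j))).
- by apply: polynomial_map_lrquad; exact: oneP.
- by apply: polynomial_funM; apply: detP; exact: oneP.
- by rewrite (linear0 A1_linear) (linear0 M1_linear) !addr0 det1 mulr1 oner_neq0.
- move=> t; rewrite mulf_eq0 negb_or -!unitfE -!unitmxE => /andP[uA uM].
  have wE : lr_equiv (ev f) (ev (w t)).
    by exists (1%:M + A1 t), (1%:M + M1 t); split => // x; rewrite ev_lrquad_diag.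
  have wn0 : w t != 0.
    have [x] := f_neq0; apply: contra => /eqP e; have [A [M [_ _ H]]] := lr_equiv_sym wE.
    by rewrite H e ev0 mulmx0.
  have [L wL] := represents_exists wn0; exists L => //.
  by apply/(lrorbitP _ wL).
- move=> u.
  (* The terms of order [e ^+ 2] and [e ^+ 3] in the trilinear expansion of [w]. *)
  exists [:: lrquad (A1 u) (M1 u) 1%:M + (lrquad (A1 u) 1%:M (M1 u) + lrquad 1%:M (M1 u) (M1 u));
    lrquad (A1 u) (M1 u) (M1 u)] => e.
  rewrite -tangent_sum w0 /w /tangent.
  have lin (B : ('I_d -> K) -> 'M[K]_3) :
      (forall c t u, B (fun j => c * t j + u j) = c *: B t + B u) ->
      B (fun j => e * u j) = e *: B u.
    move=> Bl; rewrite -[RHS]addr0 -(linear0 Bl) -Bl; congr B.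
    by apply/funext => j; rewrite addr0.
  rewrite (lin _ A1_linear) (lin _ M1_linear).
  rewrite !(lrquadDA, lrquadZA, lrquadDM, lrquadZM, lrquadDN, lrquadZN).
  rewrite !big_ord_recl big_ord0 /= expr0 expr1 scale1r addr0.
  move: (lrquad 1%:M 1%:M 1%:M) (lrquad (A1 u) 1%:M 1%:M) (lrquad 1%:M (M1 u) 1%:M)
    (lrquad 1%:M 1%:M (M1 u)) (lrquad 1%:M (M1 u) (M1 u)) (lrquad (A1 u) (M1 u) 1%:M)
    (lrquad (A1 u) 1%:M (M1 u)) (lrquad (A1 u) (M1 u) (M1 u)) => v1 v2 v3 v4 v5 v6 v7 v8.
  apply: ev_inj => x; rewrite !(evD, evZ); apply/colP => i; rewrite !(mxD, mxZ).
  by move: (ev v1 x i 0) (ev v2 x i 0) (ev v3 x i 0) (ev v4 x i 0) (ev v5 x i 0)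
    (ev v6 x i 0) (ev v7 x i 0) (ev v8 x i 0) => *; ring.
pose X := [tuple of w (fun=> 0) :: [seq tangent (dir j) | j <- ord_tuple d]].
suff : free X by [].
apply/freeP => c; rewrite big_ord_recl /=.
have -> : \sum_(i < d) c (lift ord0 i) *: X`_(lift ord0 i) = tangent (c \o lift ord0).
  rewrite tangent_sum; apply: eq_bigr => j _ /=; congr (_ *: _).
  by rewrite (nth_map j) ?add0n ?size_enum_ord // nth_ord_enum.
rewrite w0 /tangent => e.
have [|c0 cj] := @tangent_inj (c ord0) (c \o lift ord0).
  move=> x; have := congr1 (fun v => ev v x) e; rewrite ev0 => <-.
  rewrite !(evD, evZ) !ev_lrquad !mul1mx polar_bil -ev_bil mulmxDl mul_scalar_mx.
  by rewrite -addrA; congr (_ + (_ + _)); rewrite addrC.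
by move=> i; case: (unliftP ord0 i) => [j ->|->//]; exact: cj.
Qed.

End LowerBound.

End OrbitDimension.

(** * Lower bounds from injective tangent maps *)

Section DimensionLowerBounds.
Context {K : numFieldType}.
Local Open Scope classical_set_scope.

Definition at_index d (u : 'I_d -> K) (k : nat) : K := oapp u 0 (insub k).

Lemma at_indexE d (u : 'I_d -> K) (j : 'I_d) : at_index u j = u j.
Proof. by rewrite /at_index valK. Qed.

(* Indices beyond d stand for the entry 0. *)
Definition index_mx d (l : seq nat) (u : 'I_d -> K) : 'M[K]_3 :=
  \matrix_(i, j) at_index u (nth d l (3 * i + j)).

Lemma index_mx_linear d l (c : K) (t u : 'I_d -> K) :
  index_mx l (fun j => c * t j + u j) = c *: index_mx l t + index_mx l u.
Proof.
apply/matrixP => i j; rewrite !mxE /at_index; case: insub => //=.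
by rewrite mulr0 addr0.
Qed.

Lemma index_mx_polynomial d l i j :
  polynomial_fun (fun u : 'I_d -> K => index_mx l u i j).
Proof.
rewrite (_ : (fun u => _) = fun u : 'I_d -> K => at_index u (nth d l (3 * i + j))).
  rewrite /at_index; case: insub => [k|] /=; first exact: polynomial_fun_var.
  exact: polynomial_fun_cst.
by apply/funext => u; rewrite mxE.
Qed.

Lemma index_mxE d (k0 k1 k2 k3 k4 k5 k6 k7 k8 : nat) (u : 'I_d -> K) :
  let a := at_index u in
  index_mx [:: k0; k1; k2; k3; k4; k5; k6; k7; k8] u =
  m3 (a k0) (a k1) (a k2) (a k3) (a k4) (a k5) (a k6) (a k7) (a k8).
Proof.
move=> a; apply/matrixP => i j; rewrite !mxE.
by move: i; apply: ord3_ind; move: j; apply: ord3_ind.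
Qed.

Lemma scalar_m3 (c a0 a1 a2 a3 a4 a5 a6 a7 a8 : K) :
  c%:M + m3 a0 a1 a2 a3 a4 a5 a6 a7 a8 =
  m3 (c + a0) a1 a2 a3 (c + a4) a5 a6 a7 (c + a8).
Proof.
apply/matrixP => i j; rewrite !mxE.
by move: i; apply: ord3_ind; move: j; apply: ord3_ind; rewrite !(tnth_nth 0, tnth_nth [tuple 0; 0; 0]) /= ?mulr1n ?mulr0n ?add0r.
Qed.

Lemma quadratic_eq0 (q0 q1 q2 q3 q4 q5 : K) :
  (forall a b c, q0 * a ^+ 2 + q1 * (a * b) + q2 * b ^+ 2 + q3 * (a * c)
     + q4 * (b * c) + q5 * c ^+ 2 = 0) ->
  [/\ q0 = 0, q1 = 0, q2 = 0 & [/\ q3 = 0, q4 = 0 & q5 = 0]].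
Proof.
move=> H; have e0 : q0 = 0 by rewrite -(H 1 0 0); ring.
have e2 : q2 = 0 by rewrite -(H 0 1 0); ring.
have e5 : q5 = 0 by rewrite -(H 0 0 1); ring.
have e1 : q1 = 0 by rewrite -(H 1 1 0) e0 e2; ring.
have e3 : q3 = 0 by rewrite -(H 1 0 1) e0 e5; ring.
by have e4 : q4 = 0 by rewrite -(H 0 1 1) e2 e5; ring.
Qed.

(** The index [99] exceeds every number of parameters used and gives the entry [0]. The corner is
    omitted because the tangent condition already contains a scalar matrix [c%:M], which together
    with these eight parameters spans all left factors. *)
Definition left_indices : seq nat := [:: 99; 0; 1; 2; 3; 4; 5; 6; 7]%N.

Lemma orbit_chain_exists d f (l : seq nat) :
  (exists x, ev f x != 0) ->
  (forall (c : K) (u : 'I_d -> K),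
    (forall x, (c%:M + index_mx left_indices u) *m ev f x
       + polar (ev f) x (index_mx l u *m x) = 0) ->
    c = 0 /\ forall j, u j = 0) ->
  exists c, irreducible_chain (lrorbit f) d c.
Proof.
move=> f0 tan; have [s fE] := quad_surj f.
apply: (lrorbit_chain_exists fE (A1 := index_mx left_indices) (M1 := index_mx l)) => //.
- by move=> *; exact: index_mx_linear.
- by move=> *; exact: index_mx_linear.
- by move=> *; exact: index_mx_polynomial.
- by move=> *; exact: index_mx_polynomial.
Qed.

(** Diagonal substitutions only rescale the three products and are absorbed by the left factor; six
    off-diagonal entries of [M] remain. *)
Lemma sigma_chain_exists : exists c, irreducible_chain (Sigma3 K) 14 c.
Proof.
apply: (@orbit_chain_exists 14 sigma [:: 99; 8; 9; 10; 99; 11; 12; 13; 99]%N).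
  by apply: (ev_neq0 (ev_sigma 1 1 1)); rewrite mulr1 oner_eq0.
move=> c u H; pose a := at_index u; have a99 : at_index u 99 = 0 by rewrite /at_index insubN.
have {}H x y z : [/\ 0 * x ^+ 2 + (a 1%N + a 12%N) * (x * y) + a 13%N * y ^+ 2 + (a 0%N + a 10%N) * (x * z) + c * (y * z) + a 11%N * z ^+ 2 = 0,
    a 12%N * x ^+ 2 + (a 4%N + a 13%N) * (x * y) + 0 * y ^+ 2 + (c + a 3%N) * (x * z) + (a 2%N + a 8%N) * (y * z) + a 9%N * z ^+ 2 = 0 &
    a 10%N * x ^+ 2 + (c + a 7%N) * (x * y) + a 8%N * y ^+ 2 + (a 6%N + a 11%N) * (x * z) + (a 5%N + a 9%N) * (y * z) + 0 * z ^+ 2 = 0].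
  have := H (v3 x y z); rewrite !index_mxE scalar_m3 a99 polar_sigma ev_sigma !m3_v3 add_v3 !v3E.
  by move=> /v3_eq0[E0 E1 E2]; rewrite /a; split; [rewrite -[RHS]E0|rewrite -[RHS]E1|rewrite -[RHS]E2]; ring.
have [f0 f1 f2 [f3 f4 f5]] := @quadratic_eq0 _ _ _ _ _ _ (fun x y z => let: And3 p0 p1 p2 := H x y z in p0).
have [g0 g1 g2 [g3 g4 g5]] := @quadratic_eq0 _ _ _ _ _ _ (fun x y z => let: And3 p0 p1 p2 := H x y z in p1).
have [h0 h1 h2 [h3 h4 h5]] := @quadratic_eq0 _ _ _ _ _ _ (fun x y z => let: And3 p0 p1 p2 := H x y z in p2).
have ec : c = 0 by [].
have e8 : a 8%N = 0 by [].
have e9 : a 9%N = 0 by [].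
have e10 : a 10%N = 0 by [].
have e11 : a 11%N = 0 by [].
have e12 : a 12%N = 0 by [].
have e13 : a 13%N = 0 by [].
have e0 : a 0%N = 0 by move: f3; rewrite e10 addr0.
have e1 : a 1%N = 0 by move: f1; rewrite e12 addr0.
have e2 : a 2%N = 0 by move: g4; rewrite e8 addr0.
have e3 : a 3%N = 0 by move: g3; rewrite ec add0r.
have e4 : a 4%N = 0 by move: g1; rewrite e13 addr0.
have e5 : a 5%N = 0 by move: h4; rewrite e9 addr0.
have e6 : a 6%N = 0 by move: h3; rewrite e11 addr0.
have e7 : a 7%N = 0 by move: h1; rewrite ec add0r.
have {}a0 : all (fun k => at_index u k == 0) (iota 0 14).
  by rewrite /= -/a e0 e1 e2 e3 e4 e5 e6 e7 e8 e9 e10 e11 e12 e13 eqxx.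
split=> [|j]; first by [].
by apply/eqP; rewrite -at_indexE; apply: (allP a0); rewrite mem_iota /=.
Qed.

(** Besides the diagonal, [x0 |-> x0 + t x2] is absorbed, as it adds a multiple of [x1 x2] to
    [x0 x1]; five entries of [M] remain. *)
Lemma rho_chain_exists : exists c, irreducible_chain (Sigma2 K) 13 c.
Proof.
apply: (@orbit_chain_exists 13 rho [:: 99; 8; 99; 9; 99; 10; 11; 12; 99]%N).
  by apply: (ev_neq0 (ev_rho 1 1 1)); rewrite mulr1 oner_eq0.
move=> c u H; pose a := at_index u; have a99 : at_index u 99 = 0 by rewrite /at_index insubN.
have {}H x y z : [/\ a 9%N * x ^+ 2 + c * (x * y) + a 8%N * y ^+ 2 + a 10%N * (x * z) + a 1%N * (y * z) + a 0%N * z ^+ 2 = 0,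
    0 * x ^+ 2 + a 2%N * (x * y) + 0 * y ^+ 2 + (2%:R * a 11%N) * (x * z) + (a 4%N + 2%:R * a 12%N) * (y * z) + (c + a 3%N) * z ^+ 2 = 0 &
    0 * x ^+ 2 + (a 5%N + a 11%N) * (x * y) + a 12%N * y ^+ 2 + a 9%N * (x * z) + (c + a 7%N) * (y * z) + (a 6%N + a 10%N) * z ^+ 2 = 0].
  have := H (v3 x y z); rewrite !index_mxE scalar_m3 a99 polar_rho ev_rho !m3_v3 add_v3 !v3E.
  by move=> /v3_eq0[E0 E1 E2]; rewrite /a; split; [rewrite -[RHS]E0|rewrite -[RHS]E1|rewrite -[RHS]E2]; ring.
have [f0 f1 f2 [f3 f4 f5]] := @quadratic_eq0 _ _ _ _ _ _ (fun x y z => let: And3 p0 p1 p2 := H x y z in p0).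
have [g0 g1 g2 [g3 g4 g5]] := @quadratic_eq0 _ _ _ _ _ _ (fun x y z => let: And3 p0 p1 p2 := H x y z in p1).
have [h0 h1 h2 [h3 h4 h5]] := @quadratic_eq0 _ _ _ _ _ _ (fun x y z => let: And3 p0 p1 p2 := H x y z in p2).
have ec : c = 0 by [].
have e8 : a 8%N = 0 by [].
have e9 : a 9%N = 0 by [].
have e10 : a 10%N = 0 by [].
have e1 : a 1%N = 0 by [].
have e0 : a 0%N = 0 by [].
have e2 : a 2%N = 0 by [].
have e12 : a 12%N = 0 by [].
have e3 : a 3%N = 0 by move: g5; rewrite ec add0r.
have e7 : a 7%N = 0 by move: h4; rewrite ec add0r.
have e4 : a 4%N = 0 by move: g4; rewrite e12 mulr0 addr0.
have e6 : a 6%N = 0 by move: h5; rewrite e10 addr0.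
have e11 : a 11%N = 0 by move/eqP: g3; rewrite mulf_eq0 pnatr_eq0 /= => /eqP.
have e5 : a 5%N = 0 by move: h1; rewrite e11 addr0.
have {}a0 : all (fun k => at_index u k == 0) (iota 0 13).
  by rewrite /= -/a e0 e1 e2 e3 e4 e5 e6 e7 e8 e9 e10 e11 e12 eqxx.
split=> [|j]; first by [].
by apply/eqP; rewrite -at_indexE; apply: (allP a0); rewrite mem_iota /=.
Qed.

(** Lower triangular substitutions are absorbed under one condition on their diagonal, needed to
    preserve [x1^2 - x0 x2] up to the other two components. The entries above the diagonal and the
    last diagonal entry give a complement. *)
Lemma tau_chain_exists : exists c, irreducible_chain (Sigma1 K) 12 c.
Proof.
apply: (@orbit_chain_exists 12 tau [:: 99; 8; 9; 99; 99; 10; 99; 99; 11]%N).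
  by apply: (ev_neq0 (ev_tau 1 1 1)); rewrite mulr1 oner_eq0.
move=> c u H; pose a := at_index u; have a99 : at_index u 99 = 0 by rewrite /at_index insubN.
have {}H x y z : [/\ c * x ^+ 2 + (a 0%N + 2%:R * a 8%N) * (x * y) + a 1%N * y ^+ 2 + (- a 1%N + 2%:R * a 9%N) * (x * z) + 0 * (y * z) + 0 * z ^+ 2 = 0,
    a 2%N * x ^+ 2 + (c + a 3%N) * (x * y) + (a 4%N + a 8%N) * y ^+ 2 + (- a 4%N + a 10%N) * (x * z) + a 9%N * (y * z) + 0 * z ^+ 2 = 0 &
    a 5%N * x ^+ 2 + a 6%N * (x * y) + (c + a 7%N) * y ^+ 2 + (- (c + a 7%N) - a 11%N) * (x * z) + (- a 8%N + 2%:R * a 10%N) * (y * z) + (- a 9%N) * z ^+ 2 = 0].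
  have := H (v3 x y z); rewrite !index_mxE scalar_m3 a99 polar_tau ev_tau !m3_v3 add_v3 !v3E.
  by move=> /v3_eq0[E0 E1 E2]; rewrite /a; split; [rewrite -[RHS]E0|rewrite -[RHS]E1|rewrite -[RHS]E2]; ring.
have [f0 f1 f2 [f3 f4 f5]] := @quadratic_eq0 _ _ _ _ _ _ (fun x y z => let: And3 p0 p1 p2 := H x y z in p0).
have [g0 g1 g2 [g3 g4 g5]] := @quadratic_eq0 _ _ _ _ _ _ (fun x y z => let: And3 p0 p1 p2 := H x y z in p1).
have [h0 h1 h2 [h3 h4 h5]] := @quadratic_eq0 _ _ _ _ _ _ (fun x y z => let: And3 p0 p1 p2 := H x y z in p2).
have ec : c = 0 by [].
have e1 : a 1%N = 0 by [].
have e9 : a 9%N = 0 by [].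
have e2 : a 2%N = 0 by [].
have e5 : a 5%N = 0 by [].
have e6 : a 6%N = 0 by [].
have e3 : a 3%N = 0 by move: g1; rewrite ec add0r.
have e7 : a 7%N = 0 by move: h2; rewrite ec add0r.
have e8 : a 8%N = 0.
  have a4 : a 4%N = - a 8%N by apply/eqP; rewrite -addr_eq0 g2.
  have a10 : a 10%N = a 4%N by apply/eqP; rewrite -subr_eq0 addrC g3.
  have /eqP : - 3%:R * a 8%N = 0 by rewrite -[RHS]h4 a10 a4; ring.
  by rewrite mulf_eq0 oppr_eq0 pnatr_eq0 /= => /eqP.
have e0 : a 0%N = 0 by move: f1; rewrite e8 mulr0 addr0.
have e4 : a 4%N = 0 by move: g2; rewrite e8 addr0.
have e10 : a 10%N = 0 by move: g3; rewrite e4 oppr0 add0r.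
have e11 : a 11%N = 0 by apply: oppr_inj; move: h3; rewrite ec e7 addr0 oppr0 add0r.
have {}a0 : all (fun k => at_index u k == 0) (iota 0 12).
  by rewrite /= -/a e0 e1 e2 e3 e4 e5 e6 e7 e8 e9 e10 e11 eqxx.
split=> [|j]; first by [].
by apply/eqP; rewrite -at_indexE; apply: (allP a0); rewrite mem_iota /=.
Qed.

(** Substituting [M] gives a linear form [l] times [M x], whose second factor is absorbed on the
    left; only [l] up to a scalar counts. *)
Lemma zeta_chain_exists : exists c, irreducible_chain (lrorbit (@zeta K)) 10 c.
Proof.
apply: (@orbit_chain_exists 10 zeta [:: 99; 8; 9; 99; 99; 99; 99; 99; 99]%N).
  by apply: (ev_neq0 (ev_zeta 1 1 1)); rewrite mulr1 oner_eq0.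
move=> c u H; pose a := at_index u; have a99 : at_index u 99 = 0 by rewrite /at_index insubN.
have {}H x y z : [/\ c * x ^+ 2 + (a 0%N + 2%:R * a 8%N) * (x * y) + 0 * y ^+ 2 + (a 1%N + 2%:R * a 9%N) * (x * z) + 0 * (y * z) + 0 * z ^+ 2 = 0,
    a 2%N * x ^+ 2 + (c + a 3%N) * (x * y) + a 8%N * y ^+ 2 + a 4%N * (x * z) + a 9%N * (y * z) + 0 * z ^+ 2 = 0 &
    a 5%N * x ^+ 2 + a 6%N * (x * y) + 0 * y ^+ 2 + (c + a 7%N) * (x * z) + a 8%N * (y * z) + a 9%N * z ^+ 2 = 0].
  have := H (v3 x y z); rewrite !index_mxE scalar_m3 a99 polar_zeta ev_zeta !m3_v3 add_v3 !v3E.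
  by move=> /v3_eq0[E0 E1 E2]; rewrite /a; split; [rewrite -[RHS]E0|rewrite -[RHS]E1|rewrite -[RHS]E2]; ring.
have [f0 f1 f2 [f3 f4 f5]] := @quadratic_eq0 _ _ _ _ _ _ (fun x y z => let: And3 p0 p1 p2 := H x y z in p0).
have [g0 g1 g2 [g3 g4 g5]] := @quadratic_eq0 _ _ _ _ _ _ (fun x y z => let: And3 p0 p1 p2 := H x y z in p1).
have [h0 h1 h2 [h3 h4 h5]] := @quadratic_eq0 _ _ _ _ _ _ (fun x y z => let: And3 p0 p1 p2 := H x y z in p2).
have ec : c = 0 by [].
have e8 : a 8%N = 0 by [].
have e9 : a 9%N = 0 by [].
have e0 : a 0%N = 0 by move: f1; rewrite e8 mulr0 addr0.
have e1 : a 1%N = 0 by move: f3; rewrite e9 mulr0 addr0.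
have e2 : a 2%N = 0 by [].
have e3 : a 3%N = 0 by move: g1; rewrite ec add0r.
have e4 : a 4%N = 0 by [].
have e5 : a 5%N = 0 by [].
have e6 : a 6%N = 0 by [].
have e7 : a 7%N = 0 by move: h3; rewrite ec add0r.
have {}a0 : all (fun k => at_index u k == 0) (iota 0 10).
  by rewrite /= -/a e0 e1 e2 e3 e4 e5 e6 e7 e8 e9 eqxx.
split=> [|j]; first by [].
by apply/eqP; rewrite -at_indexE; apply: (allP a0); rewrite mem_iota /=.
Qed.

End DimensionLowerBounds.

(** * Upper bounds from finitely many charts *)

Section DimensionUpperBounds.
Context {K : numFieldType}.
Local Open Scope classical_set_scope.
Implicit Types (x : 'cV[K]_3) (f : quadtriple K).

(** The standard affine chart number [j] of projective [n]-space. *)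
Definition unit_row n (j : 'I_n.+1) (t : 'I_n -> K) (k : 'I_n.+1) : K :=
  if unlift j k is Some l then t l else 1.

Definition zero_row n (j : 'I_n.+1) (t : 'I_n -> K) (k : 'I_n.+1) : K :=
  if unlift j k is Some l then t l else 0.

Lemma unit_row_exists n (r : 'I_n.+1 -> K) : (exists k, r k != 0) ->
  exists (j : 'I_n.+1) (a : K) (t : 'I_n -> K), forall k, r k = a * unit_row j t k.
Proof.
move=> [j rj]; exists j, (r j), (fun l => r (lift j l) / r j) => k.
rewrite /unit_row; case: unliftP => [l ->|->]; last by rewrite mulr1.
by rewrite mulrC divfK.
Qed.

Lemma zero_row_exists n (r : 'I_n.+1 -> K) j (t : 'I_n -> K) :
  exists g : 'I_n -> K, forall k, r k = r j * unit_row j t k + zero_row j g k.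
Proof.
exists (fun l => r (lift j l) - r j * t l) => k; rewrite /unit_row /zero_row.
case: unliftP => [l ->|->]; first by rewrite addrC subrK.
by rewrite mulr1 addr0.
Qed.

Definition rows3 (r0 r1 r2 : 'I_3 -> K) : 'M[K]_3 :=
  \matrix_(i, k) (tnth [tuple r0; r1; r2] i) k.

Definition dot (r : 'I_3 -> K) x : K := \sum_k r k * x k 0.

Lemma rows3_mul r0 r1 r2 x : rows3 r0 r1 r2 *m x = v3 (dot r0 x) (dot r1 x) (dot r2 x).
Proof.
by apply: cv3P; rewrite v3E mxE; apply: eq_bigr => k _; rewrite mxE.
Qed.

Lemma mulmx_dot (M : 'M[K]_3) x : M *m x = v3 (dot (M i0) x) (dot (M i1) x) (dot (M i2) x).
Proof. by apply: cv3P; rewrite v3E mxE. Qed.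

Lemma dotZ (r g : 'I_3 -> K) a x : (forall k, r k = a * g k) -> dot r x = a * dot g x.
Proof. by move=> rE; rewrite /dot mulr_sumr; apply: eq_bigr => k _; rewrite rE mulrA. Qed.

Lemma dotD (r g h : 'I_3 -> K) x : (forall k, r k = g k + h k) -> dot r x = dot g x + dot h x.
Proof.
by move=> rE; rewrite /dot -big_split; apply: eq_bigr => k _ /=; rewrite rE mulrDl.
Qed.

Lemma unitmx_rows_free (M : 'M[K]_3) u0 u1 u2 : M \in unitmx ->
  (forall k, u0 * M i0 k + u1 * M i1 k + u2 * M i2 k = 0) -> [/\ u0 = 0, u1 = 0 & u2 = 0].
Proof.
move=> uM H; pose u : 'rV[K]_3 := \row_i tnth [tuple u0; u1; u2] i.
have uM0 : u *m M = 0 by apply/rowP => k; rewrite !mxE sum3 !mxE H.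
have u0' : u = 0 by rewrite -[u](mulmxK uM) uM0 mul0mx.
by split; [have /rowP/(_ i0) := u0'|have /rowP/(_ i1) := u0'|have /rowP/(_ i2) := u0'];
  rewrite !mxE.
Qed.

Lemma polynomial_fun_unit_row (I : finType) n (j : 'I_n.+1) (t : (I -> K) -> 'I_n -> K) k :
  (forall l, polynomial_fun (fun u => t u l)) ->
  polynomial_fun (fun u => unit_row j (t u) k).
Proof.
move=> tP; rewrite /unit_row; case: unlift => [l|]; first exact: tP.
exact: polynomial_fun_cst.
Qed.

Lemma polynomial_fun_zero_row (I : finType) n (j : 'I_n.+1) (t : (I -> K) -> 'I_n -> K) k :
  (forall l, polynomial_fun (fun u => t u l)) ->
  polynomial_fun (fun u => zero_row j (t u) k).
Proof.
move=> tP; rewrite /zero_row; case: unlift => [l|]; first exact: tP.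
exact: polynomial_fun_cst.
Qed.

Lemma polynomial_fun_rows3 (I : finType) (r0 r1 r2 : (I -> K) -> 'I_3 -> K) :
  (forall k, polynomial_fun (fun u => r0 u k)) ->
  (forall k, polynomial_fun (fun u => r1 u k)) ->
  (forall k, polynomial_fun (fun u => r2 u k)) ->
  forall i k, polynomial_fun (fun u => rows3 (r0 u) (r1 u) (r2 u) i k).
Proof.
move=> P0 P1 P2 i k.
have E u : rows3 (r0 u) (r1 u) (r2 u) i k = tnth [tuple r0 u; r1 u; r2 u] i k by rewrite mxE.
rewrite (_ : (fun u => _) = fun u => tnth [tuple r0 u; r1 u; r2 u] i k); last by apply/funext.
by move: i {E}; apply: ord3_ind; [exact: P0|exact: P1|exact: P2].
Qed.

(* Charts for an orbit: A ranges over all matrices and M over normal forms. *)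
Lemma orbit_chain_le (C J : finType) d f (M : C -> (J -> K) -> 'M[K]_3) n c :
  #|J| = d -> (forall k i j, polynomial_fun (fun t => M k t i j)) ->
  (forall N : 'M[K]_3, N \in unitmx -> exists k t (B : 'M[K]_3), forall x,
     ev f (N *m x) = B *m ev f (M k t *m x)) ->
  irreducible_chain (lrorbit f) n c -> (n <= d + 8)%N.
Proof.
move=> cJ MP norm; have [s fE] := quad_surj f.
pose I : finType := (('I_3 * 'I_3) + J)%type.
pose A (t : I -> K) : 'M[K]_3 := \matrix_(i, j) t (inl (i, j)).
pose M' k (t : I -> K) := M k (t \o inr).
apply: (charts_chain_le (I := I) (w := fun k t => lrquad s (A t) (M' k t) (M' k t))).
- by rewrite card_sum card_prod !card_ord cJ; lia.
- move=> k; have M'P i j : polynomial_fun (fun t => M' k t i j).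
    by apply: (polynomial_fun_comp (MP k i j)) => l; exact: polynomial_fun_var.
  apply: polynomial_map_lrquad => // i j.
  rewrite (_ : (fun t => _) = fun t : I -> K => t (inl (i, j))).
    exact: polynomial_fun_var.
  by apply/funext => t; rewrite mxE.
move=> v [L fL vL]; have /(lrorbitP _ vL)[B [N [_ uN vE]]] := fL.
have [k [t [B' NE]]] := norm N uN.
pose t' (i : I) := match i with inl p => (B *m B') p.1 p.2 | inr j => t j end.
exists k, t'; apply: ev_inj => x.
have -> : A t' = B *m B' by apply/matrixP => i j; rewrite [LHS]mxE.
by rewrite (ev_lrquad_diag fE) vE NE mulmxA.
Qed.

Lemma unitmx_row_neq0 (N : 'M[K]_3) i : N \in unitmx -> exists k, N i k != 0.
Proof.
move=> uN; apply: contrapT => n0; move: uN; rewrite unitmxE (expand_det_row _ i) big1 ?unitr0 // => k _.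
by have [->|nk] := eqVneq (N i k) 0; [rewrite mul0r|case: n0; exists k].
Qed.

(** Rescaling the rows of [N] multiplies the products by constants, which a diagonal matrix
    restores; each row keeps two parameters. *)
Lemma sigma_chain_le n c : irreducible_chain (Sigma3 K) n c -> (n <= 14)%N.
Proof.
pose C : finType := ('I_3 * 'I_3 * 'I_3)%type.
pose J : finType := ('I_3 * 'I_2)%type.
pose M (k : C) (t : J -> K) := rows3 (unit_row k.1.1 (fun l => t (i0, l)))
  (unit_row k.1.2 (fun l => t (i1, l))) (unit_row k.2 (fun l => t (i2, l))).
apply: (@orbit_chain_le C J 6 sigma M); first by rewrite card_prod !card_ord.
  move=> k i j; apply: polynomial_fun_rows3 => l; apply: polynomial_fun_unit_row => l';
    exact: polynomial_fun_var.
move=> N uN.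
have [j0 [a0 [t0 E0]]] := unit_row_exists (unitmx_row_neq0 i0 uN).
have [j1 [a1 [t1 E1]]] := unit_row_exists (unitmx_row_neq0 i1 uN).
have [j2 [a2 [t2 E2]]] := unit_row_exists (unitmx_row_neq0 i2 uN).
pose t (p : J) := tnth [tuple t0; t1; t2] p.1 p.2.
exists (j0, j1, j2), t, (m3 (a1 * a2) 0 0 0 (a0 * a2) 0 0 0 (a0 * a1)) => x.
have -> : M (j0, j1, j2) t = rows3 (unit_row j0 t0) (unit_row j1 t1) (unit_row j2 t2) by [].
rewrite mulmx_dot (dotZ _ E0) (dotZ _ E1) (dotZ _ E2) rows3_mul !ev_sigma m3_v3.
by congr v3; ring.
Qed.

(** Row [0] may be reduced modulo row [2], since this changes [x0 x1] by a multiple of [x1 x2];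
    after scaling, rows [2], [1], [0] keep [2 + 2 + 1] parameters. *)
Lemma rho_chain_le n c : irreducible_chain (Sigma2 K) n c -> (n <= 13)%N.
Proof.
pose C : finType := ('I_3 * 'I_3 * 'I_2)%type.
pose J : finType := ('I_2 + 'I_2 + 'I_1)%type.
pose M (k : C) (t : J -> K) :=
  rows3 (zero_row k.1.1 (unit_row k.2 (fun l => t (inr l))))
    (unit_row k.1.2 (fun l => t (inl (inr l)))) (unit_row k.1.1 (fun l => t (inl (inl l)))).
apply: (@orbit_chain_le C J 5 rho M); first by rewrite !card_sum !card_ord.
  move=> k i j; apply: polynomial_fun_rows3 => l.
  - apply: polynomial_fun_zero_row => l'; apply: polynomial_fun_unit_row => l''.
    exact: polynomial_fun_var.
  - by apply: polynomial_fun_unit_row => l'; exact: polynomial_fun_var.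
  - by apply: polynomial_fun_unit_row => l'; exact: polynomial_fun_var.
move=> N uN.
have [j1 [a1 [t1 E1]]] := unit_row_exists (unitmx_row_neq0 i1 uN).
have [j2 [a2 [t2 E2]]] := unit_row_exists (unitmx_row_neq0 i2 uN).
have [g gE] := zero_row_exists (N i0) j2 t2; set m := N i0 j2 in gE.
have a20 : a2 != 0.
  by have [k] := unitmx_row_neq0 i2 uN; rewrite E2; apply: contraNneq => ->; rewrite mul0r.
have gn0 : exists l, g l != 0.
  apply: contrapT => n0; have [e _ _] : [/\ 1 = 0 :> K, 0 = 0 :> K & - (m / a2) = 0].
    apply: (unitmx_rows_free uN) => k.
    rewrite gE E2 mulrA mulNr divfK // mul1r mul0r addr0 mulNr addrAC subrr add0r.
    rewrite /zero_row; case: unliftP => // l _.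
    by have [//|gl] := eqVneq (g l) 0; case: n0; exists l.
  by move/eqP: e; rewrite oner_eq0.
have [j0 [a0 [t0 E0]]] := unit_row_exists gn0.
exists (j2, j1, j0), (fun p => match p with inr l => t0 l | inl (inr l) => t1 l | inl (inl l) => t2 l end),
  (m3 (a0 * a1) 0 (m * a1) 0 (a2 ^+ 2) 0 0 0 (a1 * a2)) => x.
have -> : N *m x = v3 (m * dot (unit_row j2 t2) x + a0 * dot (zero_row j2 (unit_row j0 t0)) x)
    (a1 * dot (unit_row j1 t1) x) (a2 * dot (unit_row j2 t2) x).
  rewrite mulmx_dot (dotZ _ E1) (dotZ _ E2) (dotD _ gE); congr (v3 (_ + _) _ _).
    exact: dotZ.
  apply: dotZ => k; rewrite /zero_row; case: unlift => [l|]; last by rewrite mulr0.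
  by rewrite E0.
by rewrite rows3_mul !ev_rho m3_v3; congr v3; ring.
Qed.

(** Row [1] may be reduced modulo row [0], and row [2] modulo both. Rows [0] and [1] are scaled
    freely, but row [2] is not, so that its single entry stays: [2 + 1 + 1] parameters. *)
Lemma tau_chain_le n c : irreducible_chain (Sigma1 K) n c -> (n <= 12)%N.
Proof.
pose C : finType := ('I_3 * 'I_2)%type.
pose J : finType := ('I_2 + 'I_1 + 'I_1)%type.
pose M (k : C) (t : J -> K) :=
  rows3 (unit_row k.1 (fun l => t (inl (inl l))))
    (zero_row k.1 (unit_row k.2 (fun l => t (inl (inr l)))))
    (zero_row k.1 (zero_row k.2 (fun l => t (inr l)))).
apply: (@orbit_chain_le C J 4 tau M); first by rewrite !card_sum !card_ord.
  move=> k i j; apply: polynomial_fun_rows3 => l.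
  - by apply: polynomial_fun_unit_row => l'; exact: polynomial_fun_var.
  - apply: polynomial_fun_zero_row => l'; apply: polynomial_fun_unit_row => l''.
    exact: polynomial_fun_var.
  - apply: polynomial_fun_zero_row => l'; apply: polynomial_fun_zero_row => l''.
    exact: polynomial_fun_var.
move=> N uN.
have [j0 [a [t0 E0]]] := unit_row_exists (unitmx_row_neq0 i0 uN).
have a0 : a != 0.
  by have [k] := unitmx_row_neq0 i0 uN; rewrite E0; apply: contraNneq => ->; rewrite mul0r.
have [g gE] := zero_row_exists (N i1) j0 t0; set m := N i1 j0 in gE.
have gn0 : exists l, g l != 0.
  apply: contrapT => n0; have [_ e _] : [/\ - (m / a) = 0, 1 = 0 :> K & 0 = 0 :> K].
    apply: (unitmx_rows_free uN) => k.
    rewrite gE E0 mulrA mulNr divfK // mul1r mul0r addr0 mulNr addrA addNr add0r.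
    rewrite /zero_row; case: unliftP => // l _.
    by have [//|gl] := eqVneq (g l) 0; case: n0; exists l.
  by move/eqP: e; rewrite oner_eq0.
have [j1 [b [t1 E1]]] := unit_row_exists gn0.
have b0 : b != 0.
  by have [l] := gn0; rewrite E1; apply: contraNneq => ->; rewrite mul0r.
have [h hE] := zero_row_exists (N i2) j0 t0; set p := N i2 j0 in hE.
have [q qE] := zero_row_exists h j1 t1; set r := h j1 in qE.
(* From [b^2 z1^2 - a z0 z2 = b^2 (z1^2 - (a / b^2) z0 z2)]: the scales of rows [0] and [1] fix that
   of row [2]. *)
exists (j0, j1), (fun i => match i with inr l => a / b ^+ 2 * q l | inl (inr l) => t1 l | inl (inl l) => t0 l end),
  (m3 (a ^+ 2) 0 0 (a * m) (a * b) 0 (m ^+ 2 - a * p) (2%:R * m * b - a * r) (b ^+ 2)) => x.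
pose z0 := dot (unit_row j0 t0) x; pose z1 := dot (zero_row j0 (unit_row j1 t1)) x.
pose z2 := dot (zero_row j0 (zero_row j1 q)) x.
have -> : N *m x = v3 (a * z0) (m * z0 + b * z1) (p * z0 + (r * z1 + z2)).
  rewrite mulmx_dot (dotZ _ E0) (dotD _ gE) (dotD _ hE); congr (v3 _ (_ + _) (_ + _)).
  - exact: dotZ.
  - apply: dotZ => k; rewrite /zero_row; case: unlift => [l|]; last by rewrite mulr0.
    by rewrite E1.
  - exact: dotZ.
  rewrite (dotD (g := fun k => r * zero_row j0 (unit_row j1 t1) k)
    (h := zero_row j0 (zero_row j1 q))); first by congr (_ + _); exact: dotZ.
  move=> k; rewrite {1 2 3}/zero_row; case: unlift => [l|]; first exact: qE.
  by rewrite mulr0 addr0.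
rewrite rows3_mul -/z0 -/z1.
have -> : dot (zero_row j0 (zero_row j1 (fun l => a / b ^+ 2 * q l))) x = a / b ^+ 2 * z2.
  apply: dotZ => k; rewrite /zero_row; case: unlift => [l|]; last by rewrite mulr0.
  by case: unlift => [l'|]; rewrite ?mulr0.
by rewrite !ev_tau m3_v3; congr v3; field.
Qed.

(** The charts multiply a normalized linear form, with two parameters, by an arbitrary matrix, with
    nine; the scale of the form is moved into the matrix. *)
Lemma zeta_chain_le n c : irreducible_chain (lrorbit (@zeta K)) n c -> (n <= 10)%N.
Proof.
pose I : finType := (('I_3 * 'I_3) + 'I_2)%type.
pose r (j : 'I_3) (t : I -> K) := unit_row j (fun l => t (inr l)).
apply: (charts_chain_le (I := I) (w := fun (j : 'I_3) t =>
  quad (fun i k l => r j t k * t (inl (i, l))))).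
- by rewrite card_sum card_prod !card_ord.
- move=> j; apply: polynomial_map_quad => i k l; apply: polynomial_funM; last exact: polynomial_fun_var.
  by apply: polynomial_fun_unit_row => l'; exact: polynomial_fun_var.
move=> v [L fL vL].
have /factored_zeta[a [N [a0 uN vE]]] : lr_equiv (ev zeta) (ev v) by exact/(lrorbitP _ vL).
have [|j [b [t E]]] := @unit_row_exists 2 (fun k => a 0 k).
  apply: contrapT => n0; case/eqP: a0; apply/rowP => k; rewrite mxE.
  by have [//|ak] := eqVneq (a 0 k) 0; case: n0; exists k.
pose t' (i : I) := match i with inl p => b * N p.1 p.2 | inr l => t l end.
exists j, t'; apply: ev_inj => x; apply/colP => i.
rewrite vE ev_quad !mxE.
have -> : \sum_k a 0 k * x k 0 = b * \sum_k unit_row j t k * x k 0.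
  by rewrite mulr_sumr; apply: eq_bigr => k _; rewrite E mulrA.
rewrite -mulrA big_distrlr mulr_sumr; apply: eq_bigr => k _ /=.
by rewrite mulr_sumr; apply: eq_bigr => l _; rewrite /r /=; ring.
Qed.

Lemma has_dim_Sigma0 : has_dim (Sigma0 K) 10.
Proof. by rewrite Sigma0_orbit; split; [exact: zeta_chain_exists|exact: zeta_chain_le]. Qed.

Lemma has_dim_Sigma1 : has_dim (Sigma1 K) 12.
Proof. by split; [exact: tau_chain_exists|exact: tau_chain_le]. Qed.

Lemma has_dim_Sigma2 : has_dim (Sigma2 K) 13.
Proof. by split; [exact: rho_chain_exists|exact: rho_chain_le]. Qed.

Lemma has_dim_Sigma3 : has_dim (Sigma3 K) 14.
Proof. by split; [exact: sigma_chain_exists|exact: sigma_chain_le]. Qed.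

End DimensionUpperBounds.

Local Open Scope classical_set_scope.

Theorem mainTheorem3 (R : realType) :
  (zclosure_in (Bir2 R[i]) (Sigma0 R[i]) = Sigma0 R[i]) /\
  (zclosure_in (Bir2 R[i]) (Sigma1 R[i]) = Sigma0 R[i] `|` Sigma1 R[i]) /\
  (zclosure_in (Bir2 R[i]) (Sigma2 R[i]) =
     Sigma0 R[i] `|` Sigma1 R[i] `|` Sigma2 R[i]) /\
  (oBir2 R[i] = Sigma1 R[i] `|` Sigma2 R[i] `|` Sigma3 R[i]) /\
  (Bir2 R[i] = zclosure_in (Bir2 R[i]) (Sigma3 R[i])) /\
  (zclosure_in (Bir2 R[i]) (Sigma3 R[i]) =
     Sigma0 R[i] `|` Sigma1 R[i] `|` Sigma2 R[i] `|` Sigma3 R[i]) /\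
  has_dim (Sigma0 R[i]) 10 /\
  has_dim (Sigma1 R[i]) 12 /\
  has_dim (Sigma2 R[i]) 13 /\
  has_dim (Sigma3 R[i]) 14.
Proof.
have BirE := @Bir2_decomposition R[i].
split; first exact: zclosure_Sigma0.
split; first exact: zclosure_Sigma1.
split; first exact: zclosure_Sigma2.
split; first exact: oBir2_decomposition.
split; first by rewrite zclosure_Sigma3.
split; first by rewrite zclosure_Sigma3.
split; first exact: has_dim_Sigma0.
split; first exact: has_dim_Sigma1.
split; first exact: has_dim_Sigma2.
exact: has_dim_Sigma3.
Qed.
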